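(* Let $r\ge1$, let $D\subset\mathbb R^n$ be a simply connected domain and $M:=D\times\mathbb R$. Let $v=(v^1,\dots,v^{n+1})\in C^r(M,\mathbb R^{n+1})$ be such that $v^{n+1}(x)\neq0$ for all $x\in M$ and $\left|\frac{v^i}{v^{n+1}}\right|\le C$ on $M$ for all $i$ and some constant $C$. Let $\omega:=\sum_{k=1}^{n+1}v^k\,dx_k$ be integrable. Then there are functions $f\in C^r(M,\mathbb R)$ and $\lambda\in C^{r-1}(M,\mathbb R)$ satisfying $\lambda(x)\neq0$ for all $x\in M$ and \[ df=\lambda\,\omega . \]
   Context: A one-form $\omega$ is called integrable if $\omega\wedge d\omega=0$. Here $x_1,\dots,x_{n+1}$ are the standard coordinates on $M=D\times\mathbb R\subset\mathbb R^{n+1}$. *)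

(* Defs.v *)
From HB Require Import structures.
From mathcomp Require Export all_boot all_order all_algebra perm.
From mathcomp Require Export all_classical all_reals all_analysis.
Export Order.TTheory GRing.Theory Num.Theory.
Export numFieldNormedType.Exports.

Set Implicit Arguments.
Unset Strict Implicit.
Unset Printing Implicit Defensive.

Local Open Scope classical_set_scope.
Local Open Scope ring_scope.

(* Maps and forms are total on 'rV[R]_m; only their values on the open set
   under consideration are ever used. *)

(* f is of class C^r on the open set U: all partial derivatives of order
   at most r exist and are continuous on U. *)
Fixpoint class_C (R : realType) (m : nat) (W : normedModType R) (r : nat)
    (U : set 'rV[R]_m) (f : 'rV[R]_m -> W) : Prop :=
  {within U, continuous f} /\
  (if r is r'.+1 then
     forall i : 'I_m,
       (forall x, U x -> derivable f x (delta_mx 0 i)) /\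
       class_C r' U (fun x => 'D_(delta_mx 0 i) f x)
   else True).

(* A domain is a nonempty connected open set. *)
Definition domain (R : realType) (m : nat) (D : set 'rV[R]_m) : Prop :=
  [/\ open D, D !=set0 & connected D].

Definition path_connected (R : realType) (m : nat) (D : set 'rV[R]_m) : Prop :=
  forall a b, D a -> D b ->
  exists c : R -> 'rV[R]_m,
    [/\ {within `[0, 1], continuous c},
        (forall t, t \in `[0, 1] -> D (c t)), c 0 = a & c 1 = b].

(* The homotopy H s t has deformation parameter s and loop parameter t. *)
Definition loops_null_homotopic (R : realType) (m : nat)
    (D : set 'rV[R]_m) : Prop :=
  forall c : R -> 'rV[R]_m,
    {within `[0, 1], continuous c} ->
    (forall t, t \in `[0, 1] -> D (c t)) -> c 0 = c 1 ->
  exists H : R -> R -> 'rV[R]_m,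
    [/\ {within `[0, 1] `*` `[0, 1], continuous (fun p : R * R => H p.1 p.2)},
        (forall s t, s \in `[0, 1] -> t \in `[0, 1] -> D (H s t)),
        (forall t, t \in `[0, 1] -> H 0 t = c t),
        (forall t, t \in `[0, 1] -> H 1 t = c 0) &
        (forall s, s \in `[0, 1] -> H s 0 = c 0 /\ H s 1 = c 0)].

Definition simply_connected (R : realType) (m : nat)
    (D : set 'rV[R]_m) : Prop :=
  path_connected D /\ loops_null_homotopic D.

(* D x R inside R^(n+1): the last coordinate is the R factor. *)
Definition cylinder (R : realType) (n : nat) (D : set 'rV[R]_n) :
  set 'rV[R]_n.+1 := [set x | D (col' ord_max x)].

(* A k-form on R^m as the function of a point x and of k tangent vectors, the
   rows of V.  Multilinearity and alternation in V are not imposed: they hold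
   where the coefficients are differentiable, for the forms built below. *)
Definition form (R : realType) (m k : nat) : Type :=
  'rV[R]_m -> 'M[R]_(k, m) -> R.

Definition form0 (R : realType) (m : nat) (f : 'rV[R]_m -> R) : form R m 0 :=
  fun x _ => f x.

(* (d w)_x(v_0, ..., v_k)
     = sum_i (-1)^i (D_(v_i) w)_x(v_0, ..., v_(i-1), v_(i+1), ..., v_k) *)
Definition extd (R : realType) (m k : nat) (w : form R m k) : form R m k.+1 :=
  fun x V => \sum_(i < k.+1)
    (-1) ^+ i * 'D_(row i V) (fun y => w y (row' i V)) x.

(* (a /\ b)(v_1, ..., v_(p+q)) = 1/(p! q!) sum_s sgn(s)
     a(v_s(1), ..., v_s(p)) b(v_s(p+1), ..., v_s(p+q)) *)
Definition wedge (R : realType) (m p q : nat) (a : form R m p)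
    (b : form R m q) : form R m (p + q) :=
  fun x V => (p`! * q`!)%:R^-1 * \sum_(s : 'S_(p + q))
    (-1) ^+ s * a x (usubmx (row_perm s V)) * b x (dsubmx (row_perm s V)).

Definition dx (R : realType) (m : nat) (k : 'I_m) : form R m 1 :=
  extd (form0 (fun x : 'rV[R]_m => x 0 k)).

Definition one_form (R : realType) (m : nat) (v : 'rV[R]_m -> 'rV[R]_m) :
  form R m 1 := fun x V => \sum_(k < m) v x 0 k * dx k x V.

Definition integrable_form (R : realType) (m : nat) (U : set 'rV[R]_m)
    (w : form R m 1) : Prop :=
  forall x, U x -> forall V, wedge w (extd w) x V = 0.

Lemma dxE (R : realType) (m : nat) (k : 'I_m) (x : 'rV[R]_m)
  (V : 'M[R]_(1, m)) : dx k x V = V 0 k.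
Proof.
rewrite /dx /extd big_ord1 expr0 mul1r /form0 /derive.
apply: cvg_lim => //.
apply: cvg_trans (cvg_cst (V 0 k)).
apply: near_eq_cvg; near=> h.
rewrite /= !mxE addrK /GRing.scale /= mulrA mulVf ?mul1r //.
by near: h; exact: nbhs_dnbhs_neq.
Unshelve. all: try end_near; exact: dnbhs_filter. Qed.

(* Main.v *)
(* Normalize [omega] to [w] with last coefficient 1.  Its leaves are graphs over
   [D], and above a curve in [D] a leaf solves a scalar ODE whose right-hand side
   is bounded by assumption, so it exists above the whole curve.  The variation of
   the solutions above a segment is explicit: by integrability the linearized
   equation is solved in closed form, so the transport [T] to the fibre above the
   end point satisfies [dT = g w] with [g > 0].  Hence [T] is constant on leaves,
   the transport above small triangles is trivial, and since [D] is simply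
   connected transport to a fixed fibre is well defined; it is the function [f].
   Its regularity comes from expressing [g], and the derivatives of integrals
   along leaves, through integrals of the same kind. *)

From HB Require Import structures.
Require Import Defs.
From mathcomp Require Import all_boot all_order all_algebra.
From mathcomp Require Import ring lra.
From mathcomp Require Import all_classical all_reals all_analysis.
Import Order.TTheory GRing.Theory Num.Theory.
Import numFieldNormedType.Exports.

Set Implicit Arguments.
Unset Strict Implicit.
Unset Printing Implicit Defensive.

Local Open Scope classical_set_scope.
Local Open Scope ring_scope.

(** * Calculus on the unit interval *)

(** Two obstacles shape the argument. The closed form of the variation avoids this: a perturbation
    [u] of the starting point [x] becomes, at time [t], a vector with horizontal part
    [(1 - t) *: hz u] on which [w] takes the value [ip w x u] multiplied by [g x / g (X t)].
    Everything thus depends on the curve through functions of the moving point [X t], so no new kind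
    of integral appears. The factor [g] has one order less than [w], but [dT = g w] gives that order
    back to [T]. Second, a null homotopy is only continuous, so its curves cannot be lifted by a
    differential equation. Only straight segments are lifted, a leaf is a chain of such lifts, and
    the homotopy enters through its values on a grid. The segments end on a fixed fibre, so [T] is
    defined on all fibres over a neighbourhood. The global function is the height on one chosen
    fibre; near any other fibre it is a function of one variable composed with [T], and
    connectedness of [D] carries regularity and nonvanishing from fibre to fibre. *)

Lemma MVT_closed (R : realType) (f df : R -> R) (a b : R) : a < b ->
  (forall t : R, a <= t <= b -> is_derive t 1 f (df t)) ->
  exists2 t, a <= t <= b & f b - f a = df t * (b - a).
Proof.
move=> ab fd; have [||c] := @MVT R f df a b ab.
- by move=> x; rewrite in_itv/= => /andP[ax xb]; apply: fd; rewrite !ltW.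
- apply: continuous_in_subspaceT => x; rewrite inE/= in_itv/= => xab.
  apply: differentiable_continuous; apply/derivable1_diffP.
  by have [] := fd _ xab.
- by rewrite in_itv/= => /andP[ac cb] E; exists c; rewrite ?ltW.
Qed.

Lemma primitive_exists (R : realType) (phi : R -> R) : continuous phi ->
  exists P : R -> R,
    P 0 = 0 /\ forall t : R, 0 <= t <= 1 -> is_derive t 1 P (phi t).
Proof.
move=> cphi.
(* Starting the integral at [-1] keeps [[0, 1]] to the right of the lower limit, so the derivative
   at [0] is two-sided as well. *)
pose F x : R := (\int[lebesgue_measure]_(t in [set` `[-1, x]]) (phi t))%R.
exists (fun t => F t - F 0); split => [|t /andP[t0 t1]]; first by rewrite subrr.
have [] := @continuous_FTC1_closed R phi (-1) t (t + 1).
- by rewrite ltrDl.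
- apply: continuous_compact_integrable; first exact: segment_compact.
  exact: continuous_subspaceT.
- lra.
- exact: cphi.
move=> dF; rewrite derive1E => EF.
have iF : is_derive t 1 F (phi t) by rewrite -EF; exact: derivableP.
by apply: is_derive_eq; rewrite subr0.
Qed.

Section Integral01.
Context {R : realType}.
Implicit Types (phi psi : R -> R) (I J k d : R).

(** The integral is recorded through a primitive: bounds and uniqueness then come from the mean
    value theorem, and linearity from the rules of derivation. *)
Definition has_int01 phi I := exists P : R -> R,
  [/\ P 0 = 0, P 1 = I & forall t : R, 0 <= t <= 1 -> is_derive t 1 P (phi t)].

Lemma has_int01_bound phi I d : has_int01 phi I ->
  (forall t : R, 0 <= t <= 1 -> `|phi t| <= d) -> `|I| <= d.
Proof.
move=> [P [P0 <- dP]] phid; have [t t01] := MVT_closed ltr01 dP.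
by rewrite P0 !subr0 mulr1 => ->; exact: phid.
Qed.

Lemma has_int01_comb phi psi I J k : has_int01 phi I -> has_int01 psi J ->
  has_int01 (fun t => phi t + k * psi t) (I + k * J).
Proof.
move=> [P [P0 <- dP]] [Q [Q0 <- dQ]]; exists (fun t => P t + k * Q t); split=> //.
  by rewrite P0 Q0 mulr0 addr0.
move=> t t01; have dPt := dP _ t01; have dQt := dQ _ t01.
exact: is_derive_eq.
Qed.

Lemma has_int01_unique phi psi I J : (forall t : R, 0 <= t <= 1 -> phi t = psi t) ->
  has_int01 phi I -> has_int01 psi J -> I = J.
Proof.
move=> e hI hJ; have := @has_int01_bound _ _ 0 (has_int01_comb (-1) hI hJ).
rewrite normr_le0 mulN1r subr_eq0 => h; apply/eqP/h => t t01.
by rewrite e// mulN1r subrr normr0.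
Qed.

Definition int01 phi : R := xget 0 [set I | has_int01 phi I].

(** Composing with this retraction extends a function controlled only on [[0, 1]] to one continuous
    on the whole line; it also truncates heights in the differential equation. *)
Definition clip (a b t : R) : R := Num.max a (Num.min t b).

Lemma clip_id a b t : a <= t <= b -> clip a b t = t.
Proof. by move=> /andP[h1 h2]; rewrite /clip min_l// max_r. Qed.

Lemma clip_itv a b t : a <= b -> a <= clip a b t <= b.
Proof. by move=> ab; rewrite /clip le_max lexx ge_max ab ge_min lexx orbT. Qed.

Lemma clip_continuous a b : continuous (clip a b).
Proof.
move=> t; apply: (@continuous_max R _ (cst a) (fun t => Num.min t b)).
  exact: cst_continuous.
by apply: (@continuous_min R _ id (cst b)) => //; exact: cst_continuous.
Qed.

Lemma clip_lip a b s t : `|clip a b s - clip a b t| <= `|s - t|.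
Proof.
have h1 := ler_norm (s - t); have := ler_norm (- (s - t)); rewrite normrN => h2.
rewrite /clip /Num.min /Num.max ler_norml.
by case: (ltP s b) => ?; case: (ltP t b) => ?; do 2 case: ltP => ?;
  apply/andP; split; lra.
Qed.

Lemma int01P phi : continuous (phi \o clip 0 1) -> has_int01 phi (int01 phi).
Proof.
move=> /primitive_exists[P [P0 dP]]; rewrite /int01.
apply: (@xgetPex _ 0 [set I | has_int01 phi I]); exists (P 1); exists P; split=> // t t01.
by have := dP _ t01; rewrite /= clip_id.
Qed.

End Integral01.

Lemma continuous_pair (S T V : topologicalType) (f : S -> T) (g : S -> V) (t : S) :
  {for t, continuous f} -> {for t, continuous g} ->
  {for t, continuous (fun s => (f s, g s))}.
Proof. move=> cf cg; exact: (cvg_pair cf cg).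
Qed.

(** * Scalar comparison, Gronwall and geometric limits *)

Section OneDimensionalODE.
Context {R : realType}.

Lemma is_derive1_continuous (f : R -> R) (t a : R) :
  is_derive t 1 f a -> {for t, continuous f}.
Proof.
by move=> [d _]; apply: differentiable_continuous; apply/derivable1_diffP.
Qed.

Lemma continuous_clip (f : R -> R) :
  (forall t : R, 0 <= t <= 1 -> {for t, continuous f}) ->
  continuous (f \o clip 0 1).
Proof.
move=> cf t; apply: continuous_comp; first exact: clip_continuous.
exact/cf/clip_itv/ler01.
Qed.

Lemma is_derive_expR_scale (k t : R) :
  is_derive t 1 (fun s => expR (k * s)) (k * expR (k * t)).
Proof.
have h : is_derive t 1 (fun s => k * s) k.
  by apply: is_derive_eq; rewrite [_ *: _]mulr1.
rewrite mulrC; exact: (@is_derive1_comp R expR (fun s => k * s)).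
Qed.

Lemma ge0_derive_le (f df : R -> R) (t : R) : 0 <= t <= 1 ->
  (forall s : R, 0 <= s <= 1 -> is_derive s 1 f (df s)) ->
  (forall s : R, 0 <= s <= 1 -> 0 <= df s) -> f 0 <= f t.
Proof.
move=> /andP[t0 t1] fd d0; have [->//|tn0] := eqVneq t 0.
have [|s /andP[s0 st]|s /andP[s0 st]] := @MVT_closed _ f df 0 t; rewrite ?lt_def ?tn0//.
  by apply: fd; rewrite s0 (le_trans st).
by move=> E; rewrite -subr_ge0 E mulr_ge0 ?subr_ge0//; apply: d0; rewrite s0 (le_trans st).
Qed.

(** Both [h + f] and [h - f] have nonnegative derivative. *)
Lemma comparison (f df h dh : R -> R) (t : R) : 0 <= t <= 1 ->
  (forall s : R, 0 <= s <= 1 -> is_derive s 1 f (df s)) ->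
  (forall s : R, 0 <= s <= 1 -> is_derive s 1 h (dh s)) ->
  (forall s : R, 0 <= s <= 1 -> `|df s| <= dh s) ->
  `|f t - f 0| <= h t - h 0.
Proof.
move=> t01 fd hd le.
have hp : h 0 + f 0 <= h t + f t.
  apply: (@ge0_derive_le (fun s => h s + f s) (fun s => dh s + df s)) => // s s01.
    by have := fd _ s01; have := hd _ s01 => ? ?; exact: is_deriveD.
  by have := le _ s01; rewrite ler_norml => /andP[? ?]; lra.
have hm : h 0 - f 0 <= h t - f t.
  apply: (@ge0_derive_le (fun s => h s - f s) (fun s => dh s - df s)) => // s s01.
    by have := fd _ s01; have := hd _ s01 => ? ?; exact: is_deriveB.
  by have := le _ s01; rewrite ler_norml => /andP[? ?]; lra.
by rewrite ler_norml; apply/andP; split; lra.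
Qed.

(* [(w^2 + d^2) exp(-(2L+1)t)] is nonincreasing. *)
Lemma gronwall (w dw : R -> R) (L d : R) : 0 <= L -> 0 <= d -> w 0 = 0 ->
  (forall t : R, 0 <= t <= 1 -> is_derive t 1 w (dw t)) ->
  (forall t : R, 0 <= t <= 1 -> `|dw t| <= L * `|w t| + d) ->
  forall t : R, 0 <= t <= 1 -> `|w t| <= d * expR (L + 1).
Proof.
move=> L0 d0 w0 wd le t t01; pose k := 2 * L + 1.
pose V t := - ((w t ^+ 2 + d ^+ 2) * expR (- k * t)).
pose dV t := (k * (w t ^+ 2 + d ^+ 2) - 2 * w t * dw t) * expR (- k * t).
have : V 0 <= V t.
  apply: (@ge0_derive_le V dV t t01) => s s01.
    have h1 := wd _ s01; have h2 := is_derive_expR_scale (- k) s.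
    by apply: is_derive_eq; rewrite /dV /GRing.scale/=; ring.
  rewrite mulr_ge0 ?expR_ge0// subr_ge0.
  have h3 : w s * dw s <= `|w s| * (L * `|w s| + d).
    by rewrite (le_trans (ler_norm _))// normrM ler_wpM2l// le.
  rewrite -(real_normK (num_real (w s))) /k; have := normr_ge0 (w s).
  (* With [k = 2 L + 1] the bracket is at least [(x - d)^2 + 2 L d^2]. *)
  move: (`|w s|) h3 => x h3 x0; have : 0 <= (x - d) ^+ 2 by exact: sqr_ge0.
  by nra.
rewrite /V w0 mulr0 expR0 mulr1 expr0n add0r lerN2 mulNr expRN.
rewrite ler_pdivrMr ?expR_gt0// => h.
rewrite -(@ler_pXn2r _ 2) ?nnegrE ?mulr_ge0 ?expR_ge0//.
rewrite real_normK ?num_real// exprMn -expRM_natl.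
apply: (@le_trans _ _ (d ^+ 2 * expR (k * t))).
  by apply: le_trans h; rewrite lerDl sqr_ge0.
rewrite ler_wpM2l ?sqr_ge0// ler_expR /k; move/andP: t01 => [t0 t1]; nra.
Qed.

(** The intervals of radius [2 K / 2 ^+ n] about [u n] are nested, since consecutive radii differ by
    exactly the allowed step; the limit is the supremum of their left ends. *)
Lemma fast_cauchy (u : nat -> R) (K : R) :
  (forall n, `|u n.+1 - u n| <= K / 2 ^+ n) ->
  exists l, forall n, `|l - u n| <= 2 * K / 2 ^+ n.
Proof.
move=> uK; pose e n : R := 2 * K / 2 ^+ n.
have eS n : e n - e n.+1 = K / 2 ^+ n.
  by rewrite /e exprS; field; rewrite expf_neq0.
have K0 : 0 <= K by have := uK 0%N; rewrite divr1; exact: le_trans.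
have e0 n : 0 <= e n by rewrite /e !mulr_ge0// invr_ge0 exprn_ge0.
have /nondecreasing_seqP hb : forall n, u n - e n <= u n.+1 - e n.+1.
  by move=> n; have := uK n; rewrite -eS ler_norml => /andP[? ?]; lra.
have /nonincreasing_seqP ha : forall n, u n.+1 + e n.+1 <= u n + e n.
  by move=> n; have := uK n; rewrite -eS ler_norml => /andP[? ?]; lra.
have ab n m : u n - e n <= u m + e m.
  have := hb _ _ (leq_maxl n m); have := ha _ _ (leq_maxr n m).
  by have := e0 (maxn n m); lra.
exists (sup (range (fun n => u n - e n))) => n.
have : u n - e n <= sup (range (fun n => u n - e n)).
  by apply: ub_le_sup; [exists (u 0%N + e 0%N) => _ [m _ <-]|exists n].
have : sup (range (fun n => u n - e n)) <= u n + e n.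
  by apply: ge_sup; [exists (u n - e n), n|move=> _ [m _ <-]].
by move=> h1 h2; rewrite ler_norml -/(e n); apply/andP; split; lra.
Qed.

Lemma geometric_small (x K : R) : (forall n, `|x| <= K / 2 ^+ n) -> x = 0.
Proof.
move=> xK; apply/eqP; rewrite -normr_le0.
have : geometric K (2^-1) @ \oo --> (0 : R).
  by apply: cvg_geometric; rewrite ger0_norm ?invr_ge0// invf_lt1 ?ltr1n.
move=> cK; apply: (cvgr_to_ge cK).
by near=> n; rewrite /= exprVn; exact: xK.
Unshelve. all: by end_near. Qed.

End OneDimensionalODE.

(* Picard iteration, in the norm [sup |u t| * exp (- 2 * L * t)] where the step
   contracts by the factor [1 / 2]. *)
Section Picard.
Context {R : realType} (F : R -> R -> R) (L M : R).
Hypothesis L0 : 0 <= L.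
Hypothesis cF : continuous (fun p : R * R => F p.1 p.2).
Hypothesis FL : forall t z z', `|F t z - F t z'| <= L * `|z - z'|.
Hypothesis FM : forall t z, `|F t z| <= M.

Let is_step (u P : R -> R) :=
  P 0 = 0 /\ forall t : R, 0 <= t <= 1 -> is_derive t 1 P (F t (u t)).

Let step_exists u : continuous (u \o clip 0 1) -> exists P, is_step u P.
Proof.
move=> cu.
have : continuous (fun t => F (clip 0 1 t) ((u \o clip 0 1) t)).
  move=> t; apply: (@continuous_comp _ _ _
    (fun t => (clip 0 1 t, (u \o clip 0 1) t)) (fun p : R * R => F p.1 p.2)).
    by apply: continuous_pair; [exact: clip_continuous|exact: cu].
  exact: cF.
move=> /primitive_exists[P [P0 dP]]; exists P; split=> // t t01.
by have := dP _ t01; rewrite /= clip_id.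
Qed.

Let step u := xget u (is_step u).
Let U n := iter n step (fun=> 0).

Let U_continuous n : continuous (U n \o clip 0 1).
Proof.
elim: n => [|n IH]; first exact: cst_continuous.
have [_ d] := xgetPex (U n) (step_exists IH).
by apply: continuous_clip => t /d; exact: is_derive1_continuous.
Qed.

Let U_step n : is_step (U n) (U n.+1).
Proof. exact: (xgetPex _ (step_exists (@U_continuous n))). Qed.

Let M0 : 0 <= M. Proof. exact: le_trans (normr_ge0 _) (FM 0 0). Qed.

Let U_diff n t : 0 <= t <= 1 ->
  `|U n.+1 t - U n t| <= M / 2 ^+ n * expR (2 * L * t).
Proof.
elim: n t => [|n IH] t t01.
  have [U10 dU1] := U_step 0; rewrite subr0 expr0 divr1.
  have := @comparison R (U 1%N) _ (fun s => M * s) (fun=> M) t t01 dU1.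
  rewrite U10 mulr0 !subr0 => h; apply: le_trans (h _ _) _ => //.
  - by move=> s _; apply: is_derive_eq; rewrite [_ *: _]mulr1.
  rewrite ler_wpM2l//; apply: le_trans (expR_ge1Dx _).
  have : 0 <= 2 * L * t by case/andP: t01 => *; rewrite !mulr_ge0.
  by case/andP: t01 => *; lra.
have [U20 dU2] := U_step n.+1; have [U10 dU1] := U_step n.
pose A := M / 2 ^+ n.+1.
have := @comparison R (fun s => U n.+2 s - U n.+1 s)
  (fun s => F s (U n.+1 s) - F s (U n s)) (fun s => A * expR (2 * L * s))
  (fun s => A * (2 * L * expR (2 * L * s))) t t01.
rewrite U20 U10 !subr0 => h; apply: le_trans (h _ _ _) _.
- by move=> s s01; have := dU2 _ s01; have := dU1 _ s01 => ? ?; exact: is_deriveB.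
- by move=> s _; have ? := is_derive_expR_scale (2 * L) s; exact: is_deriveZ.
- move=> s s01; apply: le_trans (FL _ _ _) _.
  rewrite (le_trans (ler_wpM2l L0 (IH _ s01)))// /A exprS invfM.
  by rewrite le_eqVlt; apply/orP; left; apply/eqP; field; rewrite expf_neq0.
by rewrite gerBl mulr_ge0 ?expR_ge0// /A divr_ge0// exprn_ge0.
Qed.

(** The pointwise limit [u] of the iterates inherits their Lipschitz constant [M], so it is
    continuous and can be fed to the Picard operator once more; the result [v] agrees with [u] on
    [[0, 1]]. *)
Lemma picard : exists s, is_step s s.
Proof.
have K t : exists l, 0 <= t <= 1 ->
    forall n, `|l - U n t| <= 2 * (M * expR (2 * L)) / 2 ^+ n.
  have [t01|] := boolP (0 <= t <= 1); last by exists 0.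
  have [|l hl] := @fast_cauchy R (U^~ t) (M * expR (2 * L)).
    move=> n; rewrite mulrAC (le_trans (U_diff _ t01))// ler_wpM2l//.
      by rewrite divr_ge0// exprn_ge0.
    rewrite ler_expR; case/andP: t01 => t0 t1.
    by rewrite ler_piMr// mulr_ge0.
  by exists l.
have [u uU] := choice K; set K0 := 2 * _ in uU.
have UM n s t : 0 <= s <= 1 -> 0 <= t <= 1 -> `|U n s - U n t| <= M * `|s - t|.
  move=> s01 t01; case: n => [|n]; first by rewrite /= subrr normr0 mulr_ge0.
  have [_ dU] := U_step n.
  wlog st : s t s01 t01 / s < t.
    move=> W; have [st|ts|->] := ltgtP s t; first exact: W.
      by rewrite distrC [`|s - t|]distrC; exact: W.
    by rewrite !subrr normr0 mulr0.
  rewrite distrC [`|s - t|]distrC.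
  have [|r /andP[h1 h2] ->] := MVT_closed st (f := U n.+1) (df := fun t => F t (U n t)).
    move=> r /andP[? ?]; apply: dU; case/andP: s01 => *; case/andP: t01 => *.
    by apply/andP; split; lra.
  by rewrite normrM ler_wpM2r.
have uM s t : 0 <= s <= 1 -> 0 <= t <= 1 -> `|u s - u t| <= M * `|s - t|.
  (* A positive excess would be at most [2 K0 / 2 ^+ n] for every [n], hence zero. *)
  move=> s01 t01; rewrite -subr_le0 leNgt; apply/negP => h.
  suff E : `|u s - u t| - M * `|s - t| = 0 by rewrite E ltxx in h.
  apply: (@geometric_small R _ (2 * K0)) => n; rewrite gtr0_norm//.
  have := uU _ s01 n; have := uU _ t01 n; have := UM n _ _ s01 t01.
  rewrite -mulrA; set k := K0 / _ => h1 h2 h3.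
  have -> : u s - u t = (u s - U n s) + (U n s - U n t) - (u t - U n t) by ring.
  apply: le_trans (_ : `|u s - U n s| + `|U n s - U n t| + `|u t - U n t|
    - M * `|s - t| <= _); last by lra.
  by rewrite lerD2r (le_trans (ler_normB _ _))// lerD2r ler_normD.
have cu : continuous (u \o clip 0 1).
  move=> t; apply/cvgrPdist_le => e e0; near=> t' => /=.
  rewrite (le_trans (uM _ _ (clip_itv _ ler01) (clip_itv _ ler01)))//.
  rewrite (le_trans (ler_wpM2l M0 (clip_lip _ _ _ _)))//.
  apply: le_trans (_ : (M + 1) * `|t - t'| <= _).
    by rewrite ler_wpM2r// lerDl.
  rewrite mulrC -ler_pdivlMr ?ltr_wpDl//; near: t'.
  by apply: cvgr_dist_le => //; rewrite divr_gt0// ltr_wpDl.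
have [v [v0 dv]] := step_exists cu.
(* The witness is [v] and not [u]: nothing is known of [u] outside [[0, 1]], where the two-sided
   derivatives at the end points look. *)
exists v; split=> // t t01; have := dv _ t01; congr is_derive; congr F.
apply/eqP; rewrite -subr_eq0; apply/eqP.
apply: (@geometric_small R _ (L * K0 + K0)) => n.
have [U10 dU] := U_step n.
have := @comparison R (fun s => v s - U n.+1 s)
  (fun s => F s (u s) - F s (U n s)) (fun s => (L * (K0 / 2 ^+ n)) * s)
  (fun s => L * (K0 / 2 ^+ n)) t t01.
rewrite v0 U10 mulr0 !subr0 => h.
have K00 : 0 <= K0 by rewrite !mulr_ge0// expR_ge0.
have {h} h1 : `|v t - U n.+1 t| <= L * (K0 / 2 ^+ n) * t.
  apply: h.
  - by move=> s s01; have := dv _ s01; have := dU _ s01 => ? ?; exact: is_deriveB.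
  - by move=> s _; apply: is_derive_eq; rewrite [_ *: _]mulr1.
  - move=> s s01; apply: le_trans (FL _ _ _) _; apply: ler_wpM2l => //.
    exact: uU.
have h2 := uU _ t01 n.+1.
have -> : u t - v t = (u t - U n.+1 t) - (v t - U n.+1 t) by ring.
rewrite (le_trans (ler_normB _ _))// mulrDl addrC lerD//.
  rewrite (le_trans h1)// mulrA ler_piMr ?mulr_ge0 ?invr_ge0 ?exprn_ge0//.
  by case/andP: t01.
rewrite (le_trans h2)// ler_wpM2l// lef_pV2 ?posrE ?exprn_gt0//.
by rewrite ler_weXn2l// ler1n.
Unshelve. all: by end_near. Qed.

End Picard.

(** * Functions of class C^r *)

Section ClassC.
Context {R : realType} {m : nat}.
Implicit Types (U V : set 'rV[R]_m) (f g : 'rV[R]_m -> R) (r : nat).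

Local Notation e_ i := (delta_mx (0 : 'I_1) i : 'rV[R]_m).

Lemma class_C_continuous (W : normedModType R) U (f : 'rV[R]_m -> W) r x :
  open U -> class_C r U f -> U x -> {for x, continuous f}.
Proof.
move=> oU C Ux; have : {within U, continuous f} by case: r C => [|r] [].
by rewrite continuous_open_subspace// => h; apply: h; rewrite inE.
Qed.

Lemma class_C0I U f : open U -> (forall x, U x -> {for x, continuous f}) ->
  class_C 0 U f.
Proof.
by move=> oU cf; split=> //; rewrite continuous_open_subspace// => x /[!inE]/cf.
Qed.

Lemma class_C_partial (W : normedModType R) U (f : 'rV[R]_m -> W) r i :
  class_C r.+1 U f -> class_C r U (fun x => 'D_(e_ i) f x).
Proof. by move=> [_ /(_ i)[]]. Qed.

Lemma class_C_is_derive (W : normedModType R) U (f : 'rV[R]_m -> W) r i x :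
  class_C r.+1 U f -> U x -> is_derive x (e_ i) f ('D_(e_ i) f x).
Proof. by move=> [_ /(_ i)[d _]] Ux; apply: derivableP; exact: d. Qed.

(** Functions that agree near a point have the same derivatives there. The first integral is
    accessible only through such local models. *)
Lemma class_C_local U f r : open U ->
  (forall x, U x -> exists V g, [/\ open V, V x,
     forall y, V y -> f y = g y & class_C r V g]) -> class_C r U f.
Proof.
move=> oU; have near_fg h V g x : open V -> V x -> (forall y, V y -> h y = g y) ->
    \forall y \near x, g y = h y.
  by move=> oV Vx fg; near=> y; apply/esym/fg; near: y; exact: open_nbhs_nbhs.
have cloc s h : (forall x, U x -> exists V g, [/\ open V, V x,
    forall y, V y -> h y = g y & class_C s V g]) ->
    forall x, U x -> {for x, continuous h}.
  move=> loc x /loc[V [g [oV Vx fg /class_C_continuous cg]]].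
  suff : h @ x --> h x by [].
  have cgx : g @ x --> h x by rewrite fg//; exact: cg.
  apply: cvg_trans cgx; apply: (@near_eq_cvg _ _ (nbhs x)).
  exact: (near_fg h V g x oV Vx fg).
elim: r f => [|r IH] f loc; first exact: class_C0I (cloc _ _ loc).
split; first by have [] := class_C0I oU (cloc _ _ loc).
move=> i; split=> [x|].
  move=> /loc[V [g [oV Vx fg Cg]]].
  apply: (near_eq_derivable (near_fg _ _ _ _ oV Vx fg)).
  by have [] := class_C_is_derive i Cg Vx.
apply: IH => x /loc[V [g [oV Vx fg Cg]]].
exists V, (fun x => 'D_(e_ i) g x); split=> // [y Vy|]; last exact: class_C_partial.
by apply/esym/near_eq_derive; exact: near_fg fg.
Unshelve. all: by end_near. Qed.

Lemma class_C_eq U f g r : open U -> (forall x, U x -> f x = g x) ->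
  class_C r U g -> class_C r U f.
Proof. by move=> oU fg Cg; apply: class_C_local => // x Ux; exists U, g. Qed.

Lemma class_C_SI U f (df : 'I_m -> 'rV[R]_m -> R) r : open U ->
  (forall x, U x -> {for x, continuous f}) ->
  (forall i x, U x -> is_derive x (e_ i) f (df i x)) ->
  (forall i, class_C r U (df i)) -> class_C r.+1 U f.
Proof.
move=> oU cf dfx Cdf; split; first by have [] := class_C0I oU cf.
move=> i; split=> [x /(dfx i)[]//|].
by apply: class_C_eq (Cdf i) => // x /(dfx i)[].
Qed.

Lemma class_CW (W : normedModType R) U (f : 'rV[R]_m -> W) r :
  class_C r.+1 U f -> class_C r U f.
Proof.
elim: r f => [|r IH] f; first by case.
move=> [cf df]; split=> // i; have [d C] := df i; split=> //; exact: IH.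
Qed.

Lemma class_C_le (W : normedModType R) U (f : 'rV[R]_m -> W) r s : (r <= s)%N ->
  class_C s U f -> class_C r U f.
Proof.
move=> /subnKC <-; elim: (s - r)%N => [|k IH]; first by rewrite addn0.
by rewrite addnS => /class_CW.
Qed.

Lemma class_C_sub U V f r : open V -> V `<=` U -> open U ->
  class_C r U f -> class_C r V f.
Proof.
move=> oV VU oU; elim: r f => [|r IH] f Cf.
  by apply: class_C0I => // x /VU; exact: (class_C_continuous oU Cf).
apply: (@class_C_SI _ _ (fun i x => 'D_(e_ i) f x)) => //.
- by move=> x /VU; exact: (class_C_continuous oU Cf).
- by move=> i x /VU; exact: (class_C_is_derive i Cf).
- by move=> i; apply: IH; exact: class_C_partial.
Qed.

Lemma class_C_cst U (c : R) r : open U -> class_C r U (fun=> c).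
Proof.
move=> oU; elim: r c => [|r IH] c; first by apply: class_C0I => // x _; exact: cst_continuous.
by apply: (@class_C_SI _ _ (fun _ _ => 0)) => //; move=> x _; exact: cst_continuous.
Qed.

Lemma class_CD U f g r : open U -> class_C r U f -> class_C r U g ->
  class_C r U (fun x => f x + g x).
Proof.
move=> oU; elim: r f g => [|r IH] f g Cf Cg.
  apply: class_C0I => // x Ux.
  by apply: continuousD; [exact: (class_C_continuous oU Cf)|exact: (class_C_continuous oU Cg)].
apply: (@class_C_SI _ _ (fun i x => 'D_(e_ i) f x + 'D_(e_ i) g x)) => //.
- move=> x Ux.
  by apply: continuousD; [exact: (class_C_continuous oU Cf)|exact: (class_C_continuous oU Cg)].
- move=> i x Ux; have df := class_C_is_derive i Cf Ux.
  have dg := class_C_is_derive i Cg Ux; exact: is_deriveD.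
- by move=> i; apply: IH; exact: class_C_partial.
Qed.

Lemma class_CM U f g r : open U -> class_C r U f -> class_C r U g ->
  class_C r U (fun x => f x * g x).
Proof.
move=> oU; elim: r f g => [|r IH] f g Cf Cg.
  apply: class_C0I => // x Ux.
  by apply: continuousM; [exact: (class_C_continuous oU Cf)|exact: (class_C_continuous oU Cg)].
apply: (@class_C_SI _ _ (fun i x => f x * 'D_(e_ i) g x + g x * 'D_(e_ i) f x)) => //.
- move=> x Ux.
  by apply: continuousM; [exact: (class_C_continuous oU Cf)|exact: (class_C_continuous oU Cg)].
- move=> i x Ux; have df := class_C_is_derive i Cf Ux.
  have dg := class_C_is_derive i Cg Ux; exact: is_deriveM.
- by move=> i; apply: class_CD => //; apply: IH; try exact: class_CW; exact: class_C_partial.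
Qed.

Lemma class_CN U f r : open U -> class_C r U f -> class_C r U (fun x => - f x).
Proof.
move=> oU Cf; apply: (@class_C_eq _ _ (fun x => -1 * f x)) => //.
  by move=> x _; rewrite mulN1r.
by apply: class_CM => //; exact: class_C_cst.
Qed.

Lemma class_CB U f g r : open U -> class_C r U f -> class_C r U g ->
  class_C r U (fun x => f x - g x).
Proof. by move=> oU Cf Cg; apply: class_CD => //; exact: class_CN. Qed.

Lemma class_C_sum U I (s : seq I) (f : I -> 'rV[R]_m -> R) r : open U ->
  (forall i, class_C r U (f i)) -> class_C r U (fun x => \sum_(i <- s) f i x).
Proof.
move=> oU Cf; elim: s => [|i s IH].
  by apply: (@class_C_eq _ _ (fun=> 0)) => [//|x _|]; rewrite ?big_nil//; exact: class_C_cst.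
apply: (@class_C_eq _ _ (fun x => f i x + \sum_(i <- s) f i x)) => [//|x _|].
  by rewrite big_cons.
exact: class_CD.
Qed.

Lemma is_derive_coord j (x v : 'rV[R]_m) : is_derive x v (fun y => y 0 j) (v 0 j).
Proof.
have d : derivable (@id 'rV[R]_m) x v by exact: derivable_id.
have := derive_mx d.
rewrite derive_id => /matrixP/(_ 0 j); rewrite mxE => ->.
by apply: derivableP; exact: (derivable_mxP _ _ _).1.
Qed.

Lemma class_C_coord U j r : open U -> class_C r U (fun x : 'rV[R]_m => x 0 j).
Proof.
move=> oU; have c x : {for x, continuous (fun x : 'rV[R]_m => x 0 j)}.
  exact: coord_continuous.
case: r => [|r]; first exact: class_C0I.
apply: (@class_C_SI _ _ (fun i _ => (e_ i) 0 j)) => //.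
  by move=> i x _; exact: is_derive_coord.
by move=> i; exact: class_C_cst.
Qed.

Lemma class_C_inv U f r : open U -> (forall x, U x -> f x != 0) ->
  class_C r U f -> class_C r U (fun x => (f x)^-1).
Proof.
move=> oU f0; elim: r f f0 => [|r IH] f f0 Cf.
  by apply: class_C0I => // x Ux; apply: continuousV; [exact: f0|exact: (class_C_continuous oU Cf)].
apply: (@class_C_SI _ _ (fun i x => - ((f x)^-1 * (f x)^-1) * 'D_(e_ i) f x)) => //.
- by move=> x Ux; apply: continuousV; [exact: f0|exact: (class_C_continuous oU Cf)].
- move=> i x Ux; have df := class_C_is_derive i Cf Ux.
  rewrite -invfM -expr2; split; last exact/deriveV/ex_derive/f0.
  exact/derivableV/ex_derive/f0.
- move=> i; have CV := IH _ f0 (class_CW Cf).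
  by apply: class_CM => //; [apply: class_CN => //; exact: class_CM|exact: class_C_partial].
Qed.

(** One-variable counterpart of [class_C] on the whole line, for the outer functions of the
    compositions: [expR] and the restrictions of the first integral to fibres. *)
Fixpoint smooth1 r (h : R -> R) : Prop :=
  continuous h /\
  if r is r'.+1 then exists2 dh, (forall t : R, is_derive t 1 h (dh t)) & smooth1 r' dh
  else True.

Lemma smooth1_continuous r h : smooth1 r h -> continuous h.
Proof. by case: r => [|r] []. Qed.

Lemma smooth1_expR r : smooth1 r (@expR R).
Proof.
elim: r => [|r IH]; first by split=> //; exact: continuous_expR.
split; first exact: continuous_expR.
by exists expR => // t; exact: is_derive_expR.
Qed.

(** Restriction to the line [x + s *: v] reduces this to the chain rule on [R], so derivability of
    [f] in the single direction [v] suffices. *)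
Lemma is_derive_comp1 (h : R -> R) f (x v : 'rV[R]_m) (a b : R) :
  is_derive (f x) 1 h a -> is_derive x v f b ->
  is_derive x v (h \o f) (a * b).
Proof.
move=> dh [df <-].
have E g : (fun t : R => t^-1 *: ((g \o shift x) (t *: v) - g x)) =
   (fun t : R => t^-1 *: (((fun s : R => g (s *: v + x)) \o shift 0) (t *: 1) - g (0 *: v + x))).
  by apply/funext => t /=; rewrite scale0r add0r addr0 [_%:A]mulr1.
pose F (s : R) := f (s *: v + x).
have dF : is_derive (0 : R) 1 F ('D_v f x).
  by split; [exact: (derivable1P _ _ _).1|rewrite /derive E].
have dh' : is_derive (F 0) 1 h a by rewrite /F scale0r add0r.
have [c d] := is_derive1_comp dh' dF.
split; first exact: (derivable1P _ _ _).2.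
by rewrite /derive E -d.
Qed.

Lemma class_C_comp U f r h : open U -> smooth1 r h -> class_C r U f ->
  class_C r U (h \o f).
Proof.
move=> oU; elim: r h f => [|r IH] h f Sh Cf.
  apply: class_C0I => // x Ux; apply: continuous_comp.
    exact: (class_C_continuous oU Cf).
  exact: smooth1_continuous Sh _.
have [_ [dh hd Sdh]] := Sh.
apply: (@class_C_SI _ _ (fun i x => dh (f x) * 'D_(e_ i) f x)) => //.
- move=> x Ux; apply: continuous_comp; first exact: (class_C_continuous oU Cf).
  exact: smooth1_continuous Sh _.
- by move=> i x Ux; apply: is_derive_comp1 => //; exact: class_C_is_derive Cf Ux.
- move=> i; apply: class_CM => //; last exact: class_C_partial.
  by apply: IH => //; exact: class_CW.
Qed.

Lemma class_C_vec_coord U (v : 'rV[R]_m -> 'rV[R]_m) r j : open U ->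
  class_C r U v -> class_C r U (fun x => v x 0 j).
Proof.
move=> oU; elim: r v => [|r IH] v Cv.
  apply: class_C0I => // x Ux.
  apply: (@continuous_comp _ _ _ v (fun y : 'rV[R]_m => y 0 j)).
    exact: (class_C_continuous oU Cv).
  exact: coord_continuous.
apply: (@class_C_SI _ _ (fun i x => ('D_(e_ i) v x) 0 j)) => //.
- move=> x Ux; apply: (@continuous_comp _ _ _ v (fun y : 'rV[R]_m => y 0 j)).
    exact: (class_C_continuous oU Cv).
  exact: coord_continuous.
- move=> i x Ux; have [d _] := class_C_is_derive i Cv Ux.
  rewrite (derive_mx d) mxE; apply: derivableP.
  exact: (derivable_mxP _ _ _).1.
- by move=> i; apply: IH; exact: class_C_partial.
Qed.

End ClassC.

(** * Strict differentiability of functions of class C^1 *)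

Section StrictDifferentiability.
Context {R : realType} {m : nat}.
Implicit Types (U : set 'rV[R]_m) (f : 'rV[R]_m -> R) (x u w : 'rV[R]_m).

Local Notation e_ i := (delta_mx (0 : 'I_1) i : 'rV[R]_m).

Lemma row_coord_le u i : `|u 0 i| <= `|u|.
Proof.
rewrite [leRHS]/Num.Def.normr/= mx_normrE.
exact: (le_bigmax (0 : R) (fun ij : 'I_1 * 'I_m => `|u ij.1 ij.2|) (0, i)).
Qed.

Lemma row_norm_le u (d : R) : 0 <= d -> (forall i, `|u 0 i| <= d) -> `|u| <= d.
Proof.
move=> d0 ud; rewrite /Num.Def.normr/= mx_normrE; apply: bigmax_le => // -[i j] _ /=.
by rewrite ord1.
Qed.

(** Linear in [u] by construction, unlike ['D_u f x]; the two agree for functions of class C^1, see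
    [class_C1_is_derive]. *)
Definition ddir f x u : R := \sum_i u 0 i * 'D_(e_ i) f x.

Lemma ddirZ f x (a : R) u : ddir f x (a *: u) = a * ddir f x u.
Proof. by rewrite mulr_sumr; apply: eq_bigr => i _; rewrite !mxE mulrA. Qed.

Lemma ddirD f x u w : ddir f x (u + w) = ddir f x u + ddir f x w.
Proof. by rewrite -big_split; apply: eq_bigr => i _; rewrite !mxE mulrDl. Qed.

Lemma ddir_le f x u : `|ddir f x u| <= (\sum_i `|'D_(e_ i) f x|) * `|u|.
Proof.
rewrite mulr_suml; apply: le_trans (ler_norm_sum _ _ _) _.
by apply: ler_sum => i _; rewrite normrM mulrC ler_wpM2l// row_coord_le.
Qed.

Lemma ddir_delta f x i : ddir f x (e_ i) = 'D_(e_ i) f x.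
Proof.
rewrite /ddir (bigD1 i)//= big1 ?addr0 => [|j ji]; rewrite mxE eqxx/= ?eqxx ?mul1r//.
by rewrite (negbTE ji) mul0r.
Qed.

Lemma is_derive_line f x u (t : R) :
  derivable f (x + t *: u) u ->
  is_derive t 1 (fun s => f (x + s *: u)) ('D_u f (x + t *: u)).
Proof.
move=> df.
have E : (fun h : R => h^-1 *: ((f \o shift (x + t *: u)) (h *: u) - f (x + t *: u))) =
  (fun h : R => h^-1 *: (((fun s => f (x + s *: u)) \o shift t) (h *: 1) - f (x + t *: u))).
  apply/funext => h /=; congr (_ *: (f _ - _)).
  by rewrite [_%:A]mulr1 scalerDl addrCA.
by split; [rewrite /derivable -E|rewrite /derive -E].
Qed.

(** Both points of the increment move near [x]. This form is the one compatible with compactness: a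
    single radius serves all base points close to [x]. *)
Lemma strict_diff U f x (e : R) : open U -> class_C 1 U f -> U x -> 0 < e ->
  exists2 d, 0 < d & forall u w, `|x - u| < d -> `|x - w| < d ->
    [/\ U u, forall v, `|ddir f u v - ddir f x v| <= e * `|v| &
        `|f u - f w - ddir f x (u - w)| <= e * `|u - w|].
Proof.
move=> oU Cf Ux e0; pose e' := e / m.+1%:R.
have e'0 : 0 < e' by rewrite divr_gt0.
have : \forall q \near x, U q /\ forall i, `|'D_(e_ i) f x - 'D_(e_ i) f q| <= e'.
  near=> q; split; first by near: q; exact: open_nbhs_nbhs.
  move=> i; move: i; near: q; apply: filter_forall => i.
  apply: (@cvgr_dist_le _ _ _ (nbhs x) _ (fun q => 'D_(e_ i) f q)) => //.
  exact: (class_C_continuous oU (class_C_partial i Cf)).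
move=> /nbhs_normP[d d0 dU]; exists d => // u w ud wd.
have sum_le (a : 'I_m -> R) (b : R) : 0 <= b -> (forall i, `|a i| <= e' * b) ->
    `|\sum_i a i| <= e * b.
  move=> b0 ab; apply: le_trans (ler_norm_sum _ _ _) _.
  apply: (@le_trans _ _ (\sum_(i < m) e' * b)); first exact: ler_sum.
  rewrite sumr_const card_ord -mulrnAl ler_wpM2r// /e' -mulr_natr -mulrA.
  by rewrite ger_pMr// mulrC ler_pdivrMr// mul1r ler_nat.
split; first by have [] := dU u ud.
  move=> v; rewrite /ddir -sumrB; apply: sum_le => // i.
  rewrite -mulrBr normrM mulrC ler_pM ?row_coord_le// distrC.
  by have [_ /(_ i)] := dU _ ud.
(* The passage from [w] to [u] changes one coordinate at a time, so that only partial derivatives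
   occur. *)
pose q (k : nat) := \row_(j < m) (if (j < k)%N then u 0 j else w 0 j).
have q0 : q 0%N = w by apply/rowP => j; rewrite mxE.
have qm : q m = u by apply/rowP => j; rewrite mxE ltn_ord.
have qS (i : 'I_m) : q i.+1 = q i + (u 0 i - w 0 i) *: e_ i.
  apply/rowP => j; rewrite !mxE eqxx/= ltnS leq_eqVlt.
  have [->|ji] := eqVneq j i; first by rewrite eqxx ltnn mulr1 addrC subrK.
  by rewrite (inj_eq val_inj) (negbTE ji)/= mulr0 addr0.
(* In the sup norm the segment stays in the ball, its moving coordinate being a convex combination
   of those of [u] and [w]. *)
have box (i : 'I_m) (t : R) : 0 <= t <= 1 ->
    `|x - (q i + t *: ((u 0 i - w 0 i) *: e_ i))| < d.
  move=> /andP[t0 t1].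
  apply: (@le_lt_trans _ _ (Num.max `|x - u| `|x - w|)); last first.
    by rewrite gt_max ud wd.
  apply: row_norm_le => [|j]; first by rewrite le_max normr_ge0.
  have h1 := row_coord_le (x - u) j; have h2 := row_coord_le (x - w) j.
  rewrite !mxE eqxx/= in h1 h2 *.
  have [ji|ji] := eqVneq j i; last first.
    rewrite !mulr0 addr0 le_max; case: ifP => _; first by rewrite h1.
    by rewrite h2 orbT.
  rewrite ji ltnn mulr1 in h1 h2 *.
  have -> : x 0 i - (w 0 i + t * (u 0 i - w 0 i)) =
     t * (x 0 i - u 0 i) + (1 - t) * (x 0 i - w 0 i) by ring.
  have hM1 : `|x - u| <= Num.max `|x - u| `|x - w| by rewrite le_max lexx.
  have hM2 : `|x - w| <= Num.max `|x - u| `|x - w| by rewrite le_max lexx orbT.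
  move: (Num.max _ _) hM1 hM2 => M hM1 hM2.
  have t10 : 0 <= 1 - t by rewrite subr_ge0.
  rewrite (le_trans (ler_normD _ _))// !normrM (ger0_norm t0) (ger0_norm t10).
  have := ler_wpM2l t0 (le_trans h1 hM1).
  by have := ler_wpM2l t10 (le_trans h2 hM2); lra.
have step (i : 'I_m) : `|f (q i.+1) - f (q i) - (u 0 i - w 0 i) * 'D_(e_ i) f x|
    <= e' * `|u - w|.
  set a := u 0 i - w 0 i.
  have dt (t : R) : 0 <= t <= 1 -> is_derive t 1 (fun t => f (q i + t *: (a *: e_ i)))
      ('D_(e_ i) f (q i + (t * a) *: e_ i) * a).
    move=> t01; have [Uq _] := dU _ (box i t t01).
    rewrite -/a scalerA in Uq.
    have [df _] := class_C_is_derive i Cf Uq.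
    have dl := is_derive_line df.
    have ds : is_derive t 1 (fun t => t * a) a.
      by apply: is_derive_eq; rewrite scaler0 add0r [_ *: _]mulr1.
    have := @is_derive1_comp R (fun s => f (q i + s *: e_ i)) (fun t => t * a) _ _ _ dl ds; congr is_derive.
    by apply/funext => s /=; rewrite scalerA.
  have [t t01] := MVT_closed ltr01 dt.
  rewrite scale1r scale0r addr0 subr0 mulr1 qS => ->.
  rewrite mulrC -mulrBr normrM mulrC; apply: ler_pM => //.
    have [_ /(_ i)] := dU _ (box i t t01).
    by rewrite distrC -/a scalerA.
  by have := row_coord_le (u - w) i; rewrite !mxE.
have tele : f u - f w = \sum_(i < m) (f (q i.+1) - f (q i)).
  rewrite -qm -q0 -(big_mkord xpredT (fun i => f (q i.+1) - f (q i))).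
  by rewrite telescope_sumr.
rewrite tele /ddir -sumrB; apply: sum_le => // i.
by have := step i; rewrite !mxE.
Unshelve. all: by end_near. Qed.

Lemma class_C1_differentiable U f x : open U -> class_C 1 U f -> U x ->
  differentiable f x /\ forall u, 'd f x u = ddir f x u.
Proof.
move=> oU Cf Ux.
have lin : linear (ddir f x).
  by move=> a u w; rewrite ddirD ddirZ.
pose dm := GRing.isLinear.Build _ _ _ _ _ lin.
pose df : {linear _ -> _} := HB.pack (ddir f x) dm.
have cdf : continuous df.
  move=> u; apply: (@class_C_continuous _ _ _ setT (ddir f x) 0 u openT) => //.
  apply: class_C_sum => [|i]; first exact: openT.
  by apply: class_CM; [exact: openT|apply: class_C_coord|apply: class_C_cst]; exact: openT.
have E : f \o shift x = cst (f x) + df +o_ (0 : 'rV[R]_m) id.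
  apply/eqaddoP => e e0.
  have [d d0 dU] := strict_diff oU Cf Ux e0.
  have : \forall u \near (0 : 'rV[R]_m), `|u| < d by exact: nbhs0_lt.
  apply: filterS => u ud; rewrite -[X in `|X|]/(f (u + x) - (f x + ddir f x u)).
  have [||_ _] := dU (u + x) x; first by rewrite addrC opprD subrK normrN.
    by rewrite subrr normr0.
  by rewrite addrK opprD addrA.
have dE := diff_unique cdf E; split; last by move=> u; rewrite dE.
by apply/diff_locallyP; rewrite dE.
Qed.

Lemma class_C1_is_derive U f x u : open U -> class_C 1 U f -> U x ->
  is_derive x u f (ddir f x u).
Proof.
move=> oU Cf Ux; have [df dE] := class_C1_differentiable oU Cf Ux.
by split; [exact: diff_derivable|rewrite deriveE// dE].
Qed.

Lemma class_C1_chain U f (c : R -> 'rV[R]_m) (t : R) c' : open U -> class_C 1 U f ->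
  U (c t) -> is_derive t 1 c c' -> is_derive t 1 (f \o c) (ddir f (c t) c').
Proof.
move=> oU Cf Uc [dc <-]; have [df dE] := class_C1_differentiable oU Cf Uc.
have dct : differentiable c t by exact/derivable1_diffP.
have dfc : differentiable (f \o c) t by exact: differentiable_comp.
split; first exact/derivable1_diffP.
have -> : 'D_1 (f \o c) t = 'd (f \o c) t 1 by exact: deriveE.
have -> : 'D_1 c t = 'd c t 1 by exact: deriveE.
by have /(congr1 (fun g => g 1)) /= -> := diff_comp dct df; exact: dE.
Qed.

Lemma is_derive_row (c : R -> 'rV[R]_m) (c' : 'rV[R]_m) (t : R) :
  (forall i, is_derive t 1 (fun s => c s 0 i) (c' 0 i)) -> is_derive t 1 c c'.
Proof.
move=> ci; have d : derivable c t 1.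
  by apply/derivable_mxP => i j; rewrite ord1; have [] := ci j.
split=> //; rewrite derive_mx//; apply/rowP => j; rewrite mxE.
by have [] := ci j.
Qed.

End StrictDifferentiability.

(** * Estimates uniform along a compact curve *)

Section UniformOnSegment.
Context {R : realType}.

(** Compactness of [[0, 1]], in the form that makes pointwise estimates uniform in the curve
    parameter. *)
Lemma near_segment01 I (F : set_system I) (P : I -> R -> Prop) : Filter F ->
  (forall t : R, 0 <= t <= 1 ->
    \forall t' \near t & i \near F, 0 <= t' <= 1 -> P i t') ->
  \forall i \near F, forall t : R, 0 <= t <= 1 -> P i t.
Proof.
move=> FF loc.
have : near_covering_within (`[0, 1]%classic : set R).
  by apply/near_covering_withinP/compact_near_coveringP; exact: segment_compact.
move=> /(_ I F P FF) h.
have : \near F, `[0, 1]%classic `<=` P F.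
  apply: h => t; rewrite /= in_itv/= => /loc; apply: filterS => -[t' i] /=.
  by rewrite in_itv.
by apply: filterS => i Pi t t01; apply: Pi; rewrite /= in_itv.
Qed.

Context {m : nat}.
Implicit Types (U : set 'rV[R]_m) (f : 'rV[R]_m -> R) (X p : R -> 'rV[R]_m).

Lemma uniform_continuity I (F : set_system I) f X (Y : I -> R -> 'rV[R]_m) :
  Filter F ->
  (forall t : R, 0 <= t <= 1 -> {for t, continuous X}) ->
  (forall t : R, 0 <= t <= 1 -> {for X t, continuous f}) ->
  (forall e, 0 < e -> \forall i \near F, forall t : R, 0 <= t <= 1 ->
     `|Y i t - X t| <= e) ->
  forall e, 0 < e -> \forall i \near F, forall t : R, 0 <= t <= 1 ->
     `|f (Y i t) - f (X t)| <= e.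
Proof.
move=> FF cX cf XY e e0; apply: near_segment01 => t t01.
have e20 : 0 < e / 2 by rewrite divr_gt0.
have /cvgr_dist_le/(_ _ e20)/nbhs_normP[d d0 df] := cf _ t01.
have d20 : 0 < d / 2 by rewrite divr_gt0.
have XtX : \forall t' \near t, `|X t - X t'| < d / 2.
  by have /cvgr_dist_lt := cX _ t01; apply.
have YX := XY _ d20.
near=> t' i => t'01.
have h1 : `|X t - X t'| < d / 2 by near: t'.
have h2a : forall s : R, 0 <= s <= 1 -> `|Y i s - X s| <= d / 2 by near: i.
have h2 := h2a _ t'01.
have h3 : `|f (X t) - f (X t')| <= e / 2 by apply: df => /=; lra.
have h4 : `|f (X t) - f (Y i t')| <= e / 2.
  apply: df => /=.
  have -> : X t - Y i t' = (X t - X t') - (Y i t' - X t') by rewrite opprB addrA subrK.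
  by rewrite (le_lt_trans (ler_normB _ _))//; lra.
have -> : f (Y i t') - f (X t') = (f (X t) - f (X t')) - (f (X t) - f (Y i t')) by ring.
by rewrite (le_trans (ler_normB _ _))//; lra.
Unshelve. all: by end_near. Qed.

(** Strict differentiability at [X t] controls [f] between [X t'] and [Y h t'] for all [t'] near
    [t]; compactness does the rest. *)
Lemma uniform_differentiability U f X p (Y : R -> R -> 'rV[R]_m) :
  open U -> class_C 1 U f ->
  (forall t : R, 0 <= t <= 1 -> {for t, continuous X}) ->
  (forall t : R, 0 <= t <= 1 -> {for t, continuous p}) ->
  (forall t : R, 0 <= t <= 1 -> U (X t)) ->
  (forall e : R, 0 < e -> \forall h \near (0 : R), forall t : R, 0 <= t <= 1 ->
     `|Y h t - X t - h *: p t| <= e * `|h|) ->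
  forall e : R, 0 < e -> \forall h \near (0 : R), forall t : R, 0 <= t <= 1 ->
     `|f (Y h t) - f (X t) - h * ddir f (X t) (p t)| <= e * `|h|.
Proof.
move=> oU Cf cX cp UX XY e e0; apply: (@near_segment01 R (nbhs (0 : R))) => t t01.
pose K := `|p t| + 1; pose A := \sum_i `|'D_(delta_mx 0 i) f (X t)|.
have K0 : 0 < K by rewrite ltr_wpDl.
have A0 : 0 <= A by apply: sumr_ge0.
have D0 : 0 < 2 * K + 3 + A by lra.
(* The three error terms below add up to at most [e1 * (2 * K + 1 + A)] times the size of [h]. *)
pose e1 := e / (2 * K + 3 + A).
have e10 : 0 < e1 by rewrite divr_gt0.
have e1E : e1 * (2 * K + 3 + A) = e.
  by rewrite divfK// gt_eqF.
(* The cap [1] ensures that [Y h t' - X t'] is at most [K + 1] times the size of [h]. *)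
pose e2 := Num.min e1 1.
have e20 : 0 < e2 by rewrite lt_min e10 ltr01.
have [d d0 dU] := strict_diff oU Cf (UX _ t01) e20.
have d20 : 0 < d / 2 by rewrite divr_gt0.
have XtX : \forall t' \near t, `|X t - X t'| < d / 2.
  by have /cvgr_dist_lt := cX _ t01; apply.
have ptp : \forall t' \near t, `|p t - p t'| < 1.
  by have /cvgr_dist_lt := cp _ t01; apply.
have YX := XY _ e20.
have h_small : \forall h \near (0 : R), `|h| <= d / 2 / (K + 1).
  by apply: nbhs0_le; rewrite divr_gt0// ltr_wpDl// ltW.
near=> t' h => t'01.
have h1 : `|X t - X t'| < d / 2 by near: t'.
have h2a : forall s : R, 0 <= s <= 1 -> `|Y h s - X s - h *: p s| <= e2 * `|h|.
  by near: h.
have h2 := h2a _ t'01.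
have h3 : `|p t'| <= K.
  rewrite -[p t'](subKr (p t)) (le_trans (ler_normB _ _))// lerD2l ltW//.
  by near: t'.
have h4 : `|h| <= d / 2 / (K + 1).
  by near: h.
have e21 : e2 <= 1 by rewrite ge_min lexx orbT.
have e2e1 : e2 <= e1 by rewrite ge_min lexx.
have h5 : `|h *: p t'| <= K * `|h| by rewrite normrZ mulrC ler_wpM2r.
have h6 : `|Y h t' - X t'| <= (K + 1) * `|h|.
  rewrite -[_ - _](subrK (h *: p t')) (le_trans (ler_normD _ _))//.
  have : e2 * `|h| <= 1 * `|h| by rewrite ler_wpM2r.
  by lra.
have h7 : (K + 1) * `|h| <= d / 2 by rewrite mulrC -ler_pdivlMr// ltr_wpDl// ltW.
have YtX : `|X t - Y h t'| < d.
  have -> : X t - Y h t' = (X t - X t') - (Y h t' - X t') by rewrite opprB addrA subrK.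
  by rewrite (le_lt_trans (ler_normB _ _))//; lra.
have XtX' : `|X t - X t'| < d by lra.
have [_ _ D1] := dU _ _ YtX XtX'.
have [_ D2 _] := dU _ _ XtX' XtX'.
have {}D2 := D2 (p t').
have D3 := ddir_le f (X t) (Y h t' - X t' - h *: p t'); rewrite -/A in D3.
have -> : f (Y h t') - f (X t') - h * ddir f (X t') (p t') =
   (f (Y h t') - f (X t') - ddir f (X t) (Y h t' - X t')) +
   ddir f (X t) (Y h t' - X t' - h *: p t') -
   h * (ddir f (X t') (p t') - ddir f (X t) (p t')).
  rewrite (ddirD _ _ (Y h t' - X t') (- (h *: p t'))) -(scaleNr h (p t')) ddirZ; ring.
rewrite (le_trans (ler_normB _ _))// (le_trans (lerD (ler_normD _ _) (lexx _)))//.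
have h0 : 0 <= `|h| by [].
have B1 : e2 * `|Y h t' - X t'| <= e1 * ((K + 1) * `|h|) by rewrite ler_pM// ltW.
have B2 : A * `|Y h t' - X t' - h *: p t'| <= A * (e1 * `|h|).
  by rewrite ler_wpM2l// (le_trans h2)// ler_wpM2r.
have B3 : `|h * (ddir f (X t') (p t') - ddir f (X t) (p t'))| <= `|h| * (e1 * K).
  by rewrite normrM ler_wpM2l// (le_trans D2)// ler_pM// ltW.
rewrite -e1E; have : 0 <= e1 * `|h| by rewrite mulr_ge0// ltW.
move: (`|h|) B1 B2 B3 h0 => a B1 B2 B3 h0 ?.
have -> : e1 * (2 * K + 3 + A) * a = e1 * ((K + 1) * a) + A * (e1 * a) + a * (e1 * K) + 2 * (e1 * a) by ring.
by lra.
Unshelve. all: by end_near. Qed.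

Lemma compact_bound (K : set 'rV[R]_m) f : compact K ->
  (forall x, K x -> {for x, continuous f}) ->
  exists2 M, 0 <= M & forall x, K x -> `|f x| <= M.
Proof.
move=> cK cf; have [K0|/set0P[x0 Kx0]] := eqVneq K set0.
  by exists 0 => // x; rewrite K0.
have [x Kx xM] := @EVT_max_rV R m (fun x => `|f x|) K (ex_intro _ x0 Kx0) cK
  (continuous_in_subspaceT (fun x (xK : x \in K) =>
     continuous_comp (cf x (set_mem xK)) (@norm_continuous _ _ (f x)))).
by exists `|f x| => // y Ky; apply: xM; rewrite inE.
Qed.

End UniformOnSegment.

(** * Horizontal transport *)

Lemma nonexpansive_continuous (R : realType) (V W : normedModType R) (f : V -> W) :
  (forall x y, `|f x - f y| <= `|x - y|) -> continuous f.
Proof.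
move=> fl x; apply/cvgrPdist_le => e e0; near=> y.
by rewrite (le_trans (fl _ _))//; near: y.
Unshelve. all: by end_near. Qed.

Section HorizontalLines.
Context {R : realType} {n : nat}.
Implicit Types (U : set 'rV[R]_n.+1) (w : 'I_n.+1 -> 'rV[R]_n.+1 -> R).
Implicit Types (c x u p q : 'rV[R]_n.+1) (s : R -> R).

Definition evert : 'rV[R]_n.+1 := delta_mx 0 ord_max.
Local Notation e := evert.

(** Projection to the base kept inside the ambient space: points lie on one fibre exactly when their
    [hz] agree, without any change of dimension. *)
Definition hz u : 'rV[R]_n.+1 := u - u 0 ord_max *: e.

Lemma e_last : e 0 ord_max = 1.
Proof. by rewrite mxE !eqxx. Qed.

Lemma e_norm : `|e| <= 1.
Proof.
by apply: row_norm_le => // i; rewrite mxE eqxx/=; case: eqP; rewrite ?normr1 ?normr0.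
Qed.

Lemma hz_last u : hz u 0 ord_max = 0.
Proof. by rewrite !mxE !eqxx mulr1 subrr. Qed.

Lemma hzD u p : hz (u + p) = hz u + hz p.
Proof. by rewrite /hz !mxE scalerDl opprD addrACA. Qed.

Lemma hzZ (a : R) u : hz (a *: u) = a *: hz u.
Proof. by rewrite /hz !mxE scalerBr scalerA. Qed.

Lemma hzN u : hz (- u) = - hz u.
Proof. by rewrite -scaleN1r hzZ scaleN1r. Qed.

Lemma hzB u p : hz (u - p) = hz u - hz p.
Proof. by rewrite hzD hzN. Qed.

Lemma hz_e : hz e = 0.
Proof. by rewrite /hz e_last scale1r subrr. Qed.

Lemma hz_hz u : hz (hz u) = hz u.
Proof. by rewrite {1}/hz hz_last scale0r subr0. Qed.

Lemma hz_decomp u : u = hz u + u 0 ord_max *: e.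
Proof. by rewrite /hz subrK. Qed.

Lemma hz_coord u i : hz u 0 i = if i == ord_max then 0 else u 0 i.
Proof. by rewrite !mxE eqxx/=; case: eqP => [->|_]; rewrite ?mulr1 ?subrr// mulr0 subr0. Qed.

Lemma hz_norm u : `|hz u| <= `|u|.
Proof.
apply: row_norm_le => // i; rewrite hz_coord.
by case: eqP => _; [rewrite normr0|exact: row_coord_le].
Qed.

Lemma hz_continuous : continuous hz.
Proof. by apply: nonexpansive_continuous => x y; rewrite -hzB hz_norm. Qed.

Definition ip w x u : R := \sum_k w k x * u 0 k.
(** Derivative in direction [p] of the pairing with a frozen [q], see [ddir_ip]; the difference
    [dip w x p q - dip w x q p] is [dw(p, q)]. *)
Definition dip w x p q : R := \sum_k q 0 k * ddir (w k) x p.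

(* [w] is the form normalized to have last coefficient [1], and [in_frob] is
   [w /\ dw = 0] evaluated on two vectors of [ker w] and a transverse one. *)
Record integrable_normal U w (C : R) : Prop := IntegrableNormal {
  in_open : open U;
  in_vert : forall x (a : R), U x -> U (x + a *: e);
  in_last : forall x, U x -> w ord_max x = 1;
  in_C1 : forall k, class_C 1 U (w k);
  in_bound : forall k x, U x -> `|w k x| <= C;
  in_frob : forall x p q, U x -> ip w x p = 0 -> ip w x q = 0 ->
    dip w x p q = dip w x q p }.

Lemma ipD w x u p : ip w x (u + p) = ip w x u + ip w x p.
Proof. by rewrite -big_split; apply: eq_bigr => k _; rewrite !mxE mulrDr. Qed.

Lemma ipZ w x (a : R) u : ip w x (a *: u) = a * ip w x u.
Proof. by rewrite mulr_sumr; apply: eq_bigr => k _; rewrite !mxE mulrCA. Qed.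

Lemma ipN w x u : ip w x (- u) = - ip w x u.
Proof. by rewrite -scaleN1r ipZ mulN1r. Qed.

Lemma ipB w x u p : ip w x (u - p) = ip w x u - ip w x p.
Proof. by rewrite ipD ipN. Qed.

Lemma dipDr w x p q u : dip w x p (q + u) = dip w x p q + dip w x p u.
Proof. by rewrite -big_split; apply: eq_bigr => k _; rewrite !mxE mulrDl. Qed.

Lemma dipZr w x (a : R) p q : dip w x p (a *: q) = a * dip w x p q.
Proof. by rewrite mulr_sumr; apply: eq_bigr => k _; rewrite !mxE mulrA. Qed.

Lemma dipDl w x p q u : dip w x (p + u) q = dip w x p q + dip w x u q.
Proof. by rewrite -big_split; apply: eq_bigr => k _; rewrite ddirD mulrDr. Qed.

Lemma dipZl w x (a : R) p q : dip w x (a *: p) q = a * dip w x p q.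
Proof. by rewrite mulr_sumr; apply: eq_bigr => k _; rewrite ddirZ mulrCA. Qed.

Lemma sum_delta (F : 'I_n.+1 -> R) : \sum_k F k * e 0 k = F ord_max.
Proof.
rewrite (bigD1 ord_max)//= e_last mulr1 big1 ?addr0// => k /negbTE k0.
by rewrite mxE k0 andbF mulr0.
Qed.

Lemma ip_class_C U w r q : open U -> (forall k, class_C r U (w k)) ->
  class_C r U (fun x => ip w x q).
Proof.
move=> oU Cw; apply: class_C_sum => // k.
by apply: class_CM => //; exact: class_C_cst.
Qed.

Section Properties.
Variables (U : set 'rV[R]_n.+1) (w : 'I_n.+1 -> 'rV[R]_n.+1 -> R) (C : R).
Hypothesis Hw : integrable_normal U w C.

Let oU := in_open Hw.

Lemma ip_C1 q : class_C 1 U (fun x => ip w x q).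
Proof. exact: ip_class_C oU (in_C1 Hw). Qed.

Lemma ddir_ip x p q : U x -> ddir (fun y => ip w y q) x p = dip w x p q.
Proof.
move=> Ux; have [_ <-] := class_C1_is_derive p oU (ip_C1 q) Ux.
have d k : is_derive x p (w k) (ddir (w k) x p).
  exact: class_C1_is_derive oU (in_C1 Hw k) Ux.
have : is_derive x p (\sum_k (q 0 k *: w k)) (\sum_k (q 0 k *: ddir (w k) x p)).
  by apply: is_derive_sum => k; have ? := d k; exact: is_deriveZ.
move=> [_ h]; apply: etrans h; congr (derive _ _ _); apply/funext => y.
rewrite fct_sumE; by apply: eq_bigr => k _; rewrite mulrC.
Qed.

Lemma ip_e x : U x -> ip w x e = 1.
Proof. by move=> Ux; rewrite /ip sum_delta (in_last Hw). Qed.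

Lemma dip_e x p : U x -> dip w x p e = 0.
Proof.
move=> Ux; have [_] := class_C1_is_derive p oU (ip_C1 e) Ux.
rewrite ddir_ip// => <-; rewrite -[RHS](derive_cst (1 : R) x p).
by apply: near_eq_derive; near=> y; apply: ip_e; near: y; exact: open_nbhs_nbhs.
Unshelve. all: by end_near. Qed.

Lemma ip_hz x u : U x -> ip w x (hz u) = ip w x u - u 0 ord_max.
Proof. by move=> Ux; rewrite ipB ipZ ip_e// mulr1. Qed.

Lemma bound_ge0 x : U x -> 0 <= C.
Proof. by move=> /(in_bound Hw ord_max); exact: le_trans. Qed.

Lemma ip_le x u : U x -> `|ip w x u| <= n.+1%:R * C * `|u|.
Proof.
move=> Ux; apply: le_trans (ler_norm_sum _ _ _) _.
apply: (@le_trans _ _ (\sum_(k < n.+1) C * `|u|)).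
  by apply: ler_sum => k _; rewrite normrM ler_pM ?row_coord_le// (in_bound Hw).
by rewrite sumr_const card_ord -[leLHS]mulr_natl mulrA.
Qed.

Lemma ip_continuous q x : U x -> {for x, continuous (fun y => ip w y q)}.
Proof. exact: class_C_continuous oU (ip_C1 q). Qed.

(** The fibres over a closed ball of the base: convex and invariant under vertical translation, so a
    lifted segment cannot leave it by gaining height. *)
Definition tube c (rho : R) : set 'rV[R]_n.+1 := [set x | `|hz (x - c)| <= rho].

Lemma tube_vert c (rho a : R) x : tube c rho x -> tube c rho (x + a *: e).
Proof. by rewrite /tube/= addrAC (hzD (x - c)) hzZ hz_e scaler0 addr0. Qed.

Lemma slab_compact c (rho Z : R) :
  compact [set x | tube c rho x /\ `|x 0 ord_max| <= Z].
Proof.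
apply: bounded_closed_compact.
  exists (rho + `|c| + `|Z|); split; first exact: num_real.
  move=> M MZ x /= [xc xZ].
  have -> : x = hz (x - c) + hz c + x 0 ord_max *: e.
    by rewrite -hzD subrK -hz_decomp.
  apply: le_trans (ltW MZ).
  rewrite (le_trans (ler_normD _ _))// lerD//.
    by rewrite (le_trans (ler_normD _ _))// lerD// hz_norm.
  rewrite normrZ (le_trans (ler_wpM2l _ e_norm))// mulr1 (le_trans xZ)//.
  exact: ler_norm.
have closed_sublevel (f : 'rV[R]_n.+1 -> R) (a : R) : continuous f ->
    closed [set x | `|f x| <= a].
  move=> cf; apply: (@preimage_closed _ _ (fun x => `|f x|) [set t : R | t <= a]).
    move=> x _; apply: (@continuous_comp _ _ _ f Num.norm); first exact: cf.
    exact: norm_continuous.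
  exact: closed_le.
apply: closedI; last by apply: closed_sublevel; exact: coord_continuous.
have cn : continuous (fun x => `|hz (x - c)|).
  move=> x; apply: (@continuous_comp _ _ _ (fun x => hz (x - c)) Num.norm).
    apply: (@continuous_comp _ _ _ (fun x => x - c) hz); last exact: hz_continuous.
    by apply: continuousB => //; exact: cst_continuous.
  exact: norm_continuous.
have := closed_sublevel _ rho cn; congr closed; apply/funext => x /=.
by rewrite normr_id.
Qed.

(** Vertical derivatives of [w] are bounded only on slabs of bounded height, by compactness; hence
    the cut-off [Z], which [sol_bound] later makes harmless. *)
Lemma ip_lip c (rho Z : R) : tube c rho `<=` U ->
  exists2 L, 0 <= L & forall x (a b : R) u, tube c rho x ->
    `|x 0 ord_max + a| <= Z -> `|x 0 ord_max + b| <= Z ->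
    `|ip w (x + a *: e) u - ip w (x + b *: e) u| <= L * `|u| * `|a - b|.
Proof.
move=> tU.
have bnd k : exists M, 0 <= M /\ forall x, [set x | tube c rho x /\ `|x 0 ord_max| <= Z] x ->
    `|'D_e (w k) x| <= M.
  have [|M M0 MP] := compact_bound (@slab_compact c rho Z) (f := fun x => 'D_e (w k) x).
    move=> x [/tU Ux _]; apply: class_C_continuous oU _ Ux.
    exact: class_C_partial (in_C1 Hw k).
  by exists M.
have {bnd}[M MP] := choice bnd.
exists (\sum_k M k); first by apply: sumr_ge0 => k _; have [] := MP k.
move=> x a b u xt; wlog ab : a b / a < b.
  move=> W; have [ab|ba|->] := ltgtP a b; first exact: W.
    by move=> ? ?; rewrite distrC [`|a - b|]distrC; exact: W.
  by rewrite !subrr !normr0 mulr0.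
move=> aZ bZ; rewrite /ip -sumrB 2!mulr_suml.
apply: le_trans (ler_norm_sum _ _ _) _; apply: ler_sum => k _.
have [_ Mk] := MP k.
have inU (t : R) : U (x + t *: e) by apply: (in_vert Hw); exact: tU.
have dt (t : R) : a <= t <= b ->
    is_derive t 1 (fun t => w k (x + t *: e)) ('D_e (w k) (x + t *: e)).
  move=> _; apply: is_derive_line.
  by have [] := class_C_is_derive ord_max (in_C1 Hw k) (inU t).
have [t /andP[at_ tb] E] := MVT_closed ab dt.
have {}Mk : `|'D_e (w k) (x + t *: e)| <= M k.
  apply: Mk => /=; split; first exact: tube_vert.
  rewrite !mxE !eqxx mulr1 ler_norml.
  by move: aZ bZ; rewrite !ler_norml => /andP[? ?] /andP[? ?]; apply/andP; split; lra.
rewrite -mulrBl normrM -mulrA [`|u| * _]mulrC mulrA ler_pM ?row_coord_le//.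
by rewrite distrC E normrM [`|a - b|]distrC ler_wpM2r.
Qed.

End Properties.
End HorizontalLines.

Lemma continuous_scalel (R : realType) (T : topologicalType) (V : normedModType R)
  (f : T -> R) (v : V) (t : T) :
  {for t, continuous f} -> {for t, continuous (fun s => f s *: v)}.
Proof.
move=> cf; apply: (@continuous_comp _ _ _ f ( *:%R^~ v)) => //.
exact: scalel_continuous.
Qed.

(** * Horizontal lifts of segments: existence, uniqueness, continuous dependence *)

Section Transport.
Context {R : realType} {n : nat}.
Variables (U : set 'rV[R]_n.+1) (w : 'I_n.+1 -> 'rV[R]_n.+1 -> R) (C : R).
Hypothesis Hw : integrable_normal U w C.
Implicit Types (c x u : 'rV[R]_n.+1) (s : R -> R) (rho : R).

Local Notation e := evert.
Let oU := in_open Hw.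

(** Only the fibre of [c] counts: its height is projected away. *)
Definition dirn c x := hz (c - x).
Definition pt c x (t a : R) := x + t *: dirn c x + a *: e.
(* [sol c x t] is the height gained above the segment from [x] to the fibre of
   [c] by the curve [traj c x] that starts at [x] and is tangent to [ker w]. *)
Definition is_sol c x s := s 0 = 0 /\ forall t : R, 0 <= t <= 1 ->
  is_derive t 1 s (- ip w (pt c x t (s t)) (dirn c x)).
Definition sol c x := xget (fun=> 0) (is_sol c x).
Definition traj c x (t : R) := pt c x t (sol c x t).

Lemma pt_tube c0 rho c x (t a : R) : tube c0 rho c -> tube c0 rho x ->
  0 <= t <= 1 -> tube c0 rho (pt c x t a).
Proof.
rewrite /tube/= => hc hx /andP[t0 t1].
have -> : hz (pt c x t a - c0) = (1 - t) *: hz (x - c0) + t *: hz (c - c0).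
  rewrite /pt /dirn !(hzB, hzD, hzZ, hz_e, hz_hz) scaler0 addr0.
  by apply/rowP => i; rewrite !mxE; ring.
rewrite (le_trans (ler_normD _ _))// !normrZ ger0_norm ?subr_ge0// ger0_norm//.
have t10 : 0 <= 1 - t by rewrite subr_ge0.
by have := ler_wpM2l t0 hc; have := ler_wpM2l t10 hx; lra.
Qed.

Lemma line_last c x (t : R) : (x + t *: dirn c x) 0 ord_max = x 0 ord_max.
Proof. by rewrite 2!mxE hz_last mulr0 addr0. Qed.

Lemma tube_center c rho : 0 <= rho -> tube c rho c.
Proof. by rewrite /tube/= hzB subrr normr0. Qed.

Lemma pt_near c x x' (t a : R) : 0 <= t <= 1 ->
  `|pt c x' t a - pt c x t a| <= 2 * `|x' - x|.
Proof.
move=> /andP[t0 t1].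
have -> : pt c x' t a - pt c x t a = (x' - x) - t *: hz (x' - x).
  rewrite /pt /dirn !hzB; apply/rowP => i; rewrite !mxE; ring.
rewrite (le_trans (ler_normB _ _))// mulr_natl mulr2n lerD2l normrZ ger0_norm//.
have h := hz_norm (x' - x); have h0 := normr_ge0 (hz (x' - x)); nra.
Qed.

Lemma pt_continuous c x s (t : R) : {for t, continuous s} ->
  {for t, continuous (fun t => pt c x t (s t))}.
Proof.
move=> cs; apply: continuousD; last first.
  exact: continuous_scalel.
by apply: continuousD; [exact: cst_continuous|exact: continuous_scalel].
Qed.

Section WithTube.
Variables (c0 : 'rV[R]_n.+1) (rho : R).
Hypothesis tU : tube c0 rho `<=` U.

Lemma pt_in c x (t a : R) : tube c0 rho c -> tube c0 rho x ->
  0 <= t <= 1 -> U (pt c x t a).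
Proof. by move=> *; apply: tU; exact: pt_tube. Qed.

(** The slope is at most this constant because the normalized coefficients are bounded by [C]. This
    a priori bound excludes blow-up above the segment. *)
Lemma sol_bound c x s : tube c0 rho c -> tube c0 rho x -> is_sol c x s ->
  forall t : R, 0 <= t <= 1 -> `|s t| <= n.+1%:R * C * `|dirn c x|.
Proof.
move=> hc hx [s0 ds] t t01; set B := _ * `|_|.
have B0 : 0 <= B by rewrite !mulr_ge0//; exact: (bound_ge0 Hw (tU hx)).
have := @comparison R s _ (fun r => B * r) (fun=> B) t t01 ds.
rewrite s0 mulr0 !subr0 => h; apply: le_trans (h _ _) _.
- by move=> r _; apply: is_derive_eq; rewrite [_ *: _]mulr1.
- by move=> r r01; rewrite normrN; apply: (ip_le Hw); exact: pt_in.
- by case/andP: t01 => t0 t1; rewrite ler_piMr.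
Qed.

(** Gronwall with zero defect; [sol_bound] supplies the height up to which a Lipschitz constant is
    needed. *)
Lemma sol_unique c x s s' : tube c0 rho c -> tube c0 rho x ->
  is_sol c x s -> is_sol c x s' -> forall t : R, 0 <= t <= 1 -> s t = s' t.
Proof.
move=> hc hx hs hs' t t01.
pose B := n.+1%:R * C * `|dirn c x|.
have [L L0 LP] := ip_lip Hw (`|x 0 ord_max| + B) tU.
have b1 := sol_bound hc hx hs; have b2 := sol_bound hc hx hs'.
have [s0 ds] := hs; have [s'0 ds'] := hs'.
pose dw t := - ip w (pt c x t (s t)) (dirn c x) + ip w (pt c x t (s' t)) (dirn c x).
have := @gronwall R (fun t => s t - s' t) dw (L * `|dirn c x|) 0 _ _ _ _ _ t t01.
rewrite mul0r normr_le0 subr_eq0 => h; apply/eqP/h => //.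
- by rewrite mulr_ge0.
- by rewrite s0 s'0 subrr.
- move=> r r01; have := ds r r01; have := ds' r r01 => d1 d2.
  by apply: is_derive_eq; rewrite /dw opprK.
- move=> r r01; rewrite addr0 /dw addrC distrC.
  have xl (a : R) : (x + r *: dirn c x) 0 ord_max + a = x 0 ord_max + a.
    by rewrite line_last.
  have lx : tube c0 rho (x + r *: dirn c x).
    by have := pt_tube 0 hc hx r01; rewrite /pt scale0r addr0.
  have := LP _ (s r) (s' r) (dirn c x) lx; rewrite !xl distrC.
  apply; rewrite (le_trans (ler_normD _ _))// lerD2l ?b1 ?b2//.
Qed.

Lemma sol_exists c x : tube c0 rho c -> tube c0 rho x -> exists s, is_sol c x s.
Proof.
move=> hc hx; pose d := dirn c x; pose B := n.+1%:R * C * `|d|.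
have B0 : 0 <= B by rewrite !mulr_ge0//; exact: (bound_ge0 Hw (tU hx)).
have NB : - B <= B by lra.
have [L L0 LP] := ip_lip Hw (`|x 0 ord_max| + B) tU.
(* Clipping time and height makes the right-hand side continuous on the plane, bounded, and globally
   Lipschitz in the height, as [picard] requires. *)
pose q (p : R * R) := pt c x (clip 0 1 p.1) (clip (- B) B p.2).
pose F t a := - ip w (q (t, a)) d.
have qU p : U (q p) by apply: pt_in => //; exact: clip_itv.
have [||||s [s0 ds]] := @picard R F (L * `|d|) B.
- by rewrite mulr_ge0.
- rewrite (_ : (fun p => _) = (fun p => - ((fun y => ip w y d) \o q) p)); last first.
    by apply/funext => -[].
  move=> p; have cq : {for p, continuous q}.
    apply: continuousD; last first.
      apply: continuous_scalel.
      apply: (@continuous_comp _ _ _ snd (clip (- B) B)); first exact: cvg_snd.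
      exact: clip_continuous.
    apply: continuousD; first exact: cst_continuous.
    apply: continuous_scalel.
    apply: (@continuous_comp _ _ _ fst (clip 0 1)); first exact: cvg_fst.
    exact: clip_continuous.
  apply: (@continuousN _ _ _ ((fun y => ip w y d) \o q)).
  by apply: continuous_comp => //; exact: (ip_continuous Hw).
- move=> t a b; rewrite /F -opprD normrN.
  pose y := x + clip 0 1 t *: d.
  have yl : y 0 ord_max = x 0 ord_max.
    by rewrite line_last.
  have yt : tube c0 rho y.
    by have := pt_tube 0 hc hx (clip_itv t ler01); rewrite /pt scale0r addr0.
  have cB r : `|clip (- B) B r| <= B by rewrite ler_norml clip_itv.
  have h := LP y (clip (- B) B a) (clip (- B) B b) d yt.
  apply: le_trans (h _ _) _; rewrite ?yl ?(le_trans (ler_normD _ _))// ?lerD2l//.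
  by rewrite ler_wpM2l ?clip_lip// mulr_ge0.
- by move=> t a; rewrite normrN; apply: (ip_le Hw).
(* The truncated solution obeys the same a priori bound, so the truncation at [B] is never
   active. *)
have sB (t : R) : 0 <= t <= 1 -> `|s t| <= B.
  move=> t01; have := @comparison R s _ (fun r => B * r) (fun=> B) t t01 ds.
  rewrite s0 mulr0 !subr0 => h; apply: le_trans (h _ _) _.
  - by move=> r _; apply: is_derive_eq; rewrite [_ *: _]mulr1.
  - by move=> r r01; rewrite normrN; apply: (ip_le Hw).
  - by case/andP: t01 => t0 t1; rewrite ler_piMr.
exists s; split=> // t t01; have := ds t t01.
by rewrite /F /q/= !clip_id// -ler_norml sB.
Qed.

Lemma solP c x : tube c0 rho c -> tube c0 rho x -> is_sol c x (sol c x).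
Proof. by move=> hc hx; exact: (xgetPex _ (sol_exists hc hx)). Qed.

End WithTube.

Lemma sol_continuous c0 rho c x (t : R) : tube c0 rho `<=` U ->
  tube c0 rho c -> tube c0 rho x -> 0 <= t <= 1 -> {for t, continuous (sol c x)}.
Proof.
move=> tU hc hx t01; have [_ /(_ t t01)] := solP tU hc hx.
exact: is_derive1_continuous.
Qed.

Lemma traj_continuous c0 rho c x (t : R) : tube c0 rho `<=` U ->
  tube c0 rho c -> tube c0 rho x -> 0 <= t <= 1 -> {for t, continuous (traj c x)}.
Proof. by move=> tU hc hx t01; apply: pt_continuous; exact: (sol_continuous tU hc hx t01). Qed.

Definition otube c rho : set 'rV[R]_n.+1 := [set x | `|hz (x - c)| < rho].

Lemma otube_open c rho : open (otube c rho).
Proof.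
apply: (@open_comp _ _ (fun x => `|hz (x - c)|) [set t : R | t < rho]); last exact: open_lt.
move=> x _; apply: (@continuous_comp _ _ _ (fun x => hz (x - c)) Num.norm).
  apply: (@continuous_comp _ _ _ (fun x => x - c) hz); last exact: hz_continuous.
  by apply: continuousB => //; exact: cst_continuous.
exact: norm_continuous.
Qed.

Lemma otube_sub c rho : otube c rho `<=` tube c rho.
Proof. by move=> x; exact: ltW. Qed.

Lemma dirn_norm c rho x : tube c rho x -> `|dirn c x| <= rho.
Proof. by rewrite /tube/= /dirn -(opprB x) hzN normrN. Qed.

(** Neighbouring starting points have height equations with a common Lipschitz constant on one slab,
    and Gronwall compares them. *)
Lemma traj_near c rho x (d : R) : tube c rho `<=` U -> otube c rho x -> 0 < d ->
  \forall x' \near x, forall t : R, 0 <= t <= 1 -> `|traj c x' t - traj c x t| <= d.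
Proof.
move=> tU ox d0; have hx := otube_sub ox.
have rho0 : 0 <= rho by exact: le_trans (normr_ge0 _) hx.
have hc := tube_center c rho0.
have C0 : 0 <= C by exact: (bound_ge0 Hw (tU _ hx)).
pose A := n.+1%:R * C; have A0 : 0 <= A by rewrite mulr_ge0.
pose Z := `|x 0 ord_max| + 1 + A * rho.
have [L L0 LP] := ip_lip Hw Z tU.
pose G := expR (L * rho + 1); have G0 : 0 < G by exact: expR_gt0.
(* Gronwall multiplies the defect by [G]: half of [d] is spent on the height, the other half on the
   displacement of the underlying segment. *)
pose d1 := d / 2 / G.
have d10 : 0 < d1 by rewrite !divr_gt0.
pose X := traj c x.
have near_x (r : R) : 0 < r -> \forall x' \near x, `|x' - x| < r.
  by move=> r0; apply/nbhs_normP; exists r => //= y; rewrite distrC.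
have near_ip : \forall x' \near x, forall t : R, 0 <= t <= 1 ->
    `|ip w (pt c x' t (sol c x t)) (dirn c x) - ip w (X t) (dirn c x)| <= d1 / 2.
  apply: (@uniform_continuity R n.+1 'rV[R]_n.+1 (nbhs x) (fun y => ip w y (dirn c x))
    X (fun x' t => pt c x' t (sol c x t))).
  - by move=> t t01; exact: (traj_continuous tU hc hx t01).
  - move=> t t01; apply: (ip_continuous Hw); exact: (pt_in tU).
  - move=> r r0; near=> x' => t t01; rewrite (le_trans (pt_near _ _ _ _ t01))//.
    rewrite mulrC -ler_pdivlMr// ltW//; near: x'.
    by apply: near_x; rewrite divr_gt0.
  - by rewrite divr_gt0.
have near_tube : \forall x' \near x, otube c rho x'.
  by apply: open_nbhs_nbhs; split=> //; exact: otube_open.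
near=> x' => t t01.
have hx' : tube c rho x' by apply: otube_sub; near: x'.
have x'x1 : `|x' - x| < 1 by near: x'; exact: near_x.
have x'xd : `|x' - x| < d / 4 by near: x'; apply: near_x; rewrite divr_gt0.
have x'xA : `|x' - x| < d1 / 2 / (A + 1).
  by near: x'; apply: near_x; rewrite !divr_gt0// ltr_wpDl.
have nip : forall t : R, 0 <= t <= 1 ->
    `|ip w (pt c x' t (sol c x t)) (dirn c x) - ip w (X t) (dirn c x)| <= d1 / 2.
  by near: x'.
have dd : `|dirn c x' - dirn c x| <= `|x' - x|.
  rewrite /dirn -hzB (le_trans (hz_norm _))// opprB addrC addrA subrK.
  by rewrite distrC.
have [s0 ds] := solP tU hc hx; have [s'0 ds'] := solP tU hc hx'.
pose W t := sol c x' t - sol c x t.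
pose dW t := - ip w (pt c x' t (sol c x' t)) (dirn c x') + ip w (X t) (dirn c x).
have regroup (y1 y2 y3 y4 : R) :
    - y1 + y4 = - (y1 - y2) - (y2 - y3) - (y3 - y4) by ring.
have WG : forall t : R, 0 <= t <= 1 -> `|W t| <= d1 * G.
  apply: (@gronwall R W dW) => //.
  - by rewrite mulr_ge0.
  - exact: ltW.
  - by rewrite /W s0 s'0 subrr.
  - move=> r r01; have := ds r r01; have := ds' r r01 => h1 h2.
    by rewrite /dW -[ip w (X r) _]opprK; exact: is_deriveB.
  move=> r r01; rewrite /dW.
  have Q_U : U (pt c x' r (sol c x r)) by exact: (pt_in tU).
  set Q := pt c x' r (sol c x r).
  (* Change the height, then the direction, then the starting point; only the first difference
     involves [W]. *)
  have -> : - ip w (pt c x' r (sol c x' r)) (dirn c x') + ip w (X r) (dirn c x) =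
    - (ip w (pt c x' r (sol c x' r)) (dirn c x') - ip w Q (dirn c x'))
    - (ip w Q (dirn c x' - dirn c x)) - (ip w Q (dirn c x) - ip w (X r) (dirn c x)).
    by rewrite ipB; exact: regroup.
  rewrite (le_trans (ler_normB _ _))// [d1]splitr addrA lerD ?nip//.
  rewrite (le_trans (ler_normB _ _))// lerD ?normrN//.
    pose y := x' + r *: dirn c x'.
    have yl (a : R) : y 0 ord_max + a = x' 0 ord_max + a.
      by rewrite line_last.
    have yt : tube c rho y.
      by have := pt_tube 0 hc hx' r01; rewrite /pt scale0r addr0.
    have := LP y (sol c x' r) (sol c x r) (dirn c x') yt; rewrite !yl => h.
    have x'l : `|x' 0 ord_max| <= `|x 0 ord_max| + 1.
      have := row_coord_le (x' - x) ord_max; rewrite !mxE => h'.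
      rewrite -[x' 0 ord_max](subrK (x 0 ord_max)) addrC.
      by rewrite (le_trans (ler_normD _ _))// lerD2l; lra.
    have sb := sol_bound tU hc hx (solP tU hc hx) r01.
    have sb' := sol_bound tU hc hx' (solP tU hc hx') r01.
    have dr := dirn_norm hx; have dr' := dirn_norm hx'.
    have Ar := ler_wpM2l A0 dr; have Ar' := ler_wpM2l A0 dr'.
    apply: le_trans (h _ _) _.
    - by rewrite (le_trans (ler_normD _ _))// /Z lerD// (le_trans sb').
    - rewrite (le_trans (ler_normD _ _))// /Z lerD// (le_trans sb)//.
    - by rewrite ler_wpM2r// ler_wpM2l.
  rewrite (le_trans (ip_le Hw _ Q_U))// -/A (le_trans (ler_wpM2l A0 dd))//.
  have A1 : 0 < A + 1 by rewrite ltr_wpDl.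
  move: x'xA; rewrite ltr_pdivlMr// mulrDr mulr1 [A * _]mulrC => h.
  by rewrite ltW// (le_lt_trans _ h)// lerDl.
have -> : traj c x' t - traj c x t =
    (pt c x' t (sol c x t) - pt c x t (sol c x t)) + W t *: e.
  by rewrite /traj /pt /W; apply/rowP => i; rewrite !mxE; ring.
rewrite (le_trans (ler_normD _ _))// [d in leRHS]splitr lerD//.
  by rewrite (le_trans (pt_near _ _ _ _ t01))//; lra.
have Wt := WG t t01; rewrite /d1 divfK ?gt_eqF// in Wt.
rewrite normrZ (le_trans _ Wt)// -[leRHS]mulr1 ler_wpM2l// e_norm.
Unshelve. all: by end_near. Qed.

Lemma is_derive_traj c0 rho c x (t : R) : tube c0 rho `<=` U ->
  tube c0 rho c -> tube c0 rho x -> 0 <= t <= 1 ->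
  is_derive t 1 (traj c x) (dirn c x - ip w (traj c x t) (dirn c x) *: e).
Proof.
move=> tU hc hx t01; have [_ ds] := solP tU hc hx; have dst := ds t t01.
apply: is_derive_row => i.
rewrite (_ : (fun r => _) =
  (fun r => x 0 i + r * dirn c x 0 i + sol c x r * e 0 i)); last first.
  by apply/funext => r; rewrite /traj /pt !mxE.
apply: is_derive_eq.
rewrite !scaler0 !add0r mul1r [_ *: 1]mulr1.
rewrite [RHS]mxE [X in _ = _ + X]mxE [X in _ = _ - X]mxE; congr (_ + _).
by rewrite -mulNr mulrC.
Qed.

End Transport.

Lemma is_derive_affine (R : realType) (a b t : R) :
  is_derive t 1 (fun r => a + r * b) b.
Proof. by apply: is_derive_eq; rewrite scaler0 !add0r mul1r [_ *: _]mulr1. Qed.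

(** * Restarting a horizontal curve, and the factor [gfun] *)

Section Variation.
Context {R : realType} {n : nat}.
Variables (U : set 'rV[R]_n.+1) (w : 'I_n.+1 -> 'rV[R]_n.+1 -> R) (C : R).
Hypothesis Hw : integrable_normal U w C.
Implicit Types (x u p q : 'rV[R]_n.+1).
Variables (c : 'rV[R]_n.+1) (rho : R).
Hypothesis tU : tube c rho `<=` U.

Local Notation e := evert.
Local Notation X := (traj w c).
Local Notation d := (dirn c).
Let oU := in_open Hw.

Lemma dip_continuous p q x : U x -> {for x, continuous (fun y => dip w y p q)}.
Proof.
move=> Ux; apply: (@class_C_continuous _ _ _ U _ 0 x oU) => //.
apply: class_C_sum => // k; apply: class_CM => //; first exact: class_C_cst.
apply: class_C_sum => // i; apply: class_CM => //; first exact: class_C_cst.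
exact: class_C_partial (in_C1 Hw k).
Qed.

Section FixedPoint.
Variable x : 'rV[R]_n.+1.
Hypothesis hx : tube c rho x.

Let rho0 : 0 <= rho. Proof. exact: le_trans (normr_ge0 _) hx. Qed.
Let hc : tube c rho c. Proof. exact: tube_center. Qed.

Lemma traj_in (t : R) : 0 <= t <= 1 -> U (X x t).
Proof. exact: (pt_in tU). Qed.

Lemma traj_tube (t : R) : 0 <= t <= 1 -> tube c rho (X x t).
Proof. exact: pt_tube. Qed.

Lemma traj0 : X x 0 = x.
Proof. by have [s0 _] := solP Hw tU hc hx; rewrite /traj /pt s0 !scale0r !addr0. Qed.

Lemma dirn_traj (t : R) : d (X x t) = (1 - t) *: d x.
Proof.
rewrite /traj /pt /dirn !(hzB, hzD, hzZ, hz_e, hz_hz) scaler0 addr0.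
by apply/rowP => i; rewrite !mxE; ring.
Qed.

(** By uniqueness, the rest of a horizontal curve is the horizontal curve from its current point,
    slowed down by [1 - t] because the remaining segment is shorter by that factor. *)
Lemma sol_traj (t r : R) : 0 <= t <= 1 -> 0 <= r <= 1 ->
  X (X x t) r = X x (t + r * (1 - t)).
Proof.
move=> t01 r01; have [s0 ds] := solP Hw tU hc hx.
set s := sol w c x in s0 ds.
have ptE a b : pt c (X x t) a (b - s t) = pt c x (t + a * (1 - t)) b.
  rewrite {1}/pt dirn_traj /traj /pt -/s; apply/rowP => i; rewrite !mxE; ring.
have hs : is_sol w c (X x t) (fun r => s (t + r * (1 - t)) - s t).
  split=> [|a a01]; first by rewrite mul0r addr0 subrr.
  have b01 : 0 <= t + a * (1 - t) <= 1.
    by move/andP: t01 => [? ?]; move/andP: a01 => [? ?]; apply/andP; split; nra.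
  have dl : is_derive a 1 (fun r => t + r * (1 - t)) (1 - t).
    exact: is_derive_affine.
  have := @is_derive1_comp R s (fun r => t + r * (1 - t)) a _ _ (ds _ b01) dl.
  move=> h; have : is_derive a 1 (fun r => s (t + r * (1 - t)) - s t)
    (- ip w (pt c x (t + a * (1 - t)) (s (t + a * (1 - t)))) (d x) * (1 - t)).
    by rewrite -[X in is_derive _ _ _ X]subr0; apply: is_deriveB.
  rewrite ptE dirn_traj ipZ -mulrN [(1 - t) * _]mulrC. by [].
rewrite /traj -/(X x t).
have := sol_unique Hw tU hc (traj_tube t01) (solP Hw tU hc (traj_tube t01)) hs r01.
by move=> ->; rewrite ptE.
Qed.

(** Minus the derivative, with respect to the height, of the right-hand side of the height
    equation. *)
Definition psi (t : R) := dip w (X x t) e (d x).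
(* Vertical derivative of the transport to the fibre of [c], see
   [transport_is_derive]. *)
Definition gfun := expR (- int01 psi).

Lemma comp_traj_continuous (T : topologicalType) (f : 'rV[R]_n.+1 -> T) (t : R) :
  0 <= t <= 1 -> {for X x t, continuous f} -> {for t, continuous (f \o X x)}.
Proof.
by move=> t01 cf; apply: continuous_comp => //; exact: (traj_continuous Hw tU hc hx t01).
Qed.

Lemma psi_int : has_int01 psi (int01 psi).
Proof.
apply: int01P; apply: continuous_clip => t t01.
apply: (@comp_traj_continuous _ (fun y => dip w y e (d x))) => //.
by apply: dip_continuous; exact: traj_in.
Qed.

End FixedPoint.

(** In the integral defining [gfun] at [X x t], the factor [1 - t] of the shortened direction is the
    Jacobian of the reparametrization, so that integral is the one of [psi x] over [[t, 1]]; the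
    ratio keeps the part over [[0, t]]. *)
Lemma gfun_traj x : tube c rho x ->
  exists2 P, (forall t : R, 0 <= t <= 1 -> is_derive t 1 P (psi x t)) &
    P 0 = 0 /\ forall t : R, 0 <= t <= 1 -> gfun x / gfun (X x t) = expR (- P t).
Proof.
move=> hx; have [P [P0 P1 dP]] := psi_int hx; exists P => //; split=> // t t01.
have hX := traj_tube hx t01.
have : has_int01 (psi (X x t)) (P 1 - P t).
  exists (fun r => P (t + r * (1 - t)) - P t); split.
  - by rewrite mul0r addr0 subrr.
  - by have -> : t + 1 * (1 - t) = 1 by ring.
  move=> a a01.
  have b01 : 0 <= t + a * (1 - t) <= 1.
    by move/andP: t01 => [? ?]; move/andP: a01 => [? ?]; apply/andP; split; nra.
  have dl : is_derive a 1 (fun r => t + r * (1 - t)) (1 - t).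
    exact: is_derive_affine.
  have h := @is_derive1_comp R P (fun r => t + r * (1 - t)) a _ _ (dP _ b01) dl.
  rewrite /psi (sol_traj hx t01 a01) dirn_traj dipZr [(1 - t) * _]mulrC -/(psi x _).
  by rewrite -[X in is_derive _ _ _ X]subr0; apply: is_deriveB.
move=> /(has_int01_unique (fun _ _ => erefl))/(_ (psi_int hX)) E.
have g1 : gfun x = expR (- P 1) by rewrite P1.
have g2 : gfun (X x t) = expR (- (P 1 - P t)) by rewrite E.
rewrite g2 {}g1 -expRN -expRD; congr expR; ring.
Qed.

End Variation.

Lemma bounded_segment01 (R : realType) (f : R -> R) :
  (forall t : R, 0 <= t <= 1 -> {for t, continuous f}) ->
  exists2 M, 0 <= M & forall t : R, 0 <= t <= 1 -> `|f t| <= M.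
Proof.
move=> cf; have [|t t01 tM] := @EVT_max R (fun t => `|f t|) 0 1 ler01.
  apply: continuous_in_subspaceT => t; rewrite inE/= in_itv/= => t01.
  by apply: (@continuous_comp _ _ _ f Num.norm); [exact: cf|exact: norm_continuous].
by exists `|f t| => // r r01; apply: tM; rewrite in_itv.
Qed.

(** * First variation of horizontal curves *)

Section FirstVariation.
Context {R : realType} {n : nat}.
Variables (U : set 'rV[R]_n.+1) (w : 'I_n.+1 -> 'rV[R]_n.+1 -> R) (C : R).
Hypothesis Hw : integrable_normal U w C.
Implicit Types (p q : 'rV[R]_n.+1).
Variables (c : 'rV[R]_n.+1) (rho : R).
Hypothesis tU : tube c rho `<=` U.
Variables (x u : 'rV[R]_n.+1).
Hypothesis ox : otube c rho x.

Local Notation e := evert.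
Local Notation X := (traj w c x).
Local Notation d := (dirn c x).
Let oU := in_open Hw.
Let hx : tube c rho x. Proof. exact: otube_sub. Qed.
Let rho0 : 0 <= rho. Proof. exact: le_trans (normr_ge0 _) hx. Qed.
Let hc : tube c rho c. Proof. exact: tube_center. Qed.

(** The vertical component for which [w] takes at [variation t] the value [ip w x u] times the ratio
    of the two [gfun]; the horizontal component [(1 - t) *: hz u] is forced by the motion of the
    segment, whose end fibre is fixed. *)
Definition vcoef (t : R) : R :=
  gfun w c x / gfun w c (X t) * ip w x u - (1 - t) * ip w (X t) (hz u).
Definition variation (t : R) : 'rV[R]_n.+1 := (1 - t) *: hz u + vcoef t *: e.

Let XU (t : R) : 0 <= t <= 1 -> U (X t). Proof. exact: (traj_in w tU hx). Qed.

(* The Frobenius condition makes [vcoef] solve the linearized equation. *)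
Lemma vcoef_derive : exists b : R -> R,
  [/\ forall t : R, 0 <= t <= 1 -> vcoef t = b t, b 0 = u 0 ord_max &
      forall t : R, 0 <= t <= 1 ->
        is_derive t 1 b (ip w (X t) (hz u) - dip w (X t) (variation t) d)].
Proof.
have [P dP [P0 PE]] := gfun_traj Hw tU hx.
pose E t := expR (- P t).
(* The ratio of [gfun] values is known to equal [E] only on [[0, 1]]; this representative also has
   two-sided derivatives at the end points. *)
exists (fun t => E t * ip w x u - (1 - t) * ip w (X t) (hz u)); split.
- by move=> t t01; rewrite /vcoef PE.
- rewrite /E P0 subr0 oppr0 expR0 !mul1r (traj0 Hw tU hx).
  by rewrite (ip_hz Hw) ?subKr//; exact: (tU hx).
move=> t t01; have UX := XU t01.
have dE : is_derive t 1 E (- psi w c x t * E t).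
  have dPt := dP t t01; have dN : is_derive t 1 (fun t => - P t) (- psi w c x t).
    exact: is_deriveN.
  have dexp := is_derive_expR (- P t).
  by have := @is_derive1_comp R expR (fun t => - P t) t _ _ dexp dN; rewrite mulrC.
have dX := is_derive_traj Hw tU hc hx t01.
have da := class_C1_chain oU (ip_C1 Hw (hz u)) UX dX.
rewrite (ddir_ip Hw)// in da.
set X' := d - _ in da.
set a := ip w (X t) (hz u) in da *.
pose hh := hz u - a *: e.
have X'0 : ip w (X t) X' = 0 by rewrite ipB ipZ (ip_e Hw)// mulr1 subrr.
have hh0 : ip w (X t) hh = 0 by rewrite ipB ipZ (ip_e Hw)// mulr1 subrr.
have eb p q (r : R) : dip w (X t) p (q - r *: e) = dip w (X t) p q.
  by rewrite -scaleNr dipDr dipZr (dip_e Hw)// mulr0 addr0.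
(* [X'] and [hh] lie in the kernel of [w], so the Frobenius identity exchanges them; [eb] drops
   vertical parts from the second slot. *)
have A_E : dip w (X t) X' (hz u) = dip w (X t) (hz u) d - a * psi w c x t.
  rewrite -(eb X' (hz u) a) -/hh (in_frob Hw)// /X' eb /hh -scaleNr dipDl dipZl.
  by rewrite mulNr.
set H := dip w (X t) (hz u) d in A_E.
have vE : vcoef t = E t * ip w x u - (1 - t) * a by rewrite /vcoef PE.
have DE : dip w (X t) (variation t) d =
    (1 - t) * H + (E t * ip w x u - (1 - t) * a) * psi w c x t.
  by rewrite /variation vE dipDl !dipZl.
rewrite {}DE.
have db : is_derive t 1 (fun t => 1 - t) (-1 : R).
  have := is_derive_affine 1 (-1) t; congr is_derive.
  by apply/funext => r; rewrite mulrN1.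
have d1 := is_deriveM db da.
have d2 : is_derive t 1 (fun t => E t * ip w x u) (- psi w c x t * E t * ip w x u).
  by apply: is_derive_eq; rewrite scaler0 add0r [_ *: _]mulrC.
have [d3 d3E] := is_deriveB d2 d1; split; [exact: d3|apply: etrans d3E _].
rewrite A_E -/a /= /GRing.scale /=; move: (psi _ _ _ _) (E t) (ip w x u) => k1 k2 k3.
rewrite -[ip w (X t) (hz u)]/a; ring.
Qed.

(** The predicted curve [Y h] solves the height equation of the perturbed start up to a defect small
    compared with [h], and Gronwall bounds its distance to the true curve. *)
Lemma traj_variation (eta : R) : 0 < eta ->
  \forall h \near (0 : R), forall t : R, 0 <= t <= 1 ->
    `|traj w c (x + h *: u) t - X t - h *: variation t| <= eta * `|h|.
Proof.
move=> eta0; have [b [bE b0 db]] := vcoef_derive.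
have C0 : 0 <= C by exact: (bound_ge0 Hw (tU hx)).
have cb (t : R) : 0 <= t <= 1 -> {for t, continuous b}.
  by move=> t01; have := db t t01; exact: is_derive1_continuous.
have [B B0 bB] := bounded_segment01 cb.
pose A := n.+1%:R * C; have A0 : 0 <= A by rewrite mulr_ge0.
pose tau t := b t - u 0 ord_max; pose T := B + `|u 0 ord_max|.
have tauT (t : R) : 0 <= t <= 1 -> `|tau t| <= T.
  by move=> t01; rewrite (le_trans (ler_normB _ _))// lerD2r bB.
have T0 : 0 <= T by rewrite addr_ge0.
pose Z := `|x 0 ord_max| + 1 + (A * rho + 1).
have [L L0 LP] := ip_lip Hw Z tU.
pose G := expR (L * rho + 1); have G0 : 0 < G by exact: expR_gt0.
(* The defect is at most [2 * eta1] times the size of [h], and Gronwall multiplies it by [G]. *)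
pose eta1 := eta / 2 / G.
have eta10 : 0 < eta1 by rewrite !divr_gt0.
pose p t := (1 - t) *: hz u + b t *: e.
have pE (t : R) : 0 <= t <= 1 -> variation t = p t by move=> t01; rewrite /variation bE.
have cp (t : R) : 0 <= t <= 1 -> {for t, continuous p}.
  move=> t01; apply: continuousD; apply: continuous_scalel; last exact: cb.
  by apply: continuousB => //; exact: cst_continuous.
have pM (t : R) : 0 <= t <= 1 -> `|p t| <= `|u| + B.
  move=> t01; rewrite (le_trans (ler_normD _ _))// !normrZ lerD//.
    have hu := hz_norm u; have := normr_ge0 (hz u).
    by case/andP: t01 => t0 t1; rewrite ger0_norm ?subr_ge0//; nra.
  by rewrite (le_trans (ler_pM _ _ (bB _ t01) e_norm))// mulr1.
have cX (t : R) : 0 <= t <= 1 -> {for t, continuous X}.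
  exact: (traj_continuous Hw tU hc hx).
pose Y (h : R) (t : R) := X t + h *: p t.
have N1 : \forall h \near (0 : R), forall t : R, 0 <= t <= 1 ->
   `|ip w (Y h t) d - ip w (X t) d - h * ddir (fun y => ip w y d) (X t) (p t)|
      <= eta1 * `|h|.
  apply: (uniform_differentiability oU (ip_C1 Hw d) cX cp XU _ eta10).
  move=> r r0; near=> h => t t01.
  by rewrite /Y [X t + _]addrC addrK subrr normr0 mulr_ge0// ltW.
have small (r : R) : 0 < r -> \forall h \near (0 : R), `|h| <= r.
  by move=> r0; exact: nbhs0_le.
have N2 : \forall h \near (0 : R), forall t : R, 0 <= t <= 1 ->
   `|ip w (Y h t) (hz u) - ip w (X t) (hz u)| <= eta1.
  apply: (@uniform_continuity R n.+1 R (nbhs (0 : R)) (fun y => ip w y (hz u)) X Y) => //.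
    by move=> t t01; apply: (ip_continuous Hw); exact: XU.
  move=> r r0; have D0 : 0 < `|u| + B + 1 by rewrite ltr_wpDl// addr_ge0.
  have := small _ (divr_gt0 r0 D0); apply: filterS => h.
  rewrite ler_pdivlMr// => hr t t01; rewrite /Y [X t + _]addrC addrK normrZ.
  apply: le_trans hr; rewrite ler_wpM2l// (le_trans (pM _ t01))// lerDl//.
have N3 : \forall h \near (0 : R), otube c rho (x + h *: u).
  have : \forall y \near x, otube c rho y.
    by apply: open_nbhs_nbhs; split=> //; exact: otube_open.
  move=> /nbhs_normP[r r0 rP].
  have D0 : 0 < `|u| + 1 by rewrite ltr_wpDl.
  have := small _ (divr_gt0 (divr_gt0 r0 (ltr0n _ 2)) D0); apply: filterS => h.
  rewrite ler_pdivlMr// => hr; apply: rP => /=.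
  rewrite opprD addNKr normrN normrZ.
  have hu : `|h| * `|u| <= `|h| * (`|u| + 1) by rewrite ler_wpM2l// lerDl.
  apply: le_lt_trans (le_trans hu hr) _.
  by rewrite ltr_pdivrMr// mulr_natr mulr2n ltrDl.
have N4 : \forall h \near (0 : R), `|h| <= 1 / (`|u| + T + 1).
  by apply: small; rewrite divr_gt0// ltr_wpDl// addr_ge0.
near=> h => t t01.
have hx' : tube c rho (x + h *: u) by apply: otube_sub; near: h.
have n1 : forall t : R, 0 <= t <= 1 ->
   `|ip w (Y h t) d - ip w (X t) d - h * ddir (fun y => ip w y d) (X t) (p t)|
      <= eta1 * `|h| by near: h.
have n2 : forall t : R, 0 <= t <= 1 ->
   `|ip w (Y h t) (hz u) - ip w (X t) (hz u)| <= eta1 by near: h.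
have h1 : `|h| <= 1 / (`|u| + T + 1) by near: h.
set x' := x + h *: u in hx' *.
have {h1} h1 : `|h| * (`|u| + T + 1) <= 1.
  by move: h1; rewrite ler_pdivlMr// ltr_wpDl// addr_ge0.
have hu1 : `|h| * `|u| <= 1.
  by apply: le_trans h1; rewrite ler_wpM2l// -addrA lerDl addr_ge0.
have hT1 : `|h| * T <= 1.
  by apply: le_trans h1; rewrite ler_wpM2l// addrAC lerDr addr_ge0.
have [s0 ds] := solP Hw tU hc hx; have [s'0 ds'] := solP Hw tU hc hx'.
have dE : dirn c x' = d - h *: hz u.
  by rewrite /dirn /x' opprD addrA (hzB (c - x)) hzZ.
have vec (t0 k1 k2 k3 : R) (p1 p2 p3 p4 : 'rV[R]_n.+1) :
    p1 + t0 *: p2 + k1 *: p4 + h *: ((1 - t0) *: p3 + k2 *: p4) =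
    p1 + h *: (p3 + k3 *: p4) + t0 *: (p2 - h *: p3) + (k1 + h * (k2 - k3)) *: p4.
  by apply/rowP => i; rewrite !mxE; ring.
(* The predicted point lies exactly above the segment starting at [x'], so it differs from the true
   curve in height only and [ip_lip] applies. *)
have YE (t0 : R) : Y h t0 = pt c x' t0 (sol w c x t0 + h * tau t0).
  have := vec t0 (sol w c x t0) (b t0) (u 0 ord_max) x d (hz u) e.
  by rewrite -hz_decomp -dE.
pose W t := sol w c x' t - sol w c x t - h * tau t.
pose dW t := - ip w (pt c x' t (sol w c x' t)) (dirn c x') + ip w (X t) d -
  h * (ip w (X t) (hz u) - dip w (X t) (p t) d).
(* Three groups: the height error, the Taylor remainder along [Y h], and [h] times the change of the
   pairing with [hz u]. *)
have regroup (y1 y2 y3 y4 y5 y6 : R) : - y1 + y2 - h * (y3 - y4) =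
    - (y1 - (y5 - h * y6)) - (y5 - y2 - h * y4) + h * (y6 - y3) by ring.
have WG : forall t : R, 0 <= t <= 1 -> `|W t| <= (2 * eta1 * `|h|) * G.
  apply: (@gronwall R W dW) => //.
  - by rewrite mulr_ge0.
  - by apply: mulr_ge0 => //; apply: mulr_ge0 => //; exact: ltW.
  - by rewrite /W /tau s0 s'0 b0 !subrr mulr0 subrr.
  - move=> r r01; have g1 := ds r r01; have g2 := ds' r r01; have := db r r01.
    rewrite pE// => g3.
    have g4 : is_derive r 1 tau (ip w (X r) (hz u) - dip w (X r) (p r) d).
      by apply: is_derive_eq; rewrite subr0.
    have g5 : is_derive r 1 (fun r => h * tau r)
        (h * (ip w (X r) (hz u) - dip w (X r) (p r) d)).
      exact: is_deriveZ.
    rewrite /dW -[ip w (X r) d]opprK.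
    exact: (is_deriveB (is_deriveB g2 g1) g5).
  move=> r r01; rewrite /dW (regroup _ _ _ _ (ip w (Y h r) d) (ip w (Y h r) (hz u))).
  have k2 := n1 r r01; have k3 := n2 r r01.
  rewrite (ddir_ip Hw) in k2; last exact: XU.
  have -> : ip w (Y h r) d - h * ip w (Y h r) (hz u) = ip w (Y h r) (dirn c x').
    by rewrite -ipZ -ipB -dE.
  have k1 : `|ip w (pt c x' r (sol w c x' r)) (dirn c x') - ip w (Y h r) (dirn c x')|
      <= L * rho * `|W r|.
    pose y := x' + r *: dirn c x'.
    have yl (a : R) : y 0 ord_max + a = x' 0 ord_max + a by rewrite line_last.
    have yt : tube c rho y.
      by have := pt_tube 0 hc hx' r01; rewrite /pt scale0r addr0.
    rewrite YE.
    have := LP y (sol w c x' r) (sol w c x r + h * tau r) (dirn c x') yt.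
    rewrite !yl => k.
    have x'l : `|x' 0 ord_max| <= `|x 0 ord_max| + 1.
      rewrite /x' 2!mxE (le_trans (ler_normD _ _))// lerD2l normrM.
      by rewrite (le_trans _ hu1)// ler_wpM2l// row_coord_le.
    have sb := sol_bound Hw tU hc hx (solP Hw tU hc hx) r01.
    have sb' := sol_bound Hw tU hc hx' (solP Hw tU hc hx') r01.
    have dr := dirn_norm hx; have dr' := dirn_norm hx'.
    have Ar := ler_wpM2l A0 dr; have Ar' := ler_wpM2l A0 dr'.
    have htau : `|h * tau r| <= 1.
      by rewrite normrM (le_trans _ hT1)// ler_wpM2l// tauT.
    apply: le_trans (k _ _) _.
    - rewrite (le_trans (ler_normD _ _))// /Z lerD// (le_trans sb')//.
      by rewrite (le_trans Ar')// lerDl.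
    - rewrite (le_trans (ler_normD _ _))// /Z lerD//.
      by rewrite (le_trans (ler_normD _ _))// lerD// (le_trans sb).
    - by rewrite opprD addrA ler_wpM2r// ler_wpM2l.
  rewrite (le_trans (ler_normD _ _))// (le_trans (lerD (ler_normB _ _) (lexx _)))//.
  rewrite normrN normrM.
  have k4 : `|h| * `|ip w (Y h r) (hz u) - ip w (X r) (hz u)| <= `|h| * eta1.
    by rewrite ler_wpM2l.
  have add3 (y1 y2 y3 y4 y5 : R) : y1 <= L * rho * y5 -> y2 <= eta1 * y4 ->
    y3 <= y4 * eta1 -> y1 + y2 + y3 <= L * rho * y5 + 2 * eta1 * y4 by lra.
  exact: add3.
have -> : traj w c x' t - X t - h *: variation t = W t *: e.
  rewrite pE// /W.
  have -> : traj w c x' t = Y h t + (sol w c x' t - (sol w c x t + h * tau t)) *: e.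
    have ptD (k1 k2 : R) : pt c x' t k1 + k2 *: e = pt c x' t (k1 + k2).
      by rewrite /pt -addrA -scalerDl.
    by rewrite YE ptD addrC subrK.
  have cancel (p1 p2 p3 : 'rV[R]_n.+1) : p1 + p2 + p3 - p1 - p2 = p3.
    by rewrite -addrA -opprD addrC addKr.
  by rewrite /Y cancel opprD addrA.
rewrite normrZ (le_trans (ler_wpM2l _ e_norm))// mulr1 (le_trans (WG t t01))//.
have -> : 2 * eta1 * `|h| * G = eta * `|h| * (2 / 2) * (G / G) by rewrite /eta1; ring.
by rewrite !divff ?gt_eqF// !mulr1.
Unshelve. all: by end_near. Qed.

End FirstVariation.

Lemma is_derive_approx (R : realType) (V : normedModType R) (f : V -> R) (x u : V) (a : R) :
  (forall eta : R, 0 < eta ->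
    \forall h \near (0 : R), `|f (x + h *: u) - f x - h * a| <= eta * `|h|) ->
  is_derive x u f a.
Proof.
move=> fa; suff cv : (fun h : R => h^-1 *: ((f \o shift x) (h *: u) - f x)) @ 0^' --> a.
  by split; [apply/cvg_ex; exists a|exact: cvg_lim cv].
apply/cvgrPdist_le => eta eta0; near=> h.
have h0 : h != 0 by near: h; exact: nbhs_dnbhs_neq.
have hE : `|f (x + h *: u) - f x - h * a| <= eta * `|h|.
  by near: h; apply: nbhs_dnbhs; exact: fa.
rewrite /= [h *: u + x]addrC distrC.
have -> : h^-1 *: (f (x + h *: u) - f x) - a = h^-1 * (f (x + h *: u) - f x - h * a).
  by rewrite [_ *: _]/(_ * _) [RHS]mulrBr mulKf.
by rewrite normrM normfV mulrC ler_pdivrMr ?normr_gt0.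
Unshelve. all: by end_near. Qed.

(** * Weighted integrals along leaves and regularity of the transport *)

Section Regularity.
Context {R : realType} {n : nat}.
Variables (U : set 'rV[R]_n.+1) (w : 'I_n.+1 -> 'rV[R]_n.+1 -> R) (C : R).
Hypothesis Hw : integrable_normal U w C.
Implicit Types (x u p q : 'rV[R]_n.+1) (f : 'rV[R]_n.+1 -> R).
Variables (c : 'rV[R]_n.+1) (rho : R).
Hypothesis tU : tube c rho `<=` U.

Local Notation e := evert.
Local Notation X := (traj w c).
Local Notation V := (otube c rho).
Local Notation g := (gfun w c).
Let oU := in_open Hw.
Let oV : open V := @otube_open _ _ c rho.

Let tube_of x : V x -> tube c rho x. Proof. exact: otube_sub. Qed.
Let rho0 x : V x -> 0 <= rho. Proof. by move=> /tube_of; exact: le_trans. Qed.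
Let hc x : V x -> tube c rho c. Proof. by move=> /rho0; exact: tube_center. Qed.
Let VU x : V x -> U x. Proof. by move=> /tube_of; exact: tU. Qed.

Lemma otube_traj x (t : R) : V x -> 0 <= t <= 1 -> V (X x t).
Proof.
move=> Vx /andP[t0 t1]; rewrite /otube/=.
rewrite -normrN -hzN opprB -/(dirn c _) dirn_traj normrZ ger0_norm ?subr_ge0//.
apply: le_lt_trans Vx; rewrite -normrN -hzN opprB -/(dirn c _).
by rewrite ler_piMl// gerBl.
Qed.

(* The weights keep this class of integrals stable under differentiation, by
   [wint_is_derive]; regularity then propagates by induction on the order. *)
Definition wint (m : nat) f x : R := int01 (fun t => (1 - t) ^+ m * f (X x t)).

Let cweight (m : nat) : continuous (fun t : R => (1 - t) ^+ m).
Proof.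
move=> t; have h1 : {for t, continuous (fun t : R => 1 - t)}.
  by apply: continuousB => //; exact: cst_continuous.
exact: continuous_comp h1 (@exprn_continuous _ m _).
Qed.

Let weight_le (m : nat) (t : R) : 0 <= t <= 1 -> `|(1 - t) ^+ m| <= 1.
Proof.
move=> /andP[t0 t1]; have h : 0 <= 1 - t by rewrite subr_ge0.
by rewrite normrX ger0_norm// exprn_ile1// gerBl.
Qed.

Lemma cont_traj f x (t : R) : V x -> (forall y, V y -> {for y, continuous f}) ->
  0 <= t <= 1 -> {for t, continuous (fun t => f (X x t))}.
Proof.
move=> Vx cf t01; apply: (comp_traj_continuous Hw tU (tube_of Vx) t01).
by apply: cf; exact: otube_traj.
Qed.

Lemma wint_has m f x : V x -> (forall y, V y -> {for y, continuous f}) ->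
  has_int01 (fun t => (1 - t) ^+ m * f (X x t)) (wint m f x).
Proof.
move=> Vx cf; apply: int01P; apply: continuous_clip => t t01.
by apply: continuousM; [exact: cweight|exact: cont_traj].
Qed.

Lemma wint_continuous m f x : V x -> (forall y, V y -> {for y, continuous f}) ->
  {for x, continuous (wint m f)}.
Proof.
move=> Vx cf; suff h : forall r : R, 0 < r -> \forall x' \near x,
    `|wint m f x - wint m f x'| <= r by apply/(@cvgrPdist_le _ _ _ (nbhs x)); exact: h.
move=> r r0.
have XX : forall d : R, 0 < d -> \forall x' \near x, forall t : R, 0 <= t <= 1 ->
    `|X x' t - X x t| <= d by move=> d d0; exact: (traj_near Hw tU Vx d0).
have := @uniform_continuity R n.+1 _ (nbhs x) f (X x) X _ _ _ XX r r0.
have N : \forall x' \near x, V x' by exact: open_nbhs_nbhs.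
move=> /(_ _ _) H; apply: filterS2 N (H _ _) => [x' Vx' {}H||].
- have := has_int01_comb (-1) (wint_has m Vx cf) (wint_has m Vx' cf).
  rewrite mulN1r => /has_int01_bound; apply=> t t01.
  rewrite mulN1r -mulrBr normrM -[r]mul1r ler_pM ?weight_le// distrC; exact: H.
- by move=> t t01; exact: (traj_continuous Hw tU (hc Vx) (tube_of Vx) t01).
- by move=> t t01; apply: cf; exact: otube_traj.
Qed.

Let dirn_coord x k : dirn c x 0 k = if k == ord_max then 0 else c 0 k - x 0 k.
Proof. by rewrite /dirn hz_coord !mxE. Qed.

Let dirn_class_C r k : class_C r V (fun x => dirn c x 0 k).
Proof.
have E x : V x -> dirn c x 0 k = if k == ord_max then 0 else c 0 k - x 0 k.
  by move=> _; exact: dirn_coord.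
case: (k == ord_max) E => E; apply: (class_C_eq oV E); first exact: class_C_cst.
by apply: class_CB => //; [exact: class_C_cst|exact: class_C_coord].
Qed.

Let cD_e k y : V y -> {for y, continuous (fun y => 'D_e (w k) y)}.
Proof.
by move=> /VU; apply: class_C_continuous oU _; exact: class_C_partial (in_C1 Hw k).
Qed.

(** The direction is constant along the segment and leaves the integral; [gfun] thereby becomes an
    expression in coordinates and weighted integrals of vertical derivatives of [w]. *)
Lemma gfunE x : V x ->
  g x = expR (- \sum_k dirn c x 0 k * wint 0 (fun y => 'D_e (w k) y) x).
Proof.
move=> Vx; rewrite /gfun; congr (expR (- _)).
have : has_int01 (fun t => \sum_k dirn c x 0 k * ((1 - t) ^+ 0 * 'D_e (w k) (X x t)))
    (\sum_k dirn c x 0 k * wint 0 (fun y => 'D_e (w k) y) x).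
  have hk k := wint_has 0 Vx (@cD_e k).
  elim: (index_enum _) => [|k s IH].
    exists (fun=> 0); split=> [//||t _]; rewrite ?big_nil//.
    exact: is_derive_cst.
  rewrite big_cons addrC.
  have := has_int01_comb (dirn c x 0 k) IH (hk k).
  congr has_int01; apply/funext => t.
  by rewrite big_cons addrC.
move: (psi_int Hw tU (tube_of Vx)) => h1 h2.
apply: has_int01_unique h1 h2 => t t01.
rewrite /psi /dip; apply: eq_bigr => k _.
by rewrite expr0 mul1r ddir_delta.
Qed.

Lemma gfun_gt0 x : 0 < g x. Proof. exact: expR_gt0. Qed.

Lemma gfun_continuous x : V x -> {for x, continuous g}.
Proof.
move=> Vx; apply: (@class_C_continuous _ _ _ V _ 0 x oV) => //.
apply: (@class_C_eq _ _ _ _ _ _ oV gfunE).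
apply: class_C_comp; [exact: oV|exact: smooth1_expR|apply: class_CN => //].
apply: (class_C_sum _ oV) => k; apply: (class_CM oV (dirn_class_C _ _)).
by apply: class_C0I => // y Vy; apply: wint_continuous => //; exact: cD_e.
Qed.

(** Differentiate under the integral along [variation]. The factor [1 - t] raises the weight, and
    the ratio [g x / g (X x t)] separates into a function of [x] and one of the moving point, so
    both terms are weighted integrals again. *)
Lemma wint_is_derive m f x u : class_C 1 V f -> V x ->
  is_derive x u (wint m f)
    (wint m.+1 (fun y => ddir f y u - ip w y u * 'D_e f y) x +
     g x * ip w x u * wint m (fun y => 'D_e f y / g y) x).
Proof.
move=> Cf Vx; have cf y : V y -> {for y, continuous f}.
  exact: class_C_continuous oV Cf.
have cDe y : V y -> {for y, continuous (fun y => 'D_e f y)}.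
  by apply: class_C_continuous oV _; exact: class_C_partial Cf.
have cg y : V y -> {for y, continuous (fun y => 'D_e f y / g y)}.
  move=> Vy; apply: continuousM; first exact: cDe.
  by apply: continuousV; [rewrite gt_eqF// gfun_gt0|exact: gfun_continuous].
have cddir y : V y -> {for y, continuous (fun y => ddir f y u)}.
  apply: (@class_C_continuous _ _ _ V _ 0) => //; apply: class_C_sum => // i.
  by apply: class_CM => //; [exact: class_C_cst|exact: class_C_partial].
have c1 y : V y -> {for y, continuous (fun y => ddir f y u - ip w y u * 'D_e f y)}.
  move=> Vy; apply: continuousB; first exact: cddir.
  by apply: continuousM; [apply: (ip_continuous Hw); exact: VU|exact: cDe].
have hI := has_int01_comb (g x * ip w x u) (wint_has m.+1 Vx c1) (wint_has m Vx cg).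
apply: is_derive_approx => eta eta0.
have [b [bE _ db]] := vcoef_derive Hw tU u Vx.
pose p t := (1 - t) *: hz u + b t *: e.
have pE (t : R) : 0 <= t <= 1 -> variation w c x u t = p t.
  by move=> t01; rewrite /variation bE.
have cX (t : R) : 0 <= t <= 1 -> {for t, continuous (X x)}.
  exact: (traj_continuous Hw tU (hc Vx) (tube_of Vx)).
have cp (t : R) : 0 <= t <= 1 -> {for t, continuous p}.
  move=> t01; apply: continuousD; apply: continuous_scalel.
    by apply: continuousB => //; exact: cst_continuous.
  by have := db t t01; exact: is_derive1_continuous.
have XV (t : R) : 0 <= t <= 1 -> V (X x t) by exact: otube_traj.
have XX (r : R) : 0 < r -> \forall h \near (0 : R), forall t : R, 0 <= t <= 1 ->
    `|X (x + h *: u) t - X x t - h *: p t| <= r * `|h|.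
  move=> r0; have := traj_variation Hw tU u Vx r0; apply: filterS => h H t t01.
  by rewrite -pE//; exact: H.
have near_f := uniform_differentiability oV Cf cX cp XV XX eta0.
have near_V : \forall h \near (0 : R), V (x + h *: u).
  have cl : {for (0 : R), continuous (fun h : R => x + h *: u)}.
    by apply: continuousD; [exact: cst_continuous|exact: continuous_scalel].
  apply: cl; apply: open_nbhs_nbhs; split=> //.
  by rewrite scale0r addr0.
apply: filterS2 near_V near_f => h Vh H.
have h1 := has_int01_comb (-1) (wint_has m Vh cf) (wint_has m Vx cf).
have := has_int01_comb (- h) h1 hI; rewrite mulN1r mulNr => /has_int01_bound; apply.
move=> t t01; have Ht := H t t01.
have EE : ddir f (X x t) (p t) =
    (1 - t) * (ddir f (X x t) u - ip w (X x t) u * 'D_e f (X x t)) +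
    g x * ip w x u * ('D_e f (X x t) / g (X x t)).
  rewrite /p -bE// /vcoef ddirD !ddirZ (ip_hz Hw); last exact/VU/XV.
  rewrite /hz ddirD -scaleNr ddirZ ddir_delta.
  move: (ddir _ _ _) (ip w (X x t) u) (ip w x u) (g x) ((g (X x t))^-1) => *.
  by move: ('D_e f _) (u _ _) => *; ring.
rewrite EE in Ht.
have -> : (1 - t) ^+ m * f (X (x + h *: u) t) + -1 * ((1 - t) ^+ m * f (X x t)) +
   - h * ((1 - t) ^+ m.+1 * (ddir f (X x t) u - ip w (X x t) u * 'D_e f (X x t)) +
   g x * ip w x u * ((1 - t) ^+ m * ('D_e f (X x t) / g (X x t)))) =
   (1 - t) ^+ m * (f (X (x + h *: u) t) - f (X x t) -
    h * ((1 - t) * (ddir f (X x t) u - ip w (X x t) u * 'D_e f (X x t)) +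
    g x * ip w x u * ('D_e f (X x t) / g (X x t)))).
  rewrite exprS; move: (ddir f _ _ - _) ('D_e f _ / _) => k1 k2.
  have regroup (k4 k5 k6 k7 : R) : k4 * k5 + -1 * (k4 * k6) +
      - h * ((1 - t) * k4 * k1 + k7 * (k4 * k2)) =
      k4 * (k5 - k6 - h * ((1 - t) * k1 + k7 * k2)) by ring.
  exact: regroup.
rewrite normrM -[eta * `|h|]mul1r ler_pM ?weight_le//.
Qed.

(** The two claims advance together: differentiating a weighted integral brings in [g] and [1 / g]
    at the previous order, and [gfunE] then lifts [g]. One order of [w] is spent on the vertical
    derivatives inside [g]. *)
Lemma wint_regular k : (forall i, class_C k.+1 U (w i)) ->
  class_C k V g /\ forall m f, class_C k V f -> class_C k V (wint m f).
Proof.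
elim: k => [|k IH] Cw.
  split; first by apply: class_C0I => // x; exact: gfun_continuous.
  move=> m f Cf; apply: class_C0I => // x Vx; apply: wint_continuous => //.
  by move=> y; exact: class_C_continuous oV Cf.
have CwV i r : class_C r U (w i) -> class_C r V (w i).
  by apply: class_C_sub => // y; exact: VU.
have [Cg CI] := IH (fun i => class_CW (Cw i)).
have CI' m f : class_C k.+1 V f -> class_C k.+1 V (wint m f).
  move=> Cf; have C1f : class_C 1 V f by exact: class_C_le Cf.
  pose df i x := wint m.+1 (fun y => ddir f y (delta_mx 0 i) -
    ip w y (delta_mx 0 i) * 'D_e f y) x +
     g x * ip w x (delta_mx 0 i) * wint m (fun y => 'D_e f y / g y) x.
  have CDe : class_C k V (fun y => 'D_e f y) by exact: class_C_partial.
  have Cip i : class_C k V (fun y => ip w y (delta_mx 0 i)).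
    by apply: ip_class_C => // j; apply: CwV; exact/class_CW/class_CW.
  apply: (@class_C_SI _ _ _ _ df) => //.
  - move=> x Vx; apply: wint_continuous => // y.
    exact: class_C_continuous oV Cf.
  - by move=> i x Vx; exact: wint_is_derive.
  - move=> i; apply: class_CD => //.
      apply: CI; apply: class_CB => //; last exact: class_CM.
      apply: (@class_C_eq _ _ _ _ (fun y => 'D_(delta_mx 0 i) f y)) => //.
        by move=> y _; rewrite ddir_delta.
      exact: class_C_partial.
    apply: class_CM => //; first exact: class_CM.
    apply: CI; apply: class_CM => //; apply: class_C_inv => // y _.
    by rewrite gt_eqF// gfun_gt0.
split=> //; apply: (class_C_eq oV gfunE).
apply: class_C_comp; [exact: oV|exact: smooth1_expR|apply: class_CN => //].
apply: (class_C_sum _ oV) => i; apply: (class_CM oV (dirn_class_C _ _)).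
by apply: CI'; exact: (class_C_sub oV VU oU (class_C_partial _ (Cw i))).
Qed.

Definition transport x : R := traj w c x 1 0 ord_max.

Lemma traj1 x : V x -> traj w c x 1 = hz c + transport x *: e.
Proof.
move=> Vx; rewrite [LHS]hz_decomp -/(transport x); congr (_ + _).
rewrite /traj /pt /dirn !(hzB, hzD, hzZ, hz_e, hz_hz) scaler0 addr0 scale1r.
by rewrite addrC subrK.
Qed.

Lemma gfun_traj1 x : V x -> g (traj w c x 1) = 1.
Proof.
move=> Vx; have t01 : 0 <= (1 : R) <= 1 by rewrite ler01 lexx.
have h1 := psi_int Hw tU (tube_of (otube_traj Vx t01)).
suff E : int01 (psi w c (traj w c x 1)) = 0 by rewrite /gfun E oppr0 expR0.
have h0 : has_int01 (fun _ : R => 0 : R) 0.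
  by exists (fun=> 0); split=> // t _; exact: is_derive_cst.
apply: has_int01_unique h1 h0 => t _.
rewrite /psi dirn_traj subrr scale0r -(scale0r (0 : 'rV[R]_n.+1)).
by rewrite dipZr mul0r.
Qed.

(** At time [1] the horizontal part of the variation has shrunk to zero, and [gfun] is [1] at the
    end point since the remaining segment is trivial. *)
Lemma transport_is_derive x u : V x -> is_derive x u transport (g x * ip w x u).
Proof.
move=> Vx; apply: is_derive_approx => eta eta0.
have := traj_variation Hw tU u Vx eta0; apply: filterS => h H.
have t01 : 0 <= (1 : R) <= 1 by rewrite ler01 lexx.
have v1 : variation w c x u 1 = (g x * ip w x u) *: e.
  by rewrite /variation /vcoef gfun_traj1// subrr scale0r add0r mul0r subr0 divr1.
have {H} := H 1 t01; rewrite v1.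
apply: le_trans; have := row_coord_le (traj w c (x + h *: u) 1 - traj w c x 1 -
  h *: (g x * ip w x u *: e)) ord_max.
have co (A B : 'rV[R]_n.+1) (k : R) : (A - B - h *: (k *: e)) 0 ord_max =
    A 0 ord_max - B 0 ord_max - h * k by rewrite !mxE !eqxx/= mulr1.
by rewrite co.
Qed.

(** The partial derivatives are products of [g] and coefficients of [w], so the order lost by [g] is
    regained. *)
Lemma transport_regular k : (forall i, class_C k.+1 U (w i)) ->
  class_C k.+1 V transport.
Proof.
move=> Cw; have [Cg _] := wint_regular Cw.
have Cip i : class_C k V (fun y => ip w y (delta_mx 0 i)).
  apply: ip_class_C => // j; exact: (class_C_sub oV VU oU (class_CW (Cw j))).
apply: (@class_C_SI _ _ _ _ (fun i x => g x * ip w x (delta_mx 0 i))) => //.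
- move=> x Vx; have t01 : 0 <= (1 : R) <= 1 by rewrite ler01 lexx.
  suff h : forall r : R, 0 < r -> \forall x' \near x, `|transport x - transport x'| <= r.
    by apply/(@cvgrPdist_le _ _ _ (nbhs x)); exact: h.
  move=> r r0; have := traj_near Hw tU Vx r0; apply: filterS => x' H.
  have := H 1 t01; apply: le_trans; rewrite distrC.
  have := row_coord_le (traj w c x' 1 - traj w c x 1) ord_max.
  have co (A B : 'rV[R]_n.+1) : (A - B) 0 ord_max = A 0 ord_max - B 0 ord_max.
    by rewrite !mxE.
  by rewrite co distrC.
- by move=> i x Vx; exact: transport_is_derive.
- by move=> i; exact: class_CM.
Qed.

End Regularity.

(** * Holonomy *)

Section Cocycle.
Context {R : realType} {n : nat}.
Variables (U : set 'rV[R]_n.+1) (w : 'I_n.+1 -> 'rV[R]_n.+1 -> R) (C : R).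
Hypothesis Hw : integrable_normal U w C.
Implicit Types (c x y : 'rV[R]_n.+1) (rho : R).

Local Notation e := evert.
Let oU := in_open Hw.

Definition mv c x := traj w c x 1.

Lemma mv_hz c c' x : hz c = hz c' -> mv c x = mv c' x.
Proof.
move=> cc'; have E : dirn c x = dirn c' x by rewrite /dirn !hzB cc'.
by rewrite /mv /traj /sol /is_sol /pt E.
Qed.

Lemma hz_mv c x : hz (mv c x) = hz c.
Proof.
rewrite /mv /traj /pt /dirn !(hzB, hzD, hzZ, hz_e, hz_hz) scaler0 addr0 scale1r.
by rewrite addrC subrK.
Qed.

Lemma otube_center c rho : 0 < rho -> otube c rho c.
Proof. by rewrite /otube/= hzB subrr normr0. Qed.

Lemma otube_hz c rho x y : hz x = hz y -> otube c rho x -> otube c rho y.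
Proof. by rewrite /otube/= !hzB => ->. Qed.

Lemma otubeC c rho x : otube c rho x -> otube x rho c.
Proof. by rewrite /otube/= !hzB distrC. Qed.

Lemma mv_self c x rho : 0 < rho -> tube c rho `<=` U -> hz x = hz c -> mv c x = x.
Proof.
move=> rho0 tU xc; have hc := tube_center c (ltW rho0).
have hx : tube c rho x by rewrite /tube/= hzB xc subrr normr0 ltW.
have d0 : dirn c x = 0 by rewrite /dirn hzB xc subrr.
have ip0 y : ip w y 0 = 0 by rewrite -(scale0r (0 : 'rV[R]_n.+1)) ipZ mul0r.
have h0 : is_sol w c x (fun=> 0).
  by split=> // t _; rewrite d0 ip0 oppr0; exact: is_derive_cst.
have t01 : 0 <= (1 : R) <= 1 by rewrite ler01 lexx.
rewrite /mv /traj /pt (sol_unique Hw tU hc hx (solP Hw tU hc hx) h0 t01).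
by rewrite d0 scaler0 scale0r !addr0.
Qed.

(* The transport to [c] is constant along horizontal curves: its differential
   is a multiple of [ip w]. *)
Lemma mv_cocycle c c1 x rho : tube c rho `<=` U -> otube c rho x -> otube c rho c1 ->
  mv c (mv c1 x) = mv c x.
Proof.
move=> tU ox oc1.
(* This smaller closed tube is convex and contains [x] and [c1], hence the whole segment, yet stays
   inside the open tube where the transport to [c] is differentiable. *)
pose rho' := Num.max `|hz (x - c)| `|hz (c1 - c)|.
have rr' : rho' < rho by rewrite gt_max; apply/andP; split; [exact: ox|exact: oc1].
have hx : tube c rho' x by rewrite /tube/= le_max lexx.
have hc1 : tube c rho' c1 by rewrite /tube/= le_max lexx orbT.
have tU' : tube c rho' `<=` U.
  by move=> y yt; apply: tU; rewrite /tube/=; apply: le_trans (ltW rr').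
have inV (t : R) : 0 <= t <= 1 -> otube c rho (traj w c1 x t).
  by move=> t01; apply: le_lt_trans rr'; exact: pt_tube.
have oV : open (otube c rho) by exact: otube_open.
have VU y : otube c rho y -> U y by move=> /otube_sub; exact: tU.
have CT : class_C 1 (otube c rho) (transport w c).
  exact: (transport_regular Hw tU (in_C1 Hw)).
have dT (t : R) : 0 <= t <= 1 -> is_derive t 1 (transport w c \o traj w c1 x) 0.
  move=> t01; have dX := is_derive_traj Hw tU' hc1 hx t01.
  have := class_C1_chain oV CT (inV t t01) dX; congr is_derive.
  have [_ <-] := class_C1_is_derive (dirn c1 x - ip w (traj w c1 x t) (dirn c1 x) *: e)
    oV CT (inV t t01).
  have [_ ->] := transport_is_derive Hw tU
    (dirn c1 x - ip w (traj w c1 x t) (dirn c1 x) *: e) (inV t t01).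
  by rewrite ipB ipZ (ip_e Hw (VU _ (inV t t01))) mulr1 subrr mulr0.
have [t t01] := MVT_closed ltr01 dT; rewrite mul0r /= => /eqP.
have t0 : 0 <= (0 : R) <= 1 by rewrite lexx ler01.
have X0 : traj w c1 x 0 = x.
  have [s0 _] := solP Hw tU' hc1 hx.
  by rewrite /traj /pt s0 !scale0r !addr0.
rewrite subr_eq0 X0 => /eqP E.
have h1 : otube c rho (mv c1 x) by apply: otube_hz oc1; rewrite hz_mv.
have e1 := traj1 w h1; have e2 := traj1 w ox.
exact: (etrans e1 (etrans (congr1 (fun a => hz c + a *: e) E) (esym e2))).
Qed.

(** With a common radius each of the two tubes contains both points, so transport is available in
    both directions and the relation is symmetric. *)
Definition adjacent x y := exists rho,
  [/\ tube x rho `<=` U, tube y rho `<=` U & otube x rho y].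

Lemma adjacentC x y : adjacent x y -> adjacent y x.
Proof. by move=> [rho [h1 h2 h3]]; exists rho; split=> //; exact: otubeC. Qed.

Lemma adjacent_pos x y : adjacent x y -> exists2 rho, 0 < rho &
  [/\ tube x rho `<=` U, tube y rho `<=` U & otube x rho y].
Proof.
move=> [rho [h1 h2 h3]]; exists rho; last by split.
by rewrite (le_lt_trans _ h3).
Qed.

Lemma mv_inv c x : adjacent x c -> mv x (mv c x) = x.
Proof.
move=> /adjacent_pos[rho r0 [h1 h2 h3]].
by rewrite (mv_cocycle h1 (otube_center x r0) h3) (mv_self r0).
Qed.

(** The moves go to [p 1], ..., [p k]; the point [p 0] only marks the starting fibre. *)
Fixpoint mvs (p : nat -> 'rV[R]_n.+1) k x :=
  if k is k'.+1 then mv (p k) (mvs p k' x) else x.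

Lemma hz_mvs p k x : hz x = hz (p 0%N) -> hz (mvs p k x) = hz (p k).
Proof. by case: k => //= k; rewrite hz_mv. Qed.

(** Each square between the two rows is cut by the diagonal from [p k] to [q k.+1], and [mv_cocycle]
    collapses both triangles. *)
Lemma mvs_row (p q : nat -> 'rV[R]_n.+1) rho N x : hz x = hz (p 0%N) ->
  (forall k, (k < N)%N -> [/\ tube (q k.+1) rho `<=` U, otube (q k.+1) rho (p k),
     otube (q k.+1) rho (p k.+1) & otube (q k.+1) rho (q k)]) ->
  mv (q N) (mvs p N x) = mvs q N (mv (q 0%N) x).
Proof.
move=> xp; elim: N => [//|N IH] ok /=.
have [h1 h2 h3 h4] := ok N (ltnSn N).
rewrite -IH; last by move=> k kN; apply: ok; rewrite ltnS ltnW.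
have op : otube (q N.+1) rho (mvs p N x) by apply: otube_hz h2; rewrite hz_mvs.
by rewrite (mv_cocycle h1 op h3) (mv_cocycle h1 op h4).
Qed.

(** Rows are exchanged one at a time by [mvs_row]; on the two sides and in the last row all points
    share the fibre of [x], where the moves are the identity. *)
Lemma mvs_homotopy (H : nat -> nat -> 'rV[R]_n.+1) rho N x : 0 < rho ->
  (forall i j, tube (H i j) rho `<=` U) ->
  (forall i j i' j', (i <= i' <= i.+1)%N -> (j <= j' <= j.+1)%N -> (i' <= N)%N ->
    (j' <= N)%N -> `|hz (H i j - H i' j')| < rho) ->
  (forall i, hz (H i 0%N) = hz x) -> (forall i, hz (H i N) = hz x) ->
  (forall j, hz (H N j) = hz x) -> mvs (H 0%N) N x = x.
Proof.
move=> rho0 tU adj H0 HN Hlast.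
have row i : (i <= N)%N -> mvs (H 0%N) N x = mvs (H i) N x.
  elim: i => [//|i IH] iN; rewrite (IH (ltnW iN)).
  have := @mvs_row (H i) (H i.+1) rho N x (esym (H0 i)) _.
  rewrite (mv_self rho0 (tU _ _)) ?hz_mvs ?H0 ?HN//.
  rewrite (mv_self rho0 (tU _ _)) ?H0//; apply => k kN.
  have a1 : (i <= i.+1 <= i.+1)%N by rewrite leqnSn leqnn.
  have a2 : (k <= k.+1 <= k.+1)%N by rewrite leqnSn leqnn.
  have a3 : (i.+1 <= i.+1 <= i.+2)%N by rewrite leqnn leqnSn.
  have a4 : (k.+1 <= k.+1 <= k.+2)%N by rewrite leqnn leqnSn.
  by split=> //; apply: adj.
rewrite (row N)//.
have : forall k, mvs (H N) k x = x.
  elim=> [//|k /= ->]; rewrite (mv_self rho0 (tU _ _))// Hlast//.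
by move=> ->.
Qed.

End Cocycle.

Lemma continuous_sum (R : realType) (T : topologicalType) (V : normedModType R) (I : Type)
  (s : seq I) (f : I -> T -> V) (t : T) : (forall i, {for t, continuous (f i)}) ->
  {for t, continuous (fun r => \sum_(i <- s) f i r)}.
Proof.
move=> cf; elim: s => [|i s IH].
  rewrite (_ : (fun r => _) = fun=> 0); first exact: cst_continuous.
  by apply/funext => r; rewrite big_nil.
rewrite (_ : (fun r => _) = fun r => f i r + \sum_(j <- s) f j r).
  exact: continuousD.
by apply/funext => r; rewrite big_cons.
Qed.

Section Base.
Context {R : realType} {n : nat}.
Implicit Types (x u : 'rV[R]_n.+1) (y z : 'rV[R]_n) (D : set 'rV[R]_n).

Local Notation e := (@evert R n).
Definition base x : 'rV[R]_n := col' ord_max x.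
Definition lift0 y : 'rV[R]_n.+1 := \row_j oapp (fun i => y 0 i) 0 (unlift ord_max j).

Lemma baseE x i : base x 0 i = x 0 (lift ord_max i).
Proof. by rewrite mxE. Qed.

Lemma lift0K y : base (lift0 y) = y.
Proof. by apply/rowP => i; rewrite baseE mxE liftK. Qed.

Lemma baseB x u : base (x - u) = base x - base u.
Proof. by apply/rowP => i; rewrite !mxE. Qed.

Lemma norm_hz u : `|hz u| = `|base u|.
Proof.
apply/eqP; rewrite eq_le; apply/andP; split.
  apply: row_norm_le => // j; rewrite hz_coord; case: eqP => [_|/eqP jm].
    by rewrite normr0.
  have [i ji] : exists i, j = lift ord_max i.
    by case: (unliftP ord_max j) jm => [i ->|->]; [exists i|rewrite eqxx].
  by rewrite ji -baseE row_coord_le.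
apply: row_norm_le => // i; rewrite baseE.
have := row_coord_le (hz u) (lift ord_max i); rewrite hz_coord.
by rewrite eq_sym (negbTE (neq_lift _ _)).
Qed.

Lemma hz_base x u : hz x = hz u <-> base x = base u.
Proof.
split=> h; apply/eqP; rewrite -subr_eq0 -normr_eq0.
  by rewrite -baseB -norm_hz hzB h subrr normr0.
by rewrite -hzB norm_hz baseB h subrr normr0.
Qed.

Lemma base_vert x (a : R) : base (x + a *: e) = base x.
Proof. by apply/hz_base; rewrite hzD hzZ hz_e scaler0 addr0. Qed.

Lemma tube_cylinder D x (rho : R) :
  tube x rho `<=` cylinder D <-> (forall z, `|z - base x| <= rho -> D z).
Proof.
split=> [h z zx|h u]; last by rewrite /tube/= norm_hz baseB; exact: h.
have := h (lift0 z); rewrite /tube/cylinder/= norm_hz baseB lift0K => /(_ zx).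
by rewrite -/(base _) lift0K.
Qed.

Lemma base_continuous : continuous base.
Proof.
apply: nonexpansive_continuous => x u.
by rewrite -baseB -norm_hz hz_norm.
Qed.

Lemma cylinder_open D : open D -> open (cylinder D).
Proof. by move=> oD; apply: open_comp => // x _; exact: base_continuous. Qed.

End Base.

(** * Polygonal paths in the base *)

Section PolygonalPath.
Context {R : realType} {n : nat}.
Variables (y : nat -> 'rV[R]_n) (m : nat).

(** The [k]-th increment grows while [m%:R * t] runs through [[k, k + 1]]; in this form continuity
    needs no gluing of pieces. *)
Definition polygonal (t : R) : 'rV[R]_n :=
  y 0%N + \sum_(k < m) clip 0 1 (m%:R * t - k%:R) *: (y k.+1 - y k).

Lemma polygonal_continuous : continuous polygonal.
Proof.
move=> t; apply: continuousD; first exact: cst_continuous.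
apply: continuous_sum => k; apply: continuous_scalel.
have h : {for t, continuous (fun r : R => m%:R * r - k%:R)}.
  apply: continuousB; last exact: cst_continuous.
  by apply: continuousM => //; exact: cst_continuous.
exact: continuous_comp h (@clip_continuous R 0 1 _).
Qed.

Lemma polygonalE (k : nat) (s : R) : (k < m)%N -> 0 <= s <= 1 ->
  polygonal ((k%:R + s) / m%:R) = y k + s *: (y k.+1 - y k).
Proof.
move=> km /andP[s0 s1]; have m0 : m%:R != 0 :> R.
  by rewrite pnatr_eq0 -lt0n (leq_trans _ km).
rewrite /polygonal mulrC divfK// -(big_mkord xpredT
  (fun j => clip 0 1 (k%:R + s - j%:R) *: (y j.+1 - y j))).
(* Increments before [k] are complete and telescope, those after [k] have not begun. *)
rewrite (big_cat_nat (leq0n k) (ltnW km))/= [X in _ + (_ + X)]big_ltn//.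
rewrite [X in _ + (_ + (_ + X))](_ : _ = 0) ?addr0; last first.
  rewrite big_nat_cond big1// => j /andP[/andP[kj _] _].
  have jk : k%:R + 1 <= j%:R :> R by rewrite natr1 ler_nat.
  rewrite /clip min_l ?max_l ?scale0r//; lra.
rewrite (_ : \sum_(0 <= j < k) _ = \sum_(0 <= j < k) (y j.+1 - y j)); last first.
  apply: eq_big_nat => j /andP[_ jk].
  have {}jk : j%:R + 1 <= k%:R :> R by rewrite natr1 ler_nat.
  rewrite /clip min_r ?max_r ?scale1r//; lra.
rewrite telescope_sumr// addrA [y 0%N + _]addrC subrK.
by rewrite [_ + s]addrC addrK clip_id ?s0.
Qed.

Lemma polygonal_param (t : R) : (0 < m)%N -> 0 <= t <= 1 ->
  exists k s, [/\ (k < m)%N, 0 <= s <= 1 & t = (k%:R + s) / m%:R].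
Proof.
move=> m0 /andP[t0 t1]; have mn0 : 0 < m%:R :> R by rewrite ltr0n.
have : 0 <= t * m%:R <= m%:R by rewrite mulr_ge0 ?ler0n//= ger_pMl.
have -> : t = t * m%:R / m%:R by rewrite mulfK// gt_eqF.
rewrite -mulrA mulVf ?gt_eqF// mulr1; move: (t * m%:R) => a.
suff H : forall k, (0 < k)%N -> 0 <= a <= k%:R ->
    exists j s, [/\ (j < k)%N, 0 <= s <= 1 & a = j%:R + s].
  by move=> /(H m m0)[j [s [h1 h2 ->]]]; exists j, s.
elim=> [//|k IH] _ /andP[a0 ak].
have [ak'|ak'] := leP k%:R a.
  exists k, (a - k%:R); split=> //; last by rewrite addrC subrK.
  by move: ak; rewrite -natr1 => ak; apply/andP; split; lra.
case: k IH ak ak' => [_ _ |k IH _ /ltW ak]; first by rewrite ltNge a0.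
have [//||j [s [h1 h2 h3]]] := IH; first by rewrite a0.
by exists j, s; split=> //; exact: ltnW.
Qed.

End PolygonalPath.

Lemma within_comp_continuous (S T V : topologicalType) (A : set T) (f : T -> V) (g : S -> T) :
  {within A, continuous f} -> continuous g -> (forall s, A (g s)) ->
  continuous (f \o g).
Proof.
move=> /subspace_continuousP cf cg gA s B /= Bf.
have h : nbhs (g s) (fun x => A x -> B (f x)) by exact: (cf _ (gA s) B Bf).
have h' : nbhs s (fun r => A (g r) -> B (f (g r))) by exact: (cg s _ h).
by apply: (@filterS _ (nbhs s) _ _ _ _ h') => r; apply.
Qed.

(** * Uniform estimates on the unit square by compactness *)

Section UnitSquare.
Context {R : realType} {n : nat}.
Variables (D : set 'rV[R]_n) (H : R * R -> 'rV[R]_n).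
Hypotheses (oD : open D) (cH : continuous H).

Let sq : set (R * R) := `[0, 1] `*` `[0, 1].
Hypothesis HD : forall p, sq p -> D (H p).

Let sq_near_covering : near_covering sq.
Proof.
by apply/compact_near_coveringP/compact_setX; exact: segment_compact.
Qed.

Lemma square_lebesgue_radius : exists2 rho : R, 0 < rho &
  forall p, sq p -> forall z, `|z - H p| <= rho -> D z.
Proof.
have : \forall rho \near (0 : R)^'+, sq `<=`
    (fun p => forall z, `|z - H p| <= rho -> D z).
  apply: sq_near_covering => p sqp.
  have /nbhs_normP[r r0 rD] : nbhs (H p) D by apply: open_nbhs_nbhs; split=> //; exact: HD.
  have r20 : 0 < r / 2 by rewrite divr_gt0.
  have Hp : \forall p' \near p, `|H p - H p'| < r / 2.
    by have /cvgr_dist_lt := @cH p; apply.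
  near=> p' rho => z zp; apply: rD => /=.
  have -> : H p - z = (H p - H p') - (z - H p') by rewrite opprB addrA subrK.
  have h1 : `|H p - H p'| < r / 2 by near: p'.
  have h2 : rho < r / 2 by near: rho; exact: nbhs_right_lt.
  rewrite (le_lt_trans (ler_normB _ _))// [ltRHS]splitr ltrD//.
  exact: le_lt_trans zp h2.
move=> h.
have pos : \forall rho \near (0 : R)^'+, 0 < rho by exact: nbhs_right_gt.
have [rho [r0 hr]] := filter_ex (filterI pos h).
by exists rho => // p; exact: hr.
Unshelve. all: by end_near. Qed.

Lemma square_uniform_continuity (rho : R) : 0 < rho -> exists2 d : R, 0 < d &
  forall p p', sq p -> sq p' -> `|p.1 - p'.1| <= d -> `|p.2 - p'.2| <= d ->
    `|H p - H p'| < rho.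
Proof.
move=> rho0.
have : \forall d \near (0 : R)^'+, sq `<=`
    (fun p => forall p', sq p' -> `|p.1 - p'.1| <= d -> `|p.2 - p'.2| <= d ->
    `|H p - H p'| < rho).
  apply: sq_near_covering => p sqp.
  have r20 : 0 < rho / 2 by rewrite divr_gt0.
  have : \forall q \near p, `|H p - H q| < rho / 2.
    by have /cvgr_dist_lt := @cH p; apply.
  move=> /nbhs_normP[r r0 rH].
  have rr0 : 0 < r / 2 by rewrite divr_gt0.
  have near_p : \forall p' \near p, `|p - p'| < r / 2.
    by apply/nbhs_normP; exists (r / 2).
  near=> p' d => q sqq d1 d2.
  have h1 : `|p - p'| < r / 2 by near: p'.
  have h2 : d < r / 2 by near: d; exact: nbhs_right_lt.
  have h3 : `|p' - q| < r / 2.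
    by rewrite prod_normE/= gt_max; apply/andP; split; exact: le_lt_trans h2.
  have -> : H p' - H q = (H p - H q) - (H p - H p') by rewrite opprB [RHS]addrC addrA subrK.
  have k1 : `|H p - H q| < rho / 2.
    apply: rH => /=; have -> : p - q = (p - p') + (p' - q) by rewrite addrA subrK.
    by rewrite (le_lt_trans (ler_normD _ _))// [ltRHS]splitr ltrD.
  have k2 : `|H p - H p'| < rho / 2.
    by apply: rH => /=; rewrite (lt_trans h1)// ltr_pdivrMr// mulr_natr mulr2n ltrDl.
  by rewrite (le_lt_trans (ler_normB _ _))// [ltRHS]splitr ltrD.
move=> h.
have pos : \forall d \near (0 : R)^'+, 0 < d by exact: nbhs_right_gt.
have [d [d0 hd]] := filter_ex (filterI pos h).
by exists d => // p p' sqp; exact: hd.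
Unshelve. all: by end_near. Qed.

End UnitSquare.

(** * Leaves and triviality of their monodromy *)

Section Leaves.
Context {R : realType} {n : nat}.
Variables (D : set 'rV[R]_n) (w : 'I_n.+1 -> 'rV[R]_n.+1 -> R) (C : R).
Hypotheses (oD : open D) (lD : loops_null_homotopic D).
Local Notation U := (cylinder D).
Hypothesis Hw : integrable_normal U w C.
Implicit Types (x y z : 'rV[R]_n.+1).

Definition leaf_step x y := adjacent U x y /\ y = mv w y x.

(** Finite chains of lifted segments take the place of integral curves, so statements about leaves
    are inductions on chains. *)
Inductive leaf x : 'rV[R]_n.+1 -> Prop :=
| leaf_refl : leaf x x
| leaf_snoc y z : leaf x y -> leaf_step y z -> leaf x z.

Lemma leaf_trans y x z : leaf x y -> leaf y z -> leaf x z.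
Proof. by move=> xy; elim=> // a b _ xa ab; exact: leaf_snoc ab. Qed.

Lemma leaf1 x y : leaf_step x y -> leaf x y.
Proof. by move=> xy; apply: leaf_snoc xy; exact: leaf_refl. Qed.

Lemma leaf_step_sym x y : leaf_step x y -> leaf_step y x.
Proof.
by move=> [a E]; split; [exact: adjacentC|rewrite {1}E (mv_inv Hw)].
Qed.

Lemma leaf_sym x y : leaf x y -> leaf y x.
Proof.
elim=> [|a b _ IH ab]; first exact: leaf_refl.
by apply: leaf_trans IH; exact/leaf1/leaf_step_sym.
Qed.

Lemma leaf_chain x y : leaf x y -> exists (p : nat -> 'rV[R]_n.+1) m,
  [/\ p 0%N = x, p m = y & forall k, (k < m)%N -> leaf_step (p k) (p k.+1)].
Proof.
elim=> [|a b _ [p [m [p0 pm ps]]] ab]; first by exists (fun=> x), 0%N.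
exists (fun k => if (k <= m)%N then p k else b), m.+1.
split=> [//||k kS]; rewrite ?ltnn//.
have [km|mk|->] := ltngtP k m; first exact: ps.
- by move: kS; rewrite ltnS leqNgt mk.
- by rewrite pm.
Qed.

(* The loop below a chain of transports is made polygonal, so that sampling it
   at the points [i / (m * N')] refines the chain; a null homotopy sampled on a
   fine grid then deforms the transport along it to the identity. *)
Lemma monodromy x y : U x -> leaf x y -> base x = base y -> x = y.
Proof.
move=> Ux /leaf_chain[p [m [p0 pm ps]]] xy.
have [m0|m0] := posnP m; first by rewrite -p0 -pm m0.
pose b k := base (p k).
pose cc := polygonal b m.
have mn0 : 0 < m%:R :> R by rewrite ltr0n.
have convex_ball (z a a' : 'rV[R]_n) (s rho : R) : 0 <= s <= 1 ->
    `|a - z| < rho -> `|a' - z| < rho -> `|a + s *: (a' - a) - z| < rho.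
  move=> /andP[s0 s1] h1 h2.
  have -> : a + s *: (a' - a) - z = (1 - s) *: (a - z) + s *: (a' - z).
    by apply/rowP => i; rewrite !mxE; ring.
  have s10 : 0 <= 1 - s by rewrite subr_ge0.
  rewrite (le_lt_trans (ler_normD _ _))// !normrZ (ger0_norm s0) (ger0_norm s10).
  have [->|sn0] := eqVneq s 0; first by rewrite mul0r addr0 subr0 mul1r.
  have sp : 0 < s by rewrite lt_def sn0.
  have k1 : s * `|a' - z| < s * rho by rewrite ltr_pM2l.
  have k2 : (1 - s) * `|a - z| <= (1 - s) * rho by rewrite ler_wpM2l// ltW.
  lra.
have seg k (s : R) : (k < m)%N -> 0 <= s <= 1 ->
    exists2 rho, tube (p k.+1) rho `<=` U &
      0 < rho /\ otube (p k.+1) rho (lift0 (b k + s *: (b k.+1 - b k))).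
  move=> km s01; have [/adjacent_pos[rho r0 [h1 h2 h3]] _] := ps _ km.
  exists rho => //; split=> //; rewrite /otube/= norm_hz baseB lift0K.
  apply: convex_ball => //; last by rewrite subrr normr0.
  by rewrite -baseB -norm_hz; exact: (otubeC h3).
have ccD (t : R) : t \in `[0, 1] -> D (cc t).
  rewrite in_itv/= => /(polygonal_param m0)[k [s [km s01 ->]]].
  have [rho tU [r0 /otube_sub/tU]] := seg k s km s01.
  by rewrite /cylinder/= -/(base _) lift0K /cc polygonalE.
have cc0 : cc 0 = base x.
  have -> : 0 = (0%:R + 0) / m%:R :> R by rewrite addr0 mul0r.
  by rewrite /cc polygonalE ?lexx ?ler01// scale0r addr0 /b p0.
have cc1 : cc 1 = base x.
  have -> : 1 = (m.-1%:R + 1) / m%:R :> R.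
    by rewrite natr1 prednK// divff// gt_eqF.
  rewrite /cc polygonalE ?prednK ?ler01 ?lexx//.
  by rewrite scale1r addrC subrK /b pm xy.
have ccc : {within `[0, 1], continuous cc}.
  by apply: continuous_subspaceT; exact: polygonal_continuous.
have [H [cH HD H0 H1 Hs]] := lD ccc ccD (etrans cc0 (esym cc1)).
(* Clipping extends the null homotopy to a continuous map of the plane with values still in [D]. *)
pose G (q : R * R) := H (clip 0 1 q.1) (clip 0 1 q.2).
have clipI (t : R) : clip 0 1 t \in `[0, 1] by rewrite in_itv/= clip_itv.
have cG : continuous G.
  pose cl (q : R * R) := (clip 0 1 q.1, clip 0 1 q.2).
  suff : continuous ((fun q : R * R => H q.1 q.2) \o cl) by [].
  have c1 q : {for q, continuous (fun q : R * R => clip 0 1 q.1)}.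
    apply: (@continuous_comp _ _ _ fst (clip 0 1)); first exact: cvg_fst.
    exact: clip_continuous.
  have c2 q : {for q, continuous (fun q : R * R => clip 0 1 q.2)}.
    apply: (@continuous_comp _ _ _ snd (clip 0 1)); first exact: cvg_snd.
    exact: clip_continuous.
  apply: (within_comp_continuous cH) => q; last by split; exact: clipI.
  exact: continuous_pair (c1 q) (c2 q).
have GD q : D (G q) by apply: HD; exact: clipI.
have [rho r0 rhoP] := square_lebesgue_radius oD cG (fun q _ => GD q).
have [d d0 dP] := square_uniform_continuity cG r0.
(* [N] is a multiple of [m], so the vertices of the polygon are grid points; [N'] exceeds [d^-1], so
   neighbouring grid points have images closer than [rho]. *)
pose N' := (Num.truncn (d^-1)).+1; pose N := (m * N')%N.
have N'0 : (0 < N')%N by [].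
have N0 : (0 < N)%N by rewrite muln_gt0 m0.
have NR0 : 0 < N%:R :> R by rewrite ltr0n.
have dN : N%:R^-1 <= d.
  rewrite invf_ple ?posrE//; have : d^-1 < N'%:R by exact: truncnS_gt.
  move/ltW/le_trans; apply; rewrite ler_nat; exact: leq_pmull.
pose K i j := lift0 (G (i%:R / N%:R, j%:R / N%:R)).
have clipN i : (i <= N)%N -> clip 0 1 (i%:R / N%:R) = i%:R / N%:R :> R.
  by move=> iN; rewrite clip_id// divr_ge0//= ler_pdivrMr// mul1r ler_nat.
have clip0 : clip 0 1 (0%:R / N%:R) = 0 :> R by rewrite clipN// mul0r.
have clip1 : clip 0 1 (N%:R / N%:R) = 1 :> R by rewrite clipN// divff// gt_eqF.
(* Row [0] of the grid samples the loop; the other three sides lie over [base x], as [mvs_homotopy]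
   demands. *)
have inv : mvs w (K 0%N) N x = x.
  apply: (mvs_homotopy Hw (rho := rho) r0).
  - move=> i j; apply/tube_cylinder => z; rewrite /K lift0K.
    set q := (_, _) => zq.
    pose q' := (clip 0 1 q.1, clip 0 1 q.2).
    have Gq : G q = G q' by rewrite /G /q'/= !(clip_id (clip_itv _ ler01)).
    by apply: (rhoP q'); rewrite -?Gq//; split=> /=; exact: clipI.
  - move=> i j i' j' /andP[ii1 ii2] /andP[jj1 jj2] iN jN.
    have iN0 := leq_trans ii1 iN; have jN0 := leq_trans jj1 jN.
    have sqI a : (a <= N)%N -> (a%:R / N%:R : R) \in `[0, 1].
      by move=> /clipN <-; exact: clipI.
    have close a a' : (a <= a')%N -> (a' <= a.+1)%N ->
        `|a%:R / N%:R - a'%:R / N%:R| <= d.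
      move=> aa1 aa2; rewrite -mulrBl normrM [X in _ * X]ger0_norm ?invr_ge0//.
      apply: le_trans dN; rewrite ler_piMl ?invr_ge0//.
      rewrite distrC -natrB// ger0_norm// -[1]/(1%:R) ler_nat leq_subLR.
      by rewrite addn1.
    rewrite norm_hz baseB !lift0K; apply: dP => /=; try by split; exact: sqI.
      exact: close.
    exact: close.
  - move=> i; apply/hz_base; rewrite lift0K /G/= clip0 -cc0.
    by have [-> _] := Hs _ (clipI (i%:R / N%:R)).
  - move=> i; apply/hz_base; rewrite lift0K /G/= clip1 -cc0.
    by have [_ ->] := Hs _ (clipI (i%:R / N%:R)).
  - move=> j; apply/hz_base; rewrite lift0K /G/= clip1 -cc0.
    exact: H1 (clipI _).
have qE k l : (k < m)%N -> (l <= N')%N ->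
    K 0%N (k * N' + l)%N = lift0 (b k + (l%:R / N'%:R) *: (b k.+1 - b k)).
  move=> km lN; have klN : (k * N' + l <= N)%N.
    apply: (@leq_trans (k.+1 * N')); last by rewrite leq_mul2r km orbT.
    by rewrite mulSn addnC leq_add2r.
  rewrite /K /G/= clip0 clipN// H0; last first.
    by rewrite -clipN//; exact: clipI.
  congr lift0; rewrite /cc -(@polygonalE _ _ b m k (l%:R / N'%:R))//; last first.
    by rewrite divr_ge0//= ler_pdivrMr ?ltr0n// mul1r ler_nat.
  congr (polygonal _ _ _); rewrite /N natrD !natrM.
  field.
  by rewrite !pnatr_eq0 -!lt0n m0 N'0.
have K00 : hz x = hz (K 0%N 0%N).
  by apply/hz_base; rewrite lift0K /G/= clip0 H0 ?in_itv/= ?lexx ?ler01// cc0.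
(* The pieces of one edge stay in a tube about [p k.+1], so [mv_cocycle] absorbs each small step
   into the final transport to that fibre: the refined chain reproduces the original one at the
   vertices. *)
have block k : (k <= m)%N -> mvs w (K 0%N) (k * N')%N x = p k.
  elim: k => [_|k IH km]; first by rewrite mul0n p0.
  have {}IH := IH (ltnW km).
  have lbase l : (l <= N')%N -> hz (mvs w (K 0%N) (k * N' + l)%N x) =
      hz (lift0 (b k + (l%:R / N'%:R) *: (b k.+1 - b k))).
    by move=> lN; rewrite hz_mvs// qE.
  have l01 l : (l <= N')%N -> 0 <= (l%:R / N'%:R : R) <= 1.
    by move=> lN; rewrite divr_ge0//= ler_pdivrMr ?ltr0n// mul1r ler_nat.
  have step l : (l <= N')%N -> mv w (p k.+1) (mvs w (K 0%N) (k * N' + l)%N x) = p k.+1.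
    elim: l => [_|l IHl lN]; first by rewrite addn0 IH; have [_ <-] := ps k km.
    have {}IHl := IHl (ltnW lN).
    have [/adjacent_pos[r rr0 [h1 h2 h3]] _] := ps k km.
    have in_tube (s : R) : 0 <= s <= 1 ->
        otube (p k.+1) r (lift0 (b k + s *: (b k.+1 - b k))).
      move=> s01; rewrite /otube/= norm_hz baseB lift0K.
      apply: convex_ball => //; last by rewrite subrr normr0.
      by rewrite -baseB -norm_hz; exact: (otubeC h3).
    rewrite addnS /= -addnS qE//.
    rewrite (mv_cocycle Hw h2 _ (in_tube _ (l01 _ lN)))//.
    by apply: otube_hz (in_tube _ (l01 _ (ltnW lN))); rewrite lbase// ltnW.
  have := step N' (leqnn _); rewrite -mulSnr.
  have [/adjacent_pos[r rr0 [h1 h2 h3]] _] := ps k km.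
  rewrite (mv_self Hw rr0 h2)// mulSnr lbase//.
  apply/hz_base; rewrite lift0K divff ?pnatr_eq0 -?lt0n//.
  by rewrite scale1r addrC subrK.
by rewrite -pm -(block m (leqnn _)) -/N inv.
Qed.

End Leaves.

(** * The first integral *)

Section Frobenius.
Context {R : realType} {m : nat}.
Implicit Types (x p q u : 'rV[R]_m) (v : 'rV[R]_m -> 'rV[R]_m).

Definition pairing v x u : R := \sum_k v x 0 k * u 0 k.

Lemma one_formE v x (M : 'M[R]_(1, m)) : one_form v x M = pairing v x M.
Proof. by apply: eq_bigr => k _; rewrite dxE. Qed.

(** The exterior derivative on constant vector fields [p] and [q], for which no bracket term
    occurs. *)
Definition curl v x p q : R :=
  'D_p (fun y => pairing v y q) x - 'D_q (fun y => pairing v y p) x.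

Lemma extd_one_form v x (M : 'M[R]_(2, m)) :
  extd (one_form v) x M = curl v x (row 0 M) (row 1 M).
Proof.
rewrite /extd big_ord_recl big_ord1 expr0 mul1r expr1 mulN1r /curl.
have E1 : row' ord0 M = row 1 M.
  by apply/matrixP => i j; rewrite !mxE (ord1 i); congr (M _ _); apply/val_inj.
have E2 : row' (lift ord0 ord0) M = row 0 M.
  by apply/matrixP => i j; rewrite !mxE (ord1 i); congr (M _ _); apply/val_inj.
have E3 : row (lift ord0 ord0) M = row 1 M by congr row; apply/val_inj.
have F1 : (fun y => one_form v y (row' ord0 M)) = (fun y => pairing v y (row 1 M)).
  by apply/funext => y; rewrite one_formE E1.
have F2 : (fun y => one_form v y (row' (lift ord0 ord0) M)) =
    (fun y => pairing v y (row 0 M)).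
  by apply/funext => y; rewrite one_formE E2.
by rewrite F1 F2 E3.
Qed.

Lemma curlC v x p q : curl v x p q = - curl v x q p.
Proof. by rewrite /curl opprB. Qed.

Lemma perm3_fix0 (s : 'S_(1 + 2)) : s 0 = 0 -> s = 1%g \/ s = tperm 1 2%:R.
Proof.
move=> s0; have inj := @perm_inj _ s.
have n1 : s 1 != 0 by rewrite -s0 (inj_eq inj).
have n2 : s 2%:R != 0 by rewrite -s0 (inj_eq inj).
have n12 : s 1 != s 2%:R by rewrite (inj_eq inj).
have three (i : 'I_3) : [\/ i = 0, i = 1 | i = 2%:R].
  case: i => [[|[|[|//]]] hi]; [apply: Or31|apply: Or32|apply: Or33]; exact: val_inj.
have [E|E|E] := three (s 1); first by rewrite E eqxx in n1.
- have E2 : s 2%:R = 2%:R.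
    by have [E'|E'|//] := three (s 2%:R); [rewrite E' eqxx in n2|rewrite E E' eqxx in n12].
  by left; apply/perm.permP => i; rewrite perm1; have [->|->|->] := three i.
- have E2 : s 2%:R = 1.
    by have [E'|//|E'] := three (s 2%:R); [rewrite E' eqxx in n2|rewrite E E' eqxx in n12].
  right; apply/perm.permP => i; have [->|->|->] := three i.
  + by rewrite s0 tpermD.
  + by rewrite tpermL.
  + by rewrite tpermR.
Qed.

(** With [p] and [q] in the kernel only permutations fixing the first slot survive in the wedge sum;
    the two of them contribute equally, the sign cancelling the antisymmetry of [curl]. *)
Lemma wedge_curl v x (u p q : 'rV[R]_m) : pairing v x p = 0 -> pairing v x q = 0 ->
  (forall V, wedge (one_form v) (extd (one_form v)) x V = 0) ->
  pairing v x u * curl v x p q = 0.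
Proof.
move=> p0 q0 hw.
pose r (i : 'I_(1 + 2)) := if i == 0 then u else if i == 1 then p else q.
pose V : 'M[R]_(1 + 2, m) := \matrix_(i, j) r i 0 j.
have usubE (s : 'S_(1 + 2)) : usubmx (row_perm s V) = r (s 0).
  apply/rowP => j; rewrite !mxE; congr (r (s _) _ _); exact/val_inj.
have dsub1 (s : 'S_(1 + 2)) : row 0 (dsubmx (row_perm s V)) = r (s 1).
  apply/rowP => j; rewrite !mxE; congr (r (s _) _ _); exact/val_inj.
have dsub2 (s : 'S_(1 + 2)) : row 1 (dsubmx (row_perm s V)) = r (s 2%:R).
  apply/rowP => j; rewrite !mxE; congr (r (s _) _ _); exact/val_inj.
have := hw V; rewrite /wedge => /eqP.
rewrite mulf_eq0 invr_eq0 pnatr_eq0 muln_eq0 !(gtn_eqF (fact_gt0 _))/= => /eqP.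
set K := pairing v x u * curl v x p q.
under eq_bigr => s _ do rewrite one_formE extd_one_form usubE dsub1 dsub2.
rewrite (bigID (fun s : 'S_(1 + 2) => s 0 == 0))/= [X in _ + X]big1 ?addr0; last first.
  move=> s s0; rewrite /r (negbTE s0); case: ifP => _.
    by rewrite p0 mulr0 mul0r.
  by rewrite q0 mulr0 mul0r.
rewrite (eq_bigr (fun=> K)) => [|s /eqP s0]; last first.
  rewrite s0 /r eqxx; have [->|->] := perm3_fix0 s0.
    by rewrite odd_perm1 !perm1/= expr0 mul1r.
  rewrite odd_tperm tpermL tpermR/= expr1 mulN1r mulNr.
  by rewrite /K (curlC v x q p) mulrN opprK.
(* It suffices that the number of equal terms is nonzero, which the identity permutation shows. *)
rewrite sumr_const => /eqP; rewrite mulrn_eq0 => /orP[|/eqP//].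
by move=> /eqP/card0_eq/(_ 1%g); rewrite unfold_in perm1.
Qed.

End Frobenius.

Section SmoothSlice.
Context {R : realType} {m : nat}.

Lemma smooth1_id (r : nat) : smooth1 r (@id R).
Proof.
have cs (a : R) s : smooth1 s (fun=> a).
  elim: s a => [|s IH] a; split=> //; try exact: cst_continuous.
  by exists (fun=> 0) => // t; exact: is_derive_cst.
case: r => [|r]; split=> //; first by move=> t; exact: cvg_id.
  by move=> t; exact: cvg_id.
by exists (fun=> 1) => // t; exact: is_derive_id.
Qed.

Lemma smooth1_slice (V : set 'rV[R]_m) (F : 'rV[R]_m -> R) (q : 'rV[R]_m) i r :
  open V -> (forall t : R, V (q + t *: delta_mx 0 i)) -> class_C r V F ->
  smooth1 r (fun t => F (q + t *: delta_mx 0 i)).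
Proof.
move=> oV qV; have cl (t : R) : {for t, continuous (fun t : R => q + t *: delta_mx 0 i)}.
  by apply: continuousD; [exact: cst_continuous|exact: continuous_scalel].
have ck k (G : 'rV[R]_m -> R) : class_C k V G ->
      continuous (fun t : R => G (q + t *: delta_mx 0 i)).
  move=> CG t; apply: (@continuous_comp _ _ _ _ G _ (cl t)).
  exact: class_C_continuous oV CG (qV t).
elim: r F => [|r IH] F CF; first by split=> //; exact: ck CF.
split; first exact: ck CF.
exists (fun t => 'D_(delta_mx 0 i) F (q + t *: delta_mx 0 i)); last first.
  exact: (IH (fun x => 'D_(delta_mx 0 i) F x) (class_C_partial i CF)).
move=> t; apply: is_derive_line.
by have [] := class_C_is_derive i CF (qV t).
Qed.

End SmoothSlice.

(** * Construction and regularity of the global first integral *)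

Section FirstIntegral.
Context {R : realType} {n : nat}.
Variables (D : set 'rV[R]_n) (w : 'I_n.+1 -> 'rV[R]_n.+1 -> R) (C : R) (r : nat).
Hypotheses (hD : domain D) (lD : loops_null_homotopic D).
Local Notation U := (cylinder D).
Local Notation e := (@evert R n).
Hypothesis Hw : integrable_normal U w C.
Hypothesis Cw : forall i, class_C r.+1 U (w i).
Implicit Types (x y z : 'rV[R]_n.+1).

Let oD : open D. Proof. by case: hD. Qed.
Let oU : open U. Proof. exact: cylinder_open. Qed.

Lemma local_tube x : U x -> exists2 rho, 0 < rho & tube x rho `<=` U /\
  forall y, otube x rho y -> adjacent U x y.
Proof.
move=> Ux; have /nbhs_normP[d d0 dD] : nbhs (base x) D by apply: open_nbhs_nbhs.
have d40 : 0 < d / 4 by rewrite divr_gt0.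
have d4 : d / 4 + d / 4 < d by lra.
(* Room is needed for two radii: the displacement of the centre and the tube about the new
   centre. *)
exists (d / 4) => //; split.
  apply/tube_cylinder => z zx; apply: dD => /=.
  by rewrite distrC (le_lt_trans zx)//; lra.
move=> y xy; exists (d / 4); split=> //.
  apply/tube_cylinder => z zx; apply: dD => /=.
  by rewrite distrC (le_lt_trans zx)//; lra.
apply/tube_cylinder => z zy; apply: dD => /=.
have h : `|base y - base x| < d / 4 by rewrite -baseB -norm_hz.
rewrite distrC -[z](subrK (base y)) -addrA (le_lt_trans (ler_normD _ _))//.
by rewrite (lt_trans _ d4)// ler_ltD.
Qed.

(** Connectedness as an induction principle: the base points where [Q] holds form an open and
    relatively closed set, because nearby fibres are adjacent and adjacency is symmetric. Points of
    one fibre are adjacent too, so [Q] depends on the base point only. *)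
Lemma domain_ind (Q : 'rV[R]_n.+1 -> Prop) x0 : U x0 -> Q x0 ->
  (forall x y, U x -> adjacent U x y -> Q x -> Q y) -> forall x, U x -> Q x.
Proof.
move=> U0 Q0 Qadj; have [_ _ connD] := hD.
have inv x y : U x -> U y -> base x = base y -> Q x -> Q y.
  move=> Ux Uy xy; have [rho r0 [_ adj]] := local_tube Ux.
  apply: Qadj => //; apply: adj; apply: otube_hz (otube_center x r0).
  exact/hz_base.
have U_lift (z : 'rV[R]_n) : D z -> U (lift0 z) by rewrite /cylinder/= -/(base _) lift0K.
pose B := [set z | D z /\ Q (lift0 z)].
have BD : B = D.
  have near_adj (z : 'rV[R]_n) : D z ->
      exists2 d, 0 < d & forall z' : 'rV[R]_n, `|z - z'| < d ->
      D z' /\ adjacent U (lift0 z) (lift0 z').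
    move=> Dz; have [rho r0 [tU adj]] := local_tube (U_lift _ Dz).
    exists rho => // z' zz'.
    have ot : otube (lift0 z) rho (lift0 z') by rewrite /otube/= norm_hz baseB !lift0K distrC.
    split; last exact: adj.
    by have := tU _ (otube_sub ot); rewrite /cylinder/= -/(base _) lift0K.
  apply: connD.
  - exists (base x0); split=> //; apply: inv Q0 => //; first exact: U_lift.
    by rewrite lift0K.
  - exists B; last by rewrite setIidr// => z [].
    rewrite openE => z [Dz Qz]; have [d d0 dz] := near_adj z Dz.
    suff : \forall z' \near z, B z' by [].
    apply/nbhs_normP; exists d => // z' /= /dz[Dz' adj].
    by split=> //; apply: Qadj Qz => //; exact: U_lift.
  - exists (closure B); first exact: closed_closure.
    rewrite eqEsubset; split=> z; first by move=> Bz; split; [case: Bz|exact: subset_closure].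
    move=> [Dz clz]; split=> //; have [d d0 dz] := near_adj z Dz.
    have nz : \forall z' \near z, `|z - z'| < d by apply/nbhs_normP; exists d.
    have [z' [[Dz' Qz'] zz']] := clz _ nz.
    have [_ adj] := dz _ zz'.
    by apply: (Qadj _ _ (U_lift _ Dz') _ Qz'); exact: adjacentC.
move=> x Ux; have : B (base x) by rewrite BD.
move=> [_]; apply: inv => //; first exact: U_lift.
by rewrite lift0K.
Qed.

Variable x0 : 'rV[R]_n.+1.
Hypothesis U0 : U x0.
Let c0 := hz x0.

Let hzv c (a : R) : hz (hz c + a *: e) = hz c.
Proof. by rewrite hzD hz_hz hzZ hz_e scaler0 addr0. Qed.

Let basev c (a : R) : base (hz c + a *: e) = base c.
Proof. by apply/hz_base; exact: hzv. Qed.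

Let Uv c (a : R) : U c -> U (hz c + a *: e).
Proof. by rewrite /cylinder/= -!/(base _) basev. Qed.

Let lastv c (a : R) : (hz c + a *: e) 0 ord_max = a.
Proof. by rewrite mxE hz_last mxE e_last mulr1 add0r. Qed.

Lemma adjacent_in x y : adjacent U x y -> U x /\ U y.
Proof.
move=> /adjacent_pos[rho r0 [h1 h2 _]].
by split; [apply: h1|apply: h2]; apply: tube_center; exact: ltW.
Qed.

Lemma leaf_mv x y : adjacent U x y -> leaf D w x (mv w y x).
Proof.
move=> a; apply: leaf1; split; last by apply: mv_hz; rewrite hz_mv.
have [rho [h1 h2 h3]] := a; exists rho; split=> //.
  apply/tube_cylinder => z; rewrite (_ : base (mv w y x) = base y).
    by move: z; apply/tube_cylinder.
  by apply/hz_base; exact: hz_mv.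
by apply: otube_hz h3; rewrite hz_mv.
Qed.

Lemma leaf_hits x : U x -> exists a, leaf D w x (c0 + a *: e).
Proof.
(* The claim is strengthened to whole fibres, since the induction hypothesis has to apply at the
   arrival point of a transport, whose height is not prescribed. *)
move=> Ux; suff : forall y, U y -> forall x, base x = base y ->
    exists a, leaf D w x (c0 + a *: e) by move=> /(_ x Ux x erefl).
apply: (@domain_ind _ x0 U0) => [z zx0|y z Uy a IH z' z'z].
  exists (z 0 ord_max); rewrite [z in leaf _ _ z _]hz_decomp.
  by rewrite (proj2 (hz_base z x0))//; exact: leaf_refl.
have a' : adjacent U z' y.
  have [rho [h1 h2 h3]] := a; exists rho; split=> //.
    by apply/tube_cylinder; rewrite z'z; apply/tube_cylinder.
  by apply: otubeC; apply: otube_hz h3; apply/hz_base.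
have [|b hb] := IH (mv w y z'); first by apply/hz_base; rewrite hz_mv.
by exists b; apply: leaf_trans hb; exact: leaf_mv.
Qed.

(* The junk value [0] of [xget] never occurs above [D], by [leaf_hits]. *)
Definition first_integral x : R := xget 0 [set a | leaf D w x (c0 + a *: e)].
Local Notation f := first_integral.

Lemma first_integralP x : U x -> leaf D w x (c0 + f x *: e).
Proof. by move=> /leaf_hits; exact: (@xgetPex _ 0 [set a | leaf D w x (c0 + a *: e)]). Qed.

(** Both values mark points of the base fibre on one leaf, and [monodromy] identifies these
    points. *)
Lemma first_integral_leaf x y : U x -> U y -> leaf D w x y -> f x = f y.
Proof.
move=> Ux Uy xy; have hx := first_integralP Ux; have hy := first_integralP Uy.
have h : leaf D w (c0 + f x *: e) (c0 + f y *: e).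
  exact: leaf_trans (leaf_sym Hw hx) (leaf_trans xy hy).
have := monodromy oD lD Hw (Uv _ U0) h; rewrite !basev => /(_ erefl) E.
by have := congr1 (fun z : 'rV[R]_n.+1 => z 0 ord_max) E; rewrite /c0 !lastv.
Qed.

Lemma first_integral_base (a : R) : f (c0 + a *: e) = a.
Proof.
have Ua := Uv a U0; have h := first_integralP Ua.
have := monodromy oD lD Hw Ua h; rewrite !basev => /(_ erefl) E.
by have := congr1 (fun z : 'rV[R]_n.+1 => z 0 ord_max) E; rewrite /c0 !lastv.
Qed.

(** This factorization through the transport reduces the regularity of [f] near a fibre to that of a
    function of one variable, its restriction to the fibre. *)
Lemma first_integral_local c (rho : R) x : tube c rho `<=` U -> otube c rho x ->
  adjacent U x c -> f x = f (hz c + transport w c x *: e).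
Proof.
move=> tU ox a; have [Ux Uc] := adjacent_in a.
apply: first_integral_leaf => //; first exact: Uv.
by rewrite -(traj1 w ox); exact: leaf_mv.
Qed.

(** What has to be known on the fibre of [c] to get the regularity of [f] and a nonvanishing
    differential nearby. *)
Definition good_slice c := smooth1 r.+1 (fun a => f (hz c + a *: e)) /\
  exists2 dh : R -> R, (forall a : R, dh a != 0) &
    forall a : R, is_derive a 1 (fun a => f (hz c + a *: e)) (dh a).

Lemma slice_local c : U c -> good_slice c -> exists2 rho : R, 0 < rho &
  [/\ tube c rho `<=` U, (forall y, otube c rho y -> adjacent U y c) &
   forall x, otube c rho x ->
     f x = ((fun a => f (hz c + a *: e)) \o transport w c) x].
Proof.
move=> Uc _; have [rho r0 [tU adj]] := local_tube Uc.
have adj' y : otube c rho y -> adjacent U y c by move=> /adj; exact: adjacentC.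
exists rho => //; split=> // x ox; exact: (first_integral_local tU ox (adj' _ ox)).
Qed.

(** On the base fibre the slice is the identity. Passing to an adjacent fibre composes the slice
    with the transport restricted to that fibre, whose derivative there is the positive [gfun], so
    both properties spread over [D]. *)
Lemma good_slice_all c : U c -> good_slice c.
Proof.
move: c; apply: (@domain_ind _ x0 U0).
  have E : (fun a => f (hz x0 + a *: e)) = id by apply/funext => a; exact: first_integral_base.
  rewrite /good_slice E; split; first exact: smooth1_id.
  by exists (fun=> 1) => a; [exact: oner_neq0|exact: is_derive_id].
move=> c c' Uc adj [Sh [dh dh0 hd]].
have [rho r0 [tU tU' oc']] := adjacent_pos adj.
have oV : open (otube c rho) by exact: otube_open.
have ov (a : R) : otube c rho (hz c' + a *: e) by apply: otube_hz oc'; rewrite hzv.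
have CT := transport_regular Hw tU Cw.
have Chf := class_C_comp oV Sh CT.
have E : (fun a => f (hz c' + a *: e)) =
    (fun a => ((fun a => f (hz c + a *: e)) \o transport w c) (hz c' + a *: e)).
  apply/funext => a; apply: (first_integral_local tU (ov a)).
  exists rho; split=> //; last by apply: otubeC; exact: ov.
  by apply/tube_cylinder; rewrite basev; apply/tube_cylinder.
split; rewrite E; first exact: smooth1_slice Chf.
exists (fun a => dh (transport w c (hz c' + a *: e)) * gfun w c (hz c' + a *: e)).
  by move=> a; rewrite mulf_neq0// gt_eqF// gfun_gt0.
move=> a; have dT := transport_is_derive Hw tU e (ov a).
have UX : U (hz c' + a *: e) by apply: tU; exact/otube_sub/ov.
rewrite (ip_e Hw UX) mulr1 in dT.
have [d1 dE] := is_derive_comp1 (hd (transport w c (hz c' + a *: e))) dT.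
by rewrite -dE; exact: is_derive_line.
Qed.

Lemma first_integral_regular : class_C r.+1 U f.
Proof.
apply: class_C_local oU _ => c Uc.
have gc := good_slice_all Uc; have [rho r0 [tU _ fE]] := slice_local Uc gc.
exists (otube c rho), ((fun a => f (hz c + a *: e)) \o transport w c); split=> //.
- exact: otube_open.
- exact: otube_center.
- by have [Sh _] := gc; apply: class_C_comp Sh (transport_regular Hw tU Cw); exact: otube_open.
Qed.

(** The chain rule in the local factorization makes the differential a multiple of [ip w c]; the
    direction [e], where this pairing is [1], identifies the multiple. *)
Lemma first_integral_derive c : U c -> 'D_e f c != 0 /\
  forall u, 'D_u f c = 'D_e f c * ip w c u.
Proof.
move=> Uc; have gc := good_slice_all Uc.
have [rho r0 [tU _ fE]] := slice_local Uc gc; have [_ [dh dh0 hd]] := gc.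
have oc := otube_center c r0.
have D_E u : 'D_u f c = dh (transport w c c) * (gfun w c c * ip w c u).
  have dT := transport_is_derive Hw tU u oc.
  have [_ <-] := is_derive_comp1 (hd (transport w c c)) dT.
  apply: near_eq_derive; near=> y; apply: fE; near: y.
  by apply: open_nbhs_nbhs; split=> //; exact: otube_open.
rewrite !D_E (ip_e Hw Uc) mulr1; split.
  by rewrite mulf_neq0// gt_eqF// gfun_gt0.
by move=> u; rewrite D_E mulrA.
Unshelve. all: by end_near. Qed.

End FirstIntegral.

Lemma quotient_integrable_normal (R : realType) (n : nat) (D : set 'rV[R]_n)
  (v : 'rV[R]_n.+1 -> 'rV[R]_n.+1) (C : R) : open D ->
  class_C 1 (cylinder D) v ->
  (forall x, cylinder D x -> v x 0 ord_max != 0) ->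
  (forall i x, cylinder D x -> `|v x 0 i / v x 0 ord_max| <= C) ->
  integrable_form (cylinder D) (one_form v) ->
  integrable_normal (cylinder D) (fun i x => v x 0 i / v x 0 ord_max) C.
Proof.
move=> oD Cv v0 vC hint; have oU := cylinder_open oD.
set w := fun i x => _.
have Cvi i : class_C 1 (cylinder D) (fun x => v x 0 i) by exact: class_C_vec_coord.
have Cw i : class_C 1 (cylinder D) (w i).
  by apply: class_CM => //; exact: class_C_inv.
have pairE x u : cylinder D x -> pairing v x u = v x 0 ord_max * ip w x u.
  move=> Ux; rewrite /pairing /ip mulr_sumr; apply: eq_bigr => k _.
  by rewrite /w mulrA [_ * (_ / _)]mulrC divfK// v0.
split=> //.
- by move=> x a; rewrite /cylinder/= -!/(base _) base_vert.
- by move=> x Ux; rewrite /w divff// v0.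
move=> x p q Ux p0 q0.
(* In the product rule the term with the derivative of the last coefficient carries the factor
   [ip w x u'], which vanishes; on the kernel, normalization therefore only rescales the exterior
   derivative. *)
have dpair u u' : ip w x u' = 0 ->
    'D_u (fun y => pairing v y u') x = v x 0 ord_max * dip w x u u'.
  move=> u'0.
  have d1 : is_derive x u (fun y => v y 0 ord_max) (ddir (fun y => v y 0 ord_max) x u).
    exact: class_C1_is_derive oU _ Ux.
  have d2 : is_derive x u (fun y => ip w y u') (dip w x u u').
    have d2 k : is_derive x u (w k) (ddir (w k) x u) by exact: class_C1_is_derive oU _ Ux.
    have : is_derive x u (\sum_k (u' 0 k *: w k)) (\sum_k (u' 0 k *: ddir (w k) x u)).
      by apply: is_derive_sum => k; have ? := d2 k; exact: is_deriveZ.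
    congr is_derive; apply/funext => y; rewrite fct_sumE.
    by apply: eq_bigr => k _; rewrite mulrC.
  have [_] := is_deriveM d1 d2; rewrite u'0 scale0r addr0 => h; apply: etrans h.
  by apply: near_eq_derive; near=> y; apply: pairE; near: y; exact: open_nbhs_nbhs.
(* [evert] is the transverse vector: its pairing is the last coefficient of [v], which is nonzero
   and can be cancelled. *)
have h : pairing v x evert * curl v x p q = 0.
  by apply: wedge_curl; rewrite ?pairE ?p0 ?q0 ?mulr0//; exact: hint.
move: h; rewrite pairE// (_ : ip w x evert = 1) ?mulr1; last first.
  by rewrite /ip sum_delta /w divff// v0.
move/eqP; rewrite mulf_eq0 (negbTE (v0 _ Ux))/= /curl !dpair// -mulrBr.
by rewrite mulf_eq0 (negbTE (v0 _ Ux))/= subr_eq0 => /eqP.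
Unshelve. all: by end_near. Qed.

Theorem theorem6p10 (R : realType) (n r : nat) (hr : (1 <= r)%N)
  (D : set 'rV[R]_n) (hD : domain D) (hsc : simply_connected D)
  (v : 'rV[R]_n.+1 -> 'rV[R]_n.+1)
  (hv : class_C r (cylinder D) v)
  (hv0 : forall x, cylinder D x -> v x 0 ord_max != 0)
  (hbound : exists C : R, forall i x, cylinder D x ->
     `|v x 0 i / v x 0 ord_max| <= C)
  (hint : integrable_form (cylinder D) (one_form v)) :
  exists f lambda : 'rV[R]_n.+1 -> R,
    [/\ class_C r (cylinder D) f,
        class_C r.-1 (cylinder D) lambda,
        (forall x, cylinder D x -> lambda x != 0) &
        (forall x, cylinder D x -> forall V,
           extd (form0 f) x V = lambda x * one_form v x V)].
Proof.
case: r hr hv => [//|r] _ hv; have [C hC] := hbound.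
have [oD [y0 Dy0] _] := hD; have [_ lD] := hsc.
have oU := cylinder_open oD.
have Hw := quotient_integrable_normal oD (class_C_le (ltn0Sn r) hv) hv0 hC hint.
set w := fun i x => _ in Hw.
have Cvi i : class_C r.+1 (cylinder D) (fun x => v x 0 i) by exact: class_C_vec_coord.
have Cw i : class_C r.+1 (cylinder D) (w i).
  by apply: class_CM => //; exact: class_C_inv.
have U0 : cylinder D (lift0 y0) by rewrite /cylinder/= -/(base _) lift0K.
pose f := first_integral D w (lift0 y0).
have Cf : class_C r.+1 (cylinder D) f by exact: (first_integral_regular hD lD Hw Cw U0).
have fD := first_integral_derive hD lD Hw Cw U0.
(* The differential of [f] is ['D_evert f x] times the normalized form, and normalization divided by
   the last coefficient; [lambda] collects both factors and loses one order through the
   derivative. *)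
exists f, (fun x => 'D_evert f x / v x 0 ord_max); split=> //.
- apply: class_CM => //; first exact: class_C_partial.
  by apply: class_C_inv => //; exact: class_CW.
- by move=> x Ux; have [d0 _] := fD x Ux; rewrite mulf_neq0// invr_neq0// hv0.
move=> x Ux V; have [_ dE] := fD x Ux.
rewrite /extd big_ord1 expr0 mul1r /form0 dE -mulrA; congr (_ * _).
rewrite one_formE /pairing mulr_sumr; apply: eq_bigr => k _.
by rewrite /w mxE mulrAC mulrC mulrA.
Qed.
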